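(* For $n\in\mathbb N$ and $\sigma^2>0$ let $\mathbb P_{\sigma^2}$ denote the law of the observations in the following model: $W$ is a standard Brownian motion on $[0,1]$, $X_t=\sigma W_t$, and conditionally on $(X_t)_{t\in[0,1]}$ one observes a Poisson point process on $[0,1]\times\mathbb R$ with intensity density $\lambda_{t,y}=n\,\mathbf 1(y\ge X_t)$ with respect to $dt\,dy$. Then for each $\sigma_0^2>0$ there exists $\delta>0$ such that $$\liminf_{n\to\infty}\ \inf_{\hat\sigma_n^2}\ \max_{\sigma^2\in\{\sigma_0^2,\ \sigma_0^2+\delta n^{-1/3}\}}\mathbb P_{\sigma^2}\Big(|\hat\sigma_n^2-\sigma^2|\ge \tfrac{\delta}{2}\,n^{-1/3}\Big)>0,$$ where the infimum extends over all estimators $\hat\sigma_n^2$ (real-valued measurable functions of the observed point process).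
   Context: The observation consists only of the point process; $X$ (equivalently $W$) itself is not observed, and the law $\mathbb P_{\sigma^2}$ of the point process is the mixture over $X$ of the conditional Poisson laws. *)

(* Defs.v *)
From HB Require Import structures.
From mathcomp Require Import all_boot all_order all_algebra.
From mathcomp Require Import all_classical all_reals all_analysis.
From mathcomp Require Import measurable_realfun.

Set Implicit Arguments.
Unset Strict Implicit.
Unset Printing Implicit Defensive.

Import Order.TTheory GRing.Theory Num.Theory.
Import numFieldNormedType.Exports.

Local Open Scope classical_set_scope.
Local Open Scope ring_scope.

Section configurations.
Context (R : realType).

Definition strip : set (R * R) := `[0, 1] `*` [set: R].

(* A realisation of a point process on [0,1] x R, as the counting measure
   A |-> #(points in A): a Borel measure on the plane carried by the strip and
   taking finite integer values on bounded Borel sets. *)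
Record configuration := Configuration {
  count_of :> {measure set (R * R) -> \bar R} ;
  count_strip : count_of (~` strip) = 0%E ;
  count_nat : forall A : set (R * R), measurable A -> bounded_set A ->
    exists k : nat, count_of A = k%:R%:E }.

Lemma empty_count_nat (A : set (R * R)) : measurable A -> bounded_set A ->
  exists k : nat, (mzero : {measure set (R * R) -> \bar R}) A = k%:R%:E.
Proof. by move=> _ _; exists 0%N. Qed.

Definition empty_configuration : configuration :=
  @Configuration mzero erefl empty_count_nat.

HB.instance Definition _ := gen_eqMixin configuration.
HB.instance Definition _ := gen_choiceMixin configuration.
HB.instance Definition _ := isPointed.Build configuration empty_configuration.

(* The observation space carries the sigma-algebra generated by the counting
   maps N |-> N A, for A Borel. *)
Definition count_events : set (set configuration) :=
  [set E | exists A : set (R * R), exists Y : set (\bar R),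
     [/\ measurable A, measurable Y & E = [set N : configuration | Y (N A)]]].

Definition observation := g_sigma_algebraType count_events.

End configurations.

Arguments strip {R}.

Section model.
Context (R : realType).

(* Standard Brownian motion on [0,1]; the values of W outside of [0,1] are
   irrelevant. *)
Record brownian_motion d (Om : measurableType d) (P : probability Om R)
    (W : R -> Om -> R) : Prop := BrownianMotion {
  bm_measurable : forall t : R, 0 <= t <= 1 -> measurable_fun [set: Om] (W t) ;
  bm_start : {ae P, forall w, W 0 w = 0} ;
  bm_gaussian : forall (s t : R) (B : set R), 0 <= s -> s < t -> t <= 1 ->
    measurable B ->
    P [set w | B (W t w - W s w)] = normal_prob 0 (Num.sqrt (t - s)) B ;
  bm_independent : forall (k : nat) (t : nat -> R) (B : nat -> set R),
    0 <= t 0%N -> t k <= 1 -> (forall i, (i < k)%N -> t i < t i.+1) ->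
    (forall i, (i < k)%N -> measurable (B i)) ->
    P [set w | forall i, (i < k)%N -> B i (W (t i.+1) w - W (t i) w)] =
    (\prod_(i < k) P [set w | B i (W (t i.+1) w - W (t i) w)%R])%E ;
  bm_continuous : {ae P, forall w, {within `[0, 1], continuous (W ^~ w)}} }.

(* The library's poisson_pmf is 1 for every k at rate 0; the rate 0 is needed
   here (regions below the path), where the mass is 1 at k = 0 and 0 elsewhere
   since 0 ^+ 0 = 1. *)
Definition poisson_mass (r : R) (k : nat) : R :=
  r ^+ k / k`!%:R * expR (- r).

(* Law of a Poisson point process with (locally finite) intensity measure L:
   counts of disjoint bounded Borel sets are independent Poisson variables. *)
Definition poisson_process_law (L : set (R * R) -> \bar R)
    (Q : set (observation R) -> \bar R) : Prop :=
  forall (k : nat) (A : nat -> set (R * R)) (m : nat -> nat),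
    (forall i, (i < k)%N -> measurable (A i)) ->
    (forall i, (i < k)%N -> bounded_set (A i)) ->
    trivIset `I_k A ->
    Q [set N | forall i, (i < k)%N -> (N : configuration R) (A i) = (m i)%:R%:E]
    = (\prod_(i < k) poisson_mass (fine (L (A i))) (m i))%:E.

Definition intensity (n : nat) (X : R -> R) (A : set (R * R)) : \bar R :=
  (\int[lebesgue_measure \x lebesgue_measure]_(z in A `&` strip)
     (n%:R * (X z.1 <= z.2)%R%:R)%:E)%E.

(* Q is the law of the observations with volatility s2 = sigma^2: the mixture,
   over the path X = sigma W, of the Poisson laws K w with density
   n 1(y >= X_t).  Only the law Q of the point process is retained. *)
Definition observation_law (n : nat) (s2 : R)
    (Q : probability (observation R) R) : Prop :=
  exists (d : measure_display) (Om : measurableType d) (P : probability Om R)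
         (W : R -> Om -> R) (K : R.-pker Om ~> observation R),
    [/\ brownian_motion P W,
        {ae P, forall w, poisson_process_law
                 (intensity n (fun t => Num.sqrt s2 * W t w)) (K w)} &
        forall E : set (observation R), measurable E ->
          Q E = (\int[P]_w K w E)%E].

End model.

(* Main.v *)
(* It suffices to bound below the sum of the two errors of a test E between
   s0^2 and s1^2 = (1 + eta) s0^2, where eta is of order delta n^(-1/3).  Up to
   a small probability E depends on finitely many counts.  Cut the time interval
   into 2^L slabs and freeze the path at the left end of each slab: as L grows,
   the law of the counts given the path changes by a total variation tending to
   0, since the path is uniformly continuous.  The counts now depend on a
   Gaussian random walk only; sampling it by successive midpoints writes their
   law as a binary tree of Gaussian mixtures.  On an interval of length l, moving
   the path by x changes the likelihood of the counts by a factor at most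
   exp(n l |x|), and the midpoint has standard deviation of order sqrt l; hence
   replacing s0 by s1 at this midpoint costs a squared Hellinger distance at most
   of order eta^2 min(1, n l^(3/2)).  There are 1/l intervals of length l, and
   the sum over dyadic l is dominated by l = n^(-2/3): it is at most of order
   eta^2 n^(2/3), that is delta^2, and does not depend on L. *)
Require Import Defs.
From HB Require Import structures.
From mathcomp Require Import all_boot all_order all_algebra.
From mathcomp Require Import all_classical all_reals all_analysis.
From mathcomp Require Import measurable_realfun.
From mathcomp Require Import zify ring lra.

Set Implicit Arguments.
Unset Strict Implicit.
Unset Printing Implicit Defensive.

Import Order.TTheory GRing.Theory Num.Theory.
Import numFieldNormedType.Exports.

Local Open Scope classical_set_scope.
Local Open Scope ring_scope.

(** * Hellinger distance on finite types *)

(** The laws of the path under two distinct volatilities are mutually singular, so comparing paths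
    gives nothing: only the smoothing by the Poisson noise brings the laws of the counts together,
    and it enters through the factor [Num.min 1 _] that discounts the fine scales. Squared Hellinger
    distance is used because it is subadditive over independent halves, jointly convex under mixing
    and the square of a metric; each level of the tree uses all three properties. The exponential
    bound on likelihoods holds in one direction only. Raising the path removes intensity, so the law
    at the higher path is dominated by the law at the lower one; conversely, points between the two
    paths are possible for the lower path and impossible for the higher one. Bounds in total
    variation, and even measurability in the path, are derived from this one-sided domination.
    Counts are capped so that their laws live on finite types. *)

Section hellinger.
Context (R : realType).

Lemma pmf_le1 (F : finType) (p : F -> R) (f : F) :
  (forall f, 0 <= p f) -> \sum_f p f = 1 -> p f <= 1.
Proof. by move=> p0 <-; rewrite (bigD1 f)//= lerDl; exact: sumr_ge0. Qed.

(* Twice the squared Hellinger distance. *)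
Definition hell (F : finType) (p q : F -> R) : R :=
  \sum_f (Num.sqrt (p f) - Num.sqrt (q f)) ^+ 2.

Lemma hell_ge0 (F : finType) (p q : F -> R) : 0 <= hell p q.
Proof. by apply: sumr_ge0 => f _; exact: sqr_ge0. Qed.

Lemma hell_refl (F : finType) (p : F -> R) : hell p p = 0.
Proof. by rewrite /hell big1// => f _; rewrite subrr expr0n. Qed.

Lemma le_add_epsM (x y c : R) : 0 <= c -> (forall e, 0 < e -> x <= y + c * e) ->
  x <= y.
Proof.
move=> c0 H; rewrite leNgt; apply/negP => yx.
have := H ((x - y) / (2 * (c + 1))) _.
rewrite divr_gt0 ?subr_gt0// ?mulr_gt0//; last lra.
move=> /(_ isT).
have -> : c * ((x - y) / (2 * (c + 1))) = (x - y) * (c / (2 * (c + 1))).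
  by field; apply/eqP; lra.
have : c / (2 * (c + 1)) <= 2^-1.
  by rewrite ler_pdivrMr; [rewrite mulrA mulVf ?mul1r//; lra|lra].
move: (c / _) => r r2.
have : (x - y) * r <= (x - y) / 2 by rewrite ler_wpM2l//; lra.
lra.
Qed.

(** Minkowski's inequality for the vectors of square roots, phrased with radii. The weighted form of
    the square of a sum divides by the radii, so it is applied to [a + e] and [b + e], and [e] is
    then removed. *)
Lemma hell_triangle (F : finType) (p q r : F -> R) (a b : R) :
  0 <= a -> 0 <= b -> hell p q <= a ^+ 2 -> hell q r <= b ^+ 2 ->
  hell p r <= (a + b) ^+ 2.
Proof.
move=> a0 b0 pq qr.
have key (a' b' : R) : 0 < a' -> 0 < b' -> hell p q <= a' ^+ 2 ->
    hell q r <= b' ^+ 2 -> hell p r <= (a' + b') ^+ 2.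
  move=> ha hb pq' qr'.
  have : hell p r <= (1 + b' / a') * hell p q + (1 + a' / b') * hell q r.
    rewrite /hell !mulr_sumr -big_split/=; apply: ler_sum => f _.
    set x := Num.sqrt (p f); set y := Num.sqrt (q f); set z := Num.sqrt (r f).
    rewrite -subr_ge0.
    have -> : (1 + b' / a') * (x - y) ^+ 2 + (1 + a' / b') * (y - z) ^+ 2
              - (x - z) ^+ 2 = (b' * (x - y) - a' * (y - z)) ^+ 2 / (a' * b').
      by field; rewrite !gt_eqF.
    by rewrite divr_ge0 ?sqr_ge0// mulr_ge0// ltW.
  move=> /le_trans; apply.
  have -> : (a' + b') ^+ 2 = (1 + b' / a') * a' ^+ 2 + (1 + a' / b') * b' ^+ 2.
    by field; rewrite !gt_eqF.
  by apply: lerD; rewrite ler_wpM2l// addr_ge0// divr_ge0// ltW.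
have H e : 0 < e -> hell p r <= (a + b + 2 * e) ^+ 2.
  move=> e0; have -> : a + b + 2 * e = (a + e) + (b + e) by ring.
  apply: key; [lra|lra| |].
    by rewrite (le_trans pq)// lerXn2r ?nnegrE//; lra.
  by rewrite (le_trans qr)// lerXn2r ?nnegrE//; lra.
rewrite -(@ler_sqrt _ _ ((a + b) ^+ 2)) ?sqr_ge0//.
rewrite sqrtr_sqr ger0_norm ?addr_ge0//.
apply: (@le_add_epsM _ _ 2) => // e e0.
have := H e e0; rewrite -ler_sqrt ?sqr_ge0// sqrtr_sqr ger0_norm//.
by rewrite !addr_ge0// mulr_ge0// ltW.
Qed.

Lemma hellE (F : finType) (p q : F -> R) : (forall f, 0 <= p f) ->
  (forall f, 0 <= q f) -> \sum_f p f = 1 -> \sum_f q f = 1 ->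
  hell p q = 2 - 2 * \sum_f Num.sqrt (p f) * Num.sqrt (q f).
Proof.
move=> p0 q0 p1 q1; rewrite /hell.
under eq_bigr do rewrite sqrrB !sqr_sqrtr// addrAC.
rewrite big_split/= big_split/= p1 q1 sumrN.
by under [in LHS]eq_bigr do rewrite -mulr_natl; rewrite -mulr_sumr; ring.
Qed.

Definition prodlaw (F1 F2 : finType) (p1 : F1 -> R) (p2 : F2 -> R)
  (f : F1 * F2) : R := p1 f.1 * p2 f.2.

Lemma sum_prodlaw (F1 F2 : finType) (p1 : F1 -> R) (p2 : F2 -> R) :
  \sum_f prodlaw p1 p2 f = (\sum_f p1 f) * \sum_f p2 f.
Proof.
rewrite mulr_suml (eq_bigr (fun f1 => \sum_f2 p1 f1 * p2 f2)); last first.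
  by move=> f1 _; rewrite mulr_sumr.
by rewrite pair_big/=; apply: eq_bigr => -[].
Qed.

(** Affinities multiply under products. If [x] and [y] are the two affinities, the inequality says
    that [(1 - x) * (1 - y)] is nonnegative. *)
Lemma hell_prod (F1 F2 : finType) (p1 q1 : F1 -> R) (p2 q2 : F2 -> R) :
  (forall f, 0 <= p1 f) -> (forall f, 0 <= q1 f) ->
  (forall f, 0 <= p2 f) -> (forall f, 0 <= q2 f) ->
  \sum_f p1 f = 1 -> \sum_f q1 f = 1 -> \sum_f p2 f = 1 -> \sum_f q2 f = 1 ->
  hell (prodlaw p1 p2) (prodlaw q1 q2) <= hell p1 q1 + hell p2 q2.
Proof.
move=> p10 q10 p20 q20 sp1 sq1 sp2 sq2.
have H1 := hellE p10 q10 sp1 sq1; have H2 := hellE p20 q20 sp2 sq2.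
rewrite (@hellE _ (prodlaw p1 p2)) ?sum_prodlaw ?sp1 ?sp2 ?sq1 ?sq2 ?mulr1//;
  [|by move=> f; rewrite mulr_ge0..].
rewrite (eq_bigr (prodlaw (fun f => Num.sqrt (p1 f) * Num.sqrt (q1 f))
    (fun f => Num.sqrt (p2 f) * Num.sqrt (q2 f)))); last first.
  by move=> f _; rewrite /prodlaw !sqrtrM//; ring.
rewrite sum_prodlaw.
move: H1 H2 (hell_ge0 p1 q1) (hell_ge0 p2 q2).
move: (\sum_f _) => x; move: (\sum_f _) => y -> -> hx hy.
have := mulr_ge0 hx hy; nra.
Qed.

(** Le Cam's inequality: the squared affinity is at most the sum of the minima times the sum of the
    maxima, and these two sums add up to 2. Cauchy-Schwarz is replaced by AM-GM with a weight
    depending on the affinity [r >= 1/2], which gives overlap at least [r ^+ 2 / 2]. *)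
Lemma overlap_ge (F : finType) (p q : F -> R) : (forall f, 0 <= p f) ->
  (forall f, 0 <= q f) -> \sum_f p f = 1 -> \sum_f q f = 1 ->
  hell p q <= 1 -> 8^-1 <= \sum_f Num.min (p f) (q f).
Proof.
move=> p0 q0 sp sq; rewrite (hellE p0 q0 sp sq).
set r := \sum_f Num.sqrt _ * _ => h1.
have r0 : 2^-1 <= r by lra.
have rp : 0 < r by lra.
set m := \sum_f _.
suff : r <= m / r + r / 2.
  move=> H; have : r / 2 <= m / r by lra.
  rewrite ler_pdivlMr// => H2.
  have : 2^-1 * 2^-1 <= r * r by apply: ler_pM => //; lra.
  move: H2; have -> : r / 2 * r = r * r / 2 by ring.
  lra.
have sM : m + \sum_f Num.max (p f) (q f) = 2.
  rewrite -big_split/= (eq_bigr (fun f => p f + q f)); last first.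
    by move=> f _; rewrite addr_min_max.
  by rewrite big_split/= sp sq.
have m0 : 0 <= m by apply: sumr_ge0 => f _; rewrite le_min p0 q0.
have -> : r / 2 = r * 2 / 4 by field.
rewrite -sM mulrDr mulrDl.
suff : r <= m / r + \sum_f r * Num.max (p f) (q f) / 4.
  have : 0 <= r * m / 4 by rewrite !mulr_ge0// ltW.
  by rewrite -mulr_suml -mulr_sumr; lra.
rewrite {1}/r /m mulr_suml -big_split/=; apply: ler_sum => f _.
have -> : Num.sqrt (p f) * Num.sqrt (q f) =
   Num.sqrt (Num.min (p f) (q f)) * Num.sqrt (Num.max (p f) (q f)).
  by case: (leP (p f) (q f)) => // _; rewrite mulrC.
have mf0 : 0 <= Num.min (p f) (q f) by rewrite le_min p0 q0.
have Mf0 : 0 <= Num.max (p f) (q f) by rewrite le_max p0.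
have := sqr_sqrtr mf0; have := sqr_sqrtr Mf0.
move: (Num.sqrt (Num.max _ _)) (Num.sqrt (Num.min _ _)) => y x <- <-.
rewrite -subr_ge0.
have -> : x ^+ 2 / r + r * y ^+ 2 / 4 - x * y = (x - r * y / 2) ^+ 2 / r.
  by field; rewrite gt_eqF.
by rewrite divr_ge0 ?sqr_ge0// ltW.
Qed.

(** Cauchy-Schwarz from a family of AM-GM bounds, a form that passes through integrals by linearity.
    The choice [t = x / (2 * a)] avoids the square root of the optimal [t]; for [a = 0] a large [t]
    forces a contradiction. *)
Lemma sqr_le_of_amgm (x a b : R) : 0 <= x -> 0 <= a -> 0 <= b ->
  (forall t, 0 < t -> x <= t * a + b / t) -> x ^+ 2 <= 4 * (a * b).
Proof.
rewrite le_eqVlt => /orP[/eqP<- a0 b0 _|x0 a0 b0 H].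
  by rewrite expr0n/= mulr_ge0// mulr_ge0.
move: a0; rewrite le_eqVlt => /orP[/eqP a0|a0].
  have t0 : 0 < (2 * b + 1) / x by rewrite divr_gt0//; lra.
  have := H _ t0; rewrite -a0 mulr0 add0r.
  have -> : b / ((2 * b + 1) / x) = b * x / (2 * b + 1).
    by field; rewrite !gt_eqF//; lra.
  by rewrite ler_pdivlMr; [nra|lra].
have t0 : 0 < x / (2 * a) by rewrite divr_gt0// mulr_gt0.
have := H _ t0.
have -> : x / (2 * a) * a + b / (x / (2 * a)) = x / 2 + 2 * (a * b) / x.
  by field; rewrite !gt_eqF.
move=> /(ler_wpM2r (ltW x0)); rewrite mulrDl divfK ?gt_eqF//.
by rewrite expr2; lra.
Qed.

(** Hellinger is controlled by chi-square: [p - q] factors through the sum of the square roots,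
    whose square is at least [p]. *)
Lemma sqrt_diff_le (p q x : R) : 0 <= p -> 0 <= q -> 0 <= x ->
  (p - q) ^+ 2 <= p * x -> (Num.sqrt p - Num.sqrt q) ^+ 2 <= x.
Proof.
move=> p0 q0 x0 H; have := p0; rewrite le_eqVlt => /orP[/eqP p00|pp].
  move: H; rewrite -p00 mul0r sub0r sqrrN sqrtr0 sub0r sqrrN => H.
  have /eqP : q ^+ 2 = 0 by apply/eqP; rewrite eq_le H sqr_ge0.
  by rewrite expf_eq0/= => /eqP ->; rewrite sqrtr0 expr0n.
rewrite -(ler_pM2l pp) (le_trans _ H)//.
have := sqr_sqrtr p0; have := sqr_sqrtr q0.
have := sqrtr_ge0 p; have := sqrtr_ge0 q.
move: (Num.sqrt p) (Num.sqrt q) => a b b0 a0 <- <-.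
rewrite subr_sqr exprMn mulrC ler_wpM2l ?sqr_ge0//.
by rewrite lerXn2r ?nnegrE ?addr_ge0// lerDl.
Qed.

End hellinger.

(** * Bounded measurable integrands and changes of density *)

Section integration.
Context d (T : measurableType d) (R : realType).

Lemma probability_integrable (P : probability T R) (f : T -> R) (M : R) :
  measurable_fun [set: T] f -> (forall x, `|f x| <= M) ->
  P.-integrable [set: T] (EFin \o f).
Proof.
move=> mf fM; apply: measurable_bounded_integrable => //.
  by rewrite (le_lt_trans (probability_le1 P _))// ltry.
by exists M; split; [exact: num_real|move=> x Mx y _; exact: le_trans (ltW Mx)].
Qed.

Definition bounded_measurable (f : T -> R) :=
  measurable_fun [set: T] f /\ exists M, forall x, `|f x| <= M.

Lemma bounded_measurable_integrable (P : probability T R) (f : T -> R) :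
  bounded_measurable f -> P.-integrable [set: T] (EFin \o f).
Proof. by move=> [mf [M fM]]; exact: probability_integrable fM. Qed.

Lemma bounded_measurable_cst (c : R) : bounded_measurable (fun=> c).
Proof. by split => //; exists `|c|. Qed.

Lemma bounded_measurableD (f g : T -> R) :
  bounded_measurable f -> bounded_measurable g ->
  bounded_measurable (fun x => f x + g x).
Proof.
move=> [mf [M fM]] [mg [N gN]]; split; first exact: measurable_funD.
by exists (M + N) => x; rewrite (le_trans (ler_normD _ _))// lerD.
Qed.

Lemma bounded_measurableN (f : T -> R) :
  bounded_measurable f -> bounded_measurable (fun x => - f x).
Proof.
move=> [mf [M fM]]; split; first exact: measurableT_comp.
by exists M => x; rewrite normrN.
Qed.

Lemma bounded_measurableM (f g : T -> R) :
  bounded_measurable f -> bounded_measurable g ->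
  bounded_measurable (fun x => f x * g x).
Proof.
move=> [mf [M fM]] [mg [N gN]]; split; first exact: measurable_funM.
by exists (M * N) => x; rewrite normrM ler_pM.
Qed.

Lemma bounded_measurable_norm (f : T -> R) :
  bounded_measurable f -> bounded_measurable (fun x => `|f x|).
Proof.
move=> [mf [M fM]]; split; first exact: measurableT_comp.
by exists M => x; rewrite normr_id.
Qed.

Lemma Rintegral_sum (mu : {measure set T -> \bar R}) (I : Type) (r : seq I)
    (f : I -> T -> R) :
  (forall i, mu.-integrable [set: T] (EFin \o f i)) ->
  \int[mu]_x (\sum_(i <- r) f i x) = \sum_(i <- r) \int[mu]_x f i x.
Proof.
move=> fi; rewrite /Rintegral.
under eq_integral do rewrite -sumEFin.
rewrite (integral_sum measurableT (fun i => fi i)) -sum_fine// => i _.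
exact: integrable_fin_num.
Qed.

Lemma Rintegral_probability_cst (P : probability T R) (c : R) :
  \int[P]_x c = c.
Proof.
rewrite /Rintegral; have := @integral_cst _ _ _ P _ measurableT c%:E.
have PT : P [set: T] = 1%E by exact: probability_setT.
move=> ->; transitivity (fine (c%:E * 1)); last by rewrite mule1.
by congr (fine (_ * _)%E).
Qed.

Import HBNNSimple.

(** The hypothesis on [nu] is the case of indicators; simple functions follow by linearity and the
    general case by monotone convergence on both sides. *)
Lemma ge0_integral_density (mu nu : {measure set T -> \bar R}) (p : T -> R)
    (f : T -> \bar R) :
  measurable_fun [set: T] p -> (forall x, 0 <= p x) ->
  (forall A, measurable A -> nu A = (\int[mu]_(x in A) (p x)%:E)%E) ->
  measurable_fun [set: T] f -> (forall x, 0 <= f x)%E ->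
  (\int[nu]_x f x = \int[mu]_x (f x * (p x)%:E))%E.
Proof.
move=> mp p0 nuE mf f0.
pose g := nnsfun_approx measurableT mf.
have gf (x : T) : (g n x)%:E @[n --> \oo] --> f x.
  exact: cvg_nnsfun_approx.
have g_nd (a : T) : {homo (fun n => (g n a)%:E) : n m / (n <= m)%N >-> (n <= m)%E}.
  by move=> n m nm; rewrite lee_fin; have /lefP := nd_nnsfun_approx measurableT mf nm; apply.
have gn n : (\int[nu]_x (g n x)%:E = \int[mu]_x ((g n x)%:E * (p x)%:E))%E.
  under eq_integral do rewrite fimfunE -fsumEFin//.
  rewrite ge0_integral_fsum//; last 2 first.
    by move=> r; exact/measurable_EFinP/measurableT_comp.
    by move=> r x _; rewrite nnfun_muleindic_ge0.
  transitivity (\int[mu]_x (\sum_(r \in range (g n))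
      ((r * \1_(g n @^-1` [set r]) x)%:E * (p x)%:E)))%E; last first.
    apply: eq_integral => x _; rewrite fimfunE -fsumEFin// ge0_mule_fsuml//.
    by move=> r; rewrite nnfun_muleindic_ge0.
  rewrite ge0_integral_fsum//; last 2 first.
    move=> r; apply: emeasurable_funM; last exact/measurable_EFinP.
    by apply/measurable_EFinP/measurable_funM => //.
    move=> r x _; apply: mule_ge0; last by rewrite lee_fin.
    by rewrite EFinM nnfun_muleindic_ge0.
  apply: eq_fsbigr => r rg.
  rewrite integralZl_indic_nnsfun//= integral_indic// setIT nuE//.
  have [r0|r0] := leP 0 r.
    under [RHS]eq_integral do rewrite EFinM -muleA.
    rewrite ge0_integralZl//; last 2 first.
      apply: emeasurable_funM; last exact/measurable_EFinP.
      by apply/measurable_EFinP.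
      by move=> x _; rewrite mule_ge0 ?lee_fin.
    congr (_ * _)%E; rewrite [LHS]integral_mkcond; apply: eq_integral => x _.
    rewrite patchE indicE; case: ifPn => _; rewrite ?mul1e ?mul0e//.
  rewrite preimage_nnfun0// integral_set0 mule0.
  by rewrite integral0_eq// => x _; rewrite indic0 mulr0 mul0e.
have nuf : (\int[nu]_x (g n x)%:E)%E @[n --> \oo] --> (\int[nu]_x f x)%E.
  rewrite (_ : (\int[nu]_x f x)%E = (\int[nu]_x limn (fun n => (g n x)%:E))%E);
    last by apply: eq_integral => x _; apply/esym/cvg_lim => //; exact: gf.
  apply: cvg_monotone_convergence => //.
  - by move=> n; exact/measurable_EFinP.
  - by move=> n x _; rewrite lee_fin.
have muf : (\int[mu]_x ((g n x)%:E * (p x)%:E))%E @[n --> \oo] -->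
    (\int[mu]_x (f x * (p x)%:E))%E.
  rewrite (_ : (\int[mu]_x (f x * (p x)%:E))%E =
    (\int[mu]_x limn (fun n => (g n x)%:E * (p x)%:E))%E); last first.
    apply: eq_integral => x _; apply/esym/cvg_lim => //.
    by apply: cvgeZr => //; exact: gf.
  apply: cvg_monotone_convergence => //.
  - by move=> n; apply: emeasurable_funM; exact/measurable_EFinP.
  - by move=> n x _; rewrite mule_ge0 ?lee_fin.
  - by move=> x _ n m nm; rewrite lee_wpmul2r ?lee_fin// -lee_fin; exact: g_nd.
apply/esym/(cvg_unique _ muf) => //.
by move: nuf; under eq_fun do rewrite gn.
Qed.

End integration.

Section normal.
Context (R : realType).
Local Notation mu := (@lebesgue_measure R).

Lemma ge0_integral_normal_prob (m s : R) (f : R -> \bar R) :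
  measurable_fun [set: R] f -> (forall x, 0 <= f x)%E ->
  (\int[normal_prob m s]_x f x = \int[mu]_x (f x * (normal_pdf m s x)%:E))%E.
Proof.
move=> mf f0; apply: ge0_integral_density => //.
  exact: measurable_normal_pdf.
by move=> x; exact: normal_pdf_ge0.
Qed.

Lemma lebesgue_measureD (c : R) (A : set R) : measurable A ->
  pushforward mu (fun x : R => x + c : measurableTypeR R) A = mu A.
Proof.
move=> mA; apply/esym/lebesgue_measure_unique => //=.
  exact: measurable_funD.
move=> mf _ [[a b]] _ <-.
rewrite /pushforward.
rewrite (_ : _ @^-1` _ = [set` `]a - c, b - c]]); last first.
  by apply/seteqP; split => x /=; rewrite !in_itv/= ltrBlDr lerBrDr.
rewrite !lebesgue_measure_itv/= !lte_fin ltrD2r.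
by case: ifP => // _; rewrite -!EFinD opprB addrA subrK.
Qed.

Lemma ge0_integral_shift (c : R) (f : R -> \bar R) :
  measurable_fun [set: R] f -> (forall x, 0 <= f x)%E ->
  (\int[mu]_x f (x + c)%R = \int[mu]_x f x)%E.
Proof.
move=> mf f0; pose phi (x : measurableTypeR R) : measurableTypeR R := x + c.
have mphi : measurable_fun [set: measurableTypeR R] phi.
  exact: measurable_funD.
transitivity (\int[pushforward mu phi]_x f x)%E.
  by rewrite ge0_integral_pushforward//.
by apply: eq_measure_integral => A mA _; exact: lebesgue_measureD.
Qed.

End normal.

(** * Mixtures *)

Section domination.
Context (R : realType).

Lemma one_sub_expRN_le (x : R) : 0 <= x -> 1 - expR (- x) <= Num.min 1 x.
Proof.
move=> x0; rewrite le_min; apply/andP; split.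
  by rewrite gerBl expR_ge0.
by have := expR_ge1Dx (- x); lra.
Qed.

(** One direction of domination suffices: [|p - q|] is at most [p - q] plus twice a bound on the
    positive part of [q - p], and the terms [p - q] sum to zero. *)
Lemma total_variation_le (F : finType) (p q : F -> R) (D : R) :
  0 <= D -> (forall f, 0 <= q f) -> \sum_f p f = 1 -> \sum_f q f = 1 ->
  (forall f, q f <= expR D * p f) ->
  \sum_f `|p f - q f| <= 2 * Num.min 1 D.
Proof.
move=> D0 q0 p1 q1 qp.
apply: (@le_trans _ _ (2 * (1 - expR (- D)))); last first.
  by rewrite ler_wpM2l// one_sub_expRN_le.
have -> : 2 * (1 - expR (- D)) =
    \sum_f (2 * ((1 - expR (- D)) * q f) + (p f - q f)).
  by rewrite big_split/= -!mulr_sumr sumrB p1 q1 subrr addr0 mulr1.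
apply: ler_sum => f _.
have h : expR (- D) * q f <= p f.
  by rewrite -(ler_pM2l (expR_gt0 D)) mulrA -expRD subrr expR0 mul1r.
have h1 : 0 <= (1 - expR (- D)) * q f.
  by rewrite mulr_ge0// subr_ge0 -expR0 ler_expR oppr_le0.
rewrite ler_norml; apply/andP; split; last by lra.
by move: h; rewrite mulrBl; lra.
Qed.

(** Domination says that [expR (- (c * z)) * G z f] is nonincreasing in [z], and monotone functions
    are measurable. *)
Lemma dominated_measurable (F : Type) (G : R -> F -> R) (c : R) :
  (forall z z' f, z <= z' -> G z' f <= expR (c * (z' - z)) * G z f) ->
  forall f, measurable_fun [set: R] (G ^~ f).
Proof.
move=> dom f.
have -> : G ^~ f = (fun z => expR (c * z) * (expR (- (c * z)) * G z f)).
  by apply/funext => z; rewrite mulrA -expRD subrr expR0 mul1r.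
apply: measurable_funM.
  by apply: measurableT_comp => //; exact: measurable_funM.
apply: nonincreasing_measurable => // x y xy.
rewrite -(ler_pM2l (expR_gt0 (c * y))) !mulrA -!expRD subrr expR0 mul1r.
by rewrite -mulrBr; exact: dom.
Qed.

End domination.

(** * Tilting the mixing law by a density *)

Section tilting.
Context (R : realType) (F : finType).
Variables (gam : probability (measurableTypeR R) R) (G : R -> F -> R) (th s : R).
Hypotheses (th0 : 0 <= th) (s0 : 0 < s).
Hypothesis G0 : forall z f, 0 <= G z f.
Hypothesis G1 : forall z, \sum_f G z f = 1.
Hypothesis Gdom : forall z z' f, z <= z' ->
  G z' f <= expR (th * (z' - z)) * G z f.

Let Gle1 z f : G z f <= 1.
Proof. exact: pmf_le1. Qed.

Let mG f : measurable_fun [set: R] (G ^~ f).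
Proof. exact: dominated_measurable Gdom f. Qed.

Local Notation bm := (@bounded_measurable _ (measurableTypeR R) R).

Let bG f : bm (G ^~ f).
Proof. by split; [exact: mG|exists 1 => z; rewrite ger0_norm]. Qed.

Let bc (c : R) : bm (fun=> c).
Proof. exact: bounded_measurable_cst. Qed.

Let ib (g : R -> R) : bm g ->
  gam.-integrable [set: R] (EFin \o g).
Proof. exact: bounded_measurable_integrable. Qed.

Definition mixture (f : F) : R := \int[gam]_z G z f.
Definition tilted_mixture (q : R -> R) (f : F) : R := \int[gam]_z (G z f * q z).

Lemma mixture_ge0 f : 0 <= mixture f.
Proof. by apply: Rintegral_ge0. Qed.

Lemma sum_mixture : \sum_f mixture f = 1.
Proof.
rewrite -(Rintegral_probability_cst gam 1) -Rintegral_sum//; last by move=> f; apply: ib; exact: bG.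
by apply: eq_Rintegral => z _; rewrite G1.
Qed.

Let w (z : R) := 1 + `|z| / s.

Let w1 z : 1 <= w z.
Proof. by rewrite lerDl divr_ge0// ltW. Qed.

(** Domination bounds the distance by [2 * Num.min 1 (th * |z - y|)]. Since
    [|z - y| <= s * (w z * w y)] and [w >= 1], the variables separate and the scale [s] is all that
    remains inside the minimum. *)
Let tv z y : \sum_f `|G z f - G y f| <= 2 * Num.min 1 (th * s) * (w z * w y).
Proof.
wlog zy : z y / z <= y.
  move=> H; case: (leP z y) => [/H//|/ltW yz].
  by rewrite (mulrC (w z)) (le_trans _ (H _ _ yz))//; apply: ler_sum => f _; rewrite distrC.
apply: le_trans (total_variation_le _ _ _ _ (fun f => Gdom f zy)) _ => //.
  by rewrite mulr_ge0// subr_ge0.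
rewrite -mulrA ler_wpM2l//.
have ww : th * (y - z) <= th * s * (w z * w y).
  rewrite -mulrA ler_wpM2l//.
  have : y - z <= `|z| + `|y| by have := ler_norm y; have := ler_norm (- z); rewrite normrN; lra.
  have -> : s * (w z * w y) = s + `|z| + `|y| + `|z| * `|y| / s.
    by rewrite /w; field; rewrite gt_eqF.
  have : 0 <= `|z| * `|y| / s by rewrite divr_ge0 ?mulr_ge0// ltW.
  move: (_ / s) => u u0 h; move: s0; lra.
have w2 : 1 <= w z * w y by rewrite -[leLHS]mulr1 ler_pM.
rewrite minr_pMl; last by rewrite (le_trans _ w2).
by rewrite le_min !ge_min mul1r w2 ww/= orbT.
Qed.

Variable q : R -> R.
Variable M : R.
Hypotheses (mq : measurable_fun [set: R] q) (q0 : forall z, 0 <= q z <= M).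
Hypothesis q1 : \int[gam]_z q z = 1.
Hypothesis iw : gam.-integrable [set: R] (EFin \o w).
Hypothesis iwq : gam.-integrable [set: R] (EFin \o (fun z => w z * (q z - 1) ^+ 2)).

Local Notation p1 := mixture.
Local Notation p0 := (tilted_mixture q).
Let A f := \int[gam]_z (`|G z f - p1 f| * (q z - 1) ^+ 2).

Let bq : bm q.
Proof. by split; [exact: mq|exists M => z; rewrite ger0_norm; case/andP: (q0 z)]. Qed.

Let bGp f : bm (fun z => G z f - p1 f).
Proof. by apply: bounded_measurableD => //; exact: bounded_measurable_cst. Qed.

Let bq1 : bm (fun z => q z - 1).
Proof. by apply: bounded_measurableD => //; exact: bounded_measurable_cst. Qed.

Let bA f : bm (fun z => `|G z f - p1 f| * (q z - 1) ^+ 2).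
Proof.
by apply: bounded_measurableM; [exact: bounded_measurable_norm|exact: bounded_measurableM].
Qed.

Let A0 f : 0 <= A f.
Proof. by apply: Rintegral_ge0 => z _; rewrite mulr_ge0// sqr_ge0. Qed.

Lemma tilted_mixture_ge0 f : 0 <= p0 f.
Proof. by apply: Rintegral_ge0 => z _; rewrite mulr_ge0//; case/andP: (q0 z). Qed.

(** Since [q - 1] has mean zero, [G z f] can be centred at [p1 f] for free; the centring is what
    later yields a total variation distance. *)
Let diffE f : p1 f - p0 f = - \int[gam]_z ((G z f - p1 f) * (q z - 1)).
Proof.
have -> : \int[gam]_z ((G z f - p1 f) * (q z - 1)) =
    \int[gam]_z ((G z f * q z - G z f) - p1 f * (q z - 1)).
  by apply: eq_Rintegral => z _; ring.
have bGq : bm (fun z => G z f * q z) by exact: bounded_measurableM.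
have bpq : bm (fun z => p1 f * (q z - 1)).
  exact (bounded_measurableM (bc (p1 f)) bq1).
rewrite RintegralB//; [|exact: ib (bounded_measurableD bGq (bounded_measurableN (bG f)))|exact: (ib bpq)].
rewrite RintegralB//; [|exact: (ib bGq)|exact: (ib (bG f))].
rewrite RintegralZl//; last exact: (ib bq1).
rewrite RintegralB//; [|exact: (ib bq)|exact: (ib (bc _))].
by rewrite q1 Rintegral_probability_cst subrr mulr0 subr0 opprB.
Qed.

(** AM-GM under the weight [|G z f - p1 f|]. In the term without [q] this weight is at most
    [G z f + p1 f], whose mean is [2 * p1 f]; the other term keeps the weight and becomes [A f]. *)
Let diff_le f t : 0 < t -> `|p1 f - p0 f| <= t * (A f / 2) + p1 f / t.
Proof.
move=> t0; rewrite diffE normrN.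
have bprod := bounded_measurableM (bGp f) bq1.
apply: le_trans (le_normr_Rintegral _ _) _ => //; first exact: (ib bprod).
have bn := bounded_measurable_norm (bGp f).
have bs : bm (fun z => G z f + p1 f).
  exact (bounded_measurableD (bG f) (bc (p1 f))).
have b1 : bm (fun z => t / 2 * (`|G z f - p1 f| * (q z - 1) ^+ 2)).
  exact (bounded_measurableM (bc (t / 2)) (bA f)).
have b2 : bm (fun z => (2 * t)^-1 * (G z f + p1 f)).
  exact (bounded_measurableM (bc (2 * t)^-1) bs).
apply: (@le_trans _ _ (\int[gam]_z (t / 2 * (`|G z f - p1 f| * (q z - 1) ^+ 2)
     + (2 * t)^-1 * (G z f + p1 f)))).
  apply: le_Rintegral => //.
  - exact: (ib (bounded_measurable_norm bprod)).
  - exact: (ib (bounded_measurableD b1 b2)).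
  - move=> z _; rewrite normrM.
    have : `|G z f - p1 f| <= G z f + p1 f.
      by rewrite (le_trans (ler_normB _ _))// !ger0_norm//; exact: mixture_ge0.
    have := normr_ge0 (G z f - p1 f).
    rewrite -(real_normK (num_real (q z - 1))).
    move: `|_ - p1 f| `|q z - 1| => x y x0 xs.
    apply: (@le_trans _ _ (t / 2 * (x * y ^+ 2) + (2 * t)^-1 * x)); last first.
      by rewrite lerD2l ler_wpM2l// invr_ge0 mulr_ge0// ltW.
    rewrite -subr_ge0.
    have -> : t / 2 * (x * y ^+ 2) + (2 * t)^-1 * x - x * y =
      x * (t * y - 1) ^+ 2 / (2 * t) by field; rewrite gt_eqF.
    apply: divr_ge0; last by rewrite mulr_ge0// ltW.
    by apply: mulr_ge0 => //; exact: sqr_ge0.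
rewrite RintegralD//; [|exact: (ib b1)|exact: (ib b2)].
rewrite RintegralZl//; last exact: (ib (bA f)).
rewrite RintegralZl//; last exact: (ib bs).
rewrite RintegralD//; [|exact: (ib (bG f))|exact: (ib (bc _))].
rewrite Rintegral_probability_cst -/(p1 f) -/(A f).
by rewrite le_eqVlt; apply/orP; left; apply/eqP; field; rewrite gt_eqF.
Qed.

Let sum_dist z : \sum_f `|G z f - p1 f| <=
  2 * Num.min 1 (th * s) * w z * \int[gam]_y w y.
Proof.
have bz f : bm (fun y => G z f - G y f).
  exact (bounded_measurableD (bc (G z f)) (bounded_measurableN (bG f))).
apply: (@le_trans _ _ (\sum_f \int[gam]_y `|G z f - G y f|)).
  apply: ler_sum => f _.
  have -> : G z f - p1 f = \int[gam]_y (G z f - G y f).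
    rewrite RintegralB//; [|exact: (ib (bc _))|exact: (ib (bG f))].
    by rewrite Rintegral_probability_cst.
  by apply: le_normr_Rintegral => //; exact: (ib (bz f)).
rewrite -Rintegral_sum; last by move=> f; apply: ib; exact: bounded_measurable_norm.
rewrite -RintegralZl//; apply: le_Rintegral => //.
- rewrite (_ : _ \o _ = fun y => \sum_f (`|G z f - G y f|)%:E)%E; last first.
    by apply/funext => y /=; rewrite sumEFin.
  apply: integrable_sum => // f _; apply: ib; exact: bounded_measurable_norm.
- rewrite (_ : _ \o _ = fun y => (2 * Num.min 1 (th * s) * w z)%:E * (w y)%:E)%E; last first.
    by apply/funext => y /=; rewrite EFinM.
  exact: integrableZl.
- by move=> y _; rewrite -[leRHS]mulrA; exact: tv.
Qed.

(* Cauchy-Schwarz with the weight [|G z f - p1 f|] on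
   [p1 f - p0 f = \int (p1 f - G z f) (q z - 1)]. *)
Lemma hell_tilted_mixture : hell p1 p0 <= 4 * Num.min 1 (th * s) *
  (\int[gam]_z w z) * \int[gam]_z (w z * (q z - 1) ^+ 2).
Proof.
apply: (@le_trans _ _ (\sum_f (2 * A f))).
  apply: ler_sum => f _; apply: sqrt_diff_le.
  - exact: mixture_ge0.
  - exact: tilted_mixture_ge0.
  - by rewrite mulr_ge0.
  - rewrite -(real_normK (num_real (_ - _))).
    have -> : p1 f * (2 * A f) = 4 * (A f / 2 * p1 f) by field.
    apply: sqr_le_of_amgm => //; [by rewrite divr_ge0|exact: mixture_ge0|].
    exact: diff_le.
rewrite -mulr_sumr -Rintegral_sum; last by move=> f; apply: ib; exact: bA.
have -> : 4 * Num.min 1 (th * s) * (\int[gam]_z w z) * \int[gam]_z (w z * (q z - 1) ^+ 2)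
  = 2 * ((2 * Num.min 1 (th * s) * (\int[gam]_z w z)) * \int[gam]_z (w z * (q z - 1) ^+ 2)).
  by ring.
rewrite ler_wpM2l// -RintegralZl//; apply: le_Rintegral => //.
- rewrite (_ : _ \o _ = fun z => \sum_f (`|G z f - p1 f| * (q z - 1) ^+ 2)%:E)%E; last first.
    by apply/funext => y /=; rewrite sumEFin.
  by apply: integrable_sum => // f _; exact: (ib (bA f)).
- rewrite (_ : _ \o _ = fun z => (2 * Num.min 1 (th * s) * \int[gam]_z w z)%:E *
     (w z * (q z - 1) ^+ 2)%:E)%E; last by apply/funext => y /=; rewrite EFinM.
  exact: integrableZl.
- move=> z _; rewrite -mulr_suml [leRHS]mulrA ler_wpM2r ?sqr_ge0//.
  by apply: (le_trans (sum_dist z)); rewrite mulrAC.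
Qed.

End tilting.

(** * Two centred Gaussians with nearby variances *)

Section normal_tilting.
Context (R : realType).
Local Notation mu := (@lebesgue_measure R).

Lemma normal_pdf0E (m s x : R) : 0 < s -> normal_pdf m s x =
  (s * Num.sqrt (pi *+ 2))^-1 * expR (- (x - m) ^+ 2 / (s ^+ 2 *+ 2)).
Proof.
move=> s0; rewrite normal_pdfE ?gt_eqF// /normal_peak /normal_fun.
by rewrite -mulrnAr sqrtrM ?sqr_ge0// sqrtr_sqr gtr0_norm.
Qed.

Lemma sqrt2pi_gt0 : 0 < Num.sqrt (pi *+ 2 : R).
Proof. by rewrite sqrtr_gt0 pmulrn_lgt0 ?pi_gt0. Qed.

Lemma ge0_Rintegral_normal_prob (m s : R) (g : R -> R) :
  measurable_fun [set: R] g -> (forall x, 0 <= g x) ->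
  \int[normal_prob m s]_x g x = \int[mu]_x (g x * normal_pdf m s x).
Proof.
move=> mg g0; rewrite /Rintegral ge0_integral_normal_prob//.
exact/measurable_EFinP.
Qed.

Section expquad.
Variables (s : R) (s0 : 0 < s).

Let e (z : R) := expR ((z / s) ^+ 2 / 4).

(** The weight [e] turns the centred normal law of variance [s ^+ 2] into the one of variance
    [2 * s ^+ 2], up to a factor [Num.sqrt 2], which is thus its mean. Dominating polynomials by [e]
    replaces all computations of moments. *)
Lemma expquad_normal_pdf z :
  e z * normal_pdf 0 s z = Num.sqrt 2 * normal_pdf 0 (Num.sqrt 2 * s) z.
Proof.
have s2 : 0 < Num.sqrt (2 : R) by rewrite sqrtr_gt0.
rewrite !normal_pdf0E//; last exact: mulr_gt0.
rewrite mulrCA -expRD !subr0 (exprMn _ (Num.sqrt 2)) sqr_sqrtr// [RHS]mulrA; congr (_ * expR _).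
  by have h := sqrt2pi_gt0; field; rewrite !gt_eqF.
by field; rewrite gt_eqF.
Qed.

Lemma measurable_expquad : measurable_fun [set: R] e.
Proof.
apply: measurableT_comp => //; apply: measurable_funM => //.
by apply: measurable_funX; exact: measurable_funM.
Qed.

Lemma integral_expquad :
  (\int[normal_prob 0 s]_z (e z)%:E = (Num.sqrt 2)%:E)%E.
Proof.
rewrite ge0_integral_normal_prob//; last 2 first.
- by apply/measurable_EFinP; exact: measurable_expquad.
- by move=> x; rewrite lee_fin expR_ge0.
under eq_integral do rewrite -EFinM expquad_normal_pdf EFinM.
rewrite integralZl//; last exact: integrable_normal_pdf.
by rewrite integral_normal_pdf mule1.
Qed.

Lemma integrable_expquad :
  (normal_prob 0 s).-integrable [set: R] (EFin \o e).
Proof.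
apply/integrableP; split.
  by apply/measurable_EFinP; exact: measurable_expquad.
under eq_integral do rewrite /= ger0_norm ?expR_ge0//.
by rewrite integral_expquad ltry.
Qed.

Lemma Rintegral_expquad : \int[normal_prob 0 s]_z e z = Num.sqrt 2.
Proof. by rewrite /Rintegral integral_expquad. Qed.

Lemma le_Rintegral_expquad (g : R -> R) (c : R) : 0 <= c ->
  measurable_fun [set: R] g -> (forall z, 0 <= g z <= c * e z) ->
  (normal_prob 0 s).-integrable [set: R] (EFin \o g) /\
  \int[normal_prob 0 s]_z g z <= c * Num.sqrt 2.
Proof.
move=> c0 mg ge.
have ice : (normal_prob 0 s).-integrable [set: R] (EFin \o (fun z => c * e z)).
  rewrite (_ : _ \o _ = fun z => c%:E * (e z)%:E)%E; last first.
    by apply/funext => z /=; rewrite EFinM.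
  exact: integrableZl integrable_expquad.
have ig : (normal_prob 0 s).-integrable [set: R] (EFin \o g).
  apply: le_integrable ice => //; first exact/measurable_EFinP.
  move=> z _ /=; have /andP[g0 gc] := ge z.
  by rewrite lee_fin !ger0_norm// (le_trans g0).
split => //; rewrite -Rintegral_expquad -RintegralZl//; last exact: integrable_expquad.
by apply: le_Rintegral => // z _; case/andP: (ge z).
Qed.

End expquad.

Lemma onePabs_le_expquad (v : R) : 1 + `|v| <= 2 * expR (v ^+ 2 / 4).
Proof.
have := expR_ge1Dx (v ^+ 2 / 4).
have : `|v| <= 1 + v ^+ 2 / 4.
  rewrite -(real_normK (num_real v)) -subr_ge0.
  have -> : 1 + `|v| ^+ 2 / 4 - `|v| = (`|v| / 2 - 1) ^+ 2 by field.
  exact: sqr_ge0.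
have := sqr_ge0 v; lra.
Qed.

Lemma poly_le_expquad (v : R) :
  (1 + `|v|) * (1 + v ^+ 2) ^+ 2 <= 256 * expR (v ^+ 2 / 4).
Proof.
set u := v ^+ 2 / 4.
have u0 : 0 <= u by rewrite divr_ge0 ?sqr_ge0.
have v2 : v ^+ 2 = 4 * u by rewrite /u; field.
have v1 : 1 + `|v| <= 2 + u.
  rewrite /u -(real_normK (num_real v)) -subr_ge0.
  have -> : 2 + `|v| ^+ 2 / 4 - (1 + `|v|) = (`|v| / 2 - 1) ^+ 2 by field.
  exact: sqr_ge0.
apply: (@le_trans _ _ ((2 + u) * (1 + 4 * u) ^+ 2)).
  by rewrite v2 ler_wpM2r// sqr_ge0.
(* The left side is cubic in [u], so the fourth power of [1 + u / 4] suffices: multiplied by 256 it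
   becomes [(4 + u) ^+ 4], which exceeds the cubic by a polynomial with nonnegative coefficients. *)
have -> : expR u = expR (u / 4) ^+ 4.
  by rewrite -expRM_natl; congr expR; field.
apply: (@le_trans _ _ (256 * (1 + u / 4) ^+ 4)); last first.
  apply: ler_wpM2l; first exact: ler0n.
  have u40 : 0 <= u / 4 by rewrite divr_ge0.
  by rewrite lerXn2r ?nnegrE ?expR_ge0 ?expR_ge1Dx// addr_ge0.
have -> : 256 * (1 + u / 4) ^+ 4 =
  (2 + u) * (1 + 4 * u) ^+ 2 + (254 + 239 * u + 56 * u ^+ 2 + u ^+ 4).
  have -> : 256 * (1 + u / 4) ^+ 4 = (4 + u) ^+ 4.
    have -> : (256 : R) = 4 ^+ 4 by rewrite -natrX.
    by rewrite -exprMn; congr (_ ^+ _); field.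
  by ring.
by have := sqr_ge0 u; have := exprn_ge0 4 u0; rewrite lerDl; lra.
Qed.

Section hell_normal.
Variables (F : finType) (G : R -> F -> R) (th s0 s1 eta : R).
Hypotheses (th0 : 0 <= th) (s00 : 0 < s0) (s10 : 0 < s1) (eta0 : 0 <= eta).
Hypothesis s01 : s1 ^+ 2 = (1 + eta) * s0 ^+ 2.
Hypothesis G0 : forall z f, 0 <= G z f.
Hypothesis G1 : forall z, \sum_f G z f = 1.
Hypothesis Gdom : forall z z' f, z <= z' ->
  G z' f <= expR (th * (z' - z)) * G z f.

(* Density of [N(0, s0^2)] with respect to [N(0, s1^2)]. *)
Let q (z : R) := s1 / s0 * expR (- (eta * (z / s1) ^+ 2 / 2)).

Let q_pdf z : q z * normal_pdf 0 s1 z = normal_pdf 0 s0 z.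
Proof.
have := sqrt2pi_gt0 => h.
rewrite !normal_pdf0E// /q mulrACA -expRD !subr0; congr (_ * expR _).
  by field; rewrite !gt_eqF.
have e10 : 0 < 1 + eta by rewrite ltr_wpDr.
have -> : s0 ^+ 2 = s1 ^+ 2 / (1 + eta) by rewrite s01; field; rewrite gt_eqF.
by field; rewrite !gt_eqF.
Qed.

Let mq : measurable_fun [set: R] q.
Proof.
apply: measurable_funM => //; apply: measurableT_comp => //.
apply: measurableT_comp => //; apply: measurable_funM => //.
apply: measurable_funM => //; apply: measurable_funX; exact: measurable_funM.
Qed.

Let q0 z : 0 <= q z.
Proof. by rewrite mulr_ge0 ?expR_ge0// divr_ge0// ltW. Qed.

Let e1 z : expR (- (eta * (z / s1) ^+ 2 / 2)) <= 1.
Proof.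
by rewrite -expR0 ler_expR oppr_le0 divr_ge0// mulr_ge0// sqr_ge0.
Qed.

Let qM z : q z <= s1 / s0.
Proof. by rewrite ler_piMr// divr_ge0// ltW. Qed.

Let ratio : 1 <= s1 / s0 <= 1 + eta / 2.
Proof.
have r0 : 0 <= s1 / s0 by rewrite divr_ge0// ltW.
have r2 : (s1 / s0) ^+ 2 = 1 + eta.
  by rewrite expr_div_n s01 mulfK// sqrf_eq0 gt_eqF.
apply/andP; split.
  have : 1 ^+ 2 <= (s1 / s0) ^+ 2 by rewrite r2 expr1n lerDl.
  by rewrite ler_pXn2r ?nnegrE.
have : (s1 / s0) ^+ 2 <= (1 + eta / 2) ^+ 2.
  by rewrite r2; have := sqr_ge0 eta; nra.
by rewrite ler_pXn2r ?nnegrE// addr_ge0// divr_ge0.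
Qed.

Let q1_le z : `|q z - 1| <= eta / 2 * (1 + (z / s1) ^+ 2).
Proof.
have /andP[r1 r2] := ratio.
have z0 : 0 <= (z / s1) ^+ 2 by exact: sqr_ge0.
have ez0 : 0 <= eta * (z / s1) ^+ 2 by exact: mulr_ge0.
have -> : eta / 2 * (1 + (z / s1) ^+ 2) = eta / 2 + eta * (z / s1) ^+ 2 / 2 by ring.
rewrite ler_norml; apply/andP; split.
  have h : expR (- (eta * (z / s1) ^+ 2 / 2)) <= q z by rewrite ler_peMl// expR_ge0.
  have := expR_ge1Dx (- (eta * (z / s1) ^+ 2 / 2)).
  by move: (_ ^+ 2) (expR _) (q z) h ez0 => v x y; move: (eta * v) => p; lra.
by have := qM z; lra.
Qed.

(** The larger variance is the reference, so that the density [q] is bounded by [s1 / s0]. By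
    [q1_le], [(q - 1) ^+ 2] is of order [eta ^+ 2] up to a polynomial. The constant is 4 from
    [hell_tilted_mixture], times [2 * Num.sqrt 2] for the mean of [w], times [64 * Num.sqrt 2] with
    64 = 256 / 4. *)
Lemma hell_normal_mixture :
  hell (mixture (normal_prob 0 s1) G) (mixture (normal_prob 0 s0) G) <=
  1024 * Num.min 1 (th * s1) * eta ^+ 2.
Proof.
have mG f := dominated_measurable Gdom f.
have -> : mixture (normal_prob 0 s0) G = tilted_mixture (normal_prob 0 s1) G q.
  apply/funext => f; rewrite /mixture /tilted_mixture.
  rewrite (ge0_Rintegral_normal_prob 0 s0 (mG f) (fun z => G0 z f)).
  have mGq : measurable_fun [set: R] (fun z => G z f * q z).
    exact: measurable_funM (mG f) mq.
  have Gq0 z : 0 <= G z f * q z by exact: mulr_ge0.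
  rewrite (ge0_Rintegral_normal_prob 0 s1 mGq Gq0).
  by apply: eq_Rintegral => z _; rewrite -mulrA q_pdf.
have q1 : \int[normal_prob 0 s1]_z q z = 1.
  rewrite ge0_Rintegral_normal_prob//; transitivity (\int[mu]_z normal_pdf 0 s0 z).
    by apply: eq_Rintegral => z _; exact: q_pdf.
  by rewrite /Rintegral integral_normal_pdf.
pose w (z : R) := 1 + `|z| / s1.
have mw : measurable_fun [set: R] w.
  by apply: measurable_funD => //; apply: measurable_funM => //; exact: measurableT_comp.
have wE z : w z = 1 + `|z / s1| by rewrite normrM normfV (gtr0_norm s10).
have [//|//||iw Iw] := @le_Rintegral_expquad s1 s10 w 2.
  by move=> z; rewrite wE onePabs_le_expquad andbT addr_ge0.
have [|||iwq Iwq] := @le_Rintegral_expquad s1 s10 (fun z => w z * (q z - 1) ^+ 2) (eta ^+ 2 * 64).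
- by rewrite mulr_ge0// sqr_ge0.
- apply: measurable_funM => //; apply: measurable_funX; exact: measurable_funD.
- move=> z; have w0 : 0 <= w z by rewrite wE addr_ge0.
  apply/andP; split; first by rewrite mulr_ge0// sqr_ge0.
  apply: (@le_trans _ _ (w z * (eta / 2 * (1 + (z / s1) ^+ 2)) ^+ 2)).
    rewrite ler_wpM2l// -(real_normK (num_real (q z - 1))) lerXn2r ?nnegrE//.
    by rewrite mulr_ge0// ?divr_ge0// addr_ge0// sqr_ge0.
  have -> : w z * (eta / 2 * (1 + (z / s1) ^+ 2)) ^+ 2 =
    eta ^+ 2 / 4 * ((1 + `|z / s1|) * (1 + (z / s1) ^+ 2) ^+ 2).
    by rewrite wE; field; rewrite gt_eqF.
  have := poly_le_expquad (z / s1).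
  move/(ler_wpM2l (_ : 0 <= eta ^+ 2 / 4)) => /(_ _)/le_trans; apply.
    by rewrite divr_ge0// sqr_ge0.
  by rewrite le_eqVlt; apply/orP; left; apply/eqP; field.
apply: le_trans (hell_tilted_mixture th0 s10 G0 G1 Gdom mq (M := s1 / s0) _ q1 iw iwq) _.
  by move=> z; rewrite q0 qM.
have m0 : 0 <= Num.min 1 (th * s1) by rewrite le_min ler01 mulr_ge0// ltW.
have w0 : 0 <= \int[normal_prob 0 s1]_z w z.
  by apply: Rintegral_ge0 => z _; rewrite wE addr_ge0.
rewrite -!mulrA.
have -> : 1024 * (Num.min 1 (th * s1) * eta ^+ 2) =
   4 * (Num.min 1 (th * s1) * ((2 * Num.sqrt 2) * (eta ^+ 2 * 64 * Num.sqrt 2))).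
  have : Num.sqrt 2 * Num.sqrt 2 = 2 :> R by rewrite -expr2 sqr_sqrtr.
  move: (Num.sqrt 2) (Num.min _ _) => x m hx.
  have -> : 4 * (m * (2 * x * (eta ^+ 2 * 64 * x))) = 512 * (m * eta ^+ 2) * (x * x) by ring.
  by rewrite hx; ring.
rewrite ler_wpM2l// ler_wpM2l// ler_pM//.
apply: Rintegral_ge0 => z _; apply: mulr_ge0; last exact: sqr_ge0.
have : 0 <= w z by rewrite wE addr_ge0.
exact.
Qed.

End hell_normal.

End normal_tilting.

(** * Hellinger bound along the dyadic tree *)

Section mixtures.
Context (R : realType) (F : finType).
Variable gam : probability (measurableTypeR R) R.
Local Notation bm := (@bounded_measurable _ (measurableTypeR R) R).

Let ib (g : R -> R) : bm g -> gam.-integrable [set: R] (EFin \o g).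
Proof. exact: bounded_measurable_integrable. Qed.

Let bc (c : R) : bm (fun=> c).
Proof. exact: bounded_measurable_cst. Qed.

Lemma bounded_measurable_pmf (G : R -> F -> R) :
  (forall f, measurable_fun [set: R] (G ^~ f)) ->
  (forall z f, 0 <= G z f) -> (forall z, \sum_f G z f = 1) ->
  forall f, bm (G ^~ f).
Proof.
move=> mG G0 G1 f; split; first exact: mG.
by exists 1 => z; rewrite ger0_norm//; exact: pmf_le1.
Qed.

Let bsqrt (g : R -> R) : bm g -> (forall z, 0 <= g z) ->
  bm (fun z => Num.sqrt (g z)).
Proof.
move=> [mg [M gM]] g0; split.
  apply: measurableT_comp mg; apply: continuous_measurable_fun.
  exact: sqrt_continuous.
exists (Num.sqrt M) => z.
rewrite ger0_norm// ler_wsqrtr//; exact: le_trans (ler_norm _) (gM z).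
Qed.

(** After expanding the squares this is Cauchy-Schwarz for the square roots of [p] and [q]. *)
Let sqr_sqrt_mixture (p q : R -> R) : bm p -> bm q ->
  (forall z, 0 <= p z) -> (forall z, 0 <= q z) ->
  (Num.sqrt (\int[gam]_z p z) - Num.sqrt (\int[gam]_z q z)) ^+ 2 <=
  \int[gam]_z (Num.sqrt (p z) - Num.sqrt (q z)) ^+ 2.
Proof.
move=> bp bq p0 q0.
have bsp := bsqrt bp p0; have bsq := bsqrt bq q0.
have bpq := bounded_measurableM bsp bsq.
have b2pq : bm (fun z => 2 * (Num.sqrt (p z) * Num.sqrt (q z))).
  exact (bounded_measurableM (bc 2) bpq).
have bs := bounded_measurableD bp bq.
have ip0 : 0 <= \int[gam]_z p z by apply: Rintegral_ge0.
have iq0 : 0 <= \int[gam]_z q z by apply: Rintegral_ge0.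
have -> : \int[gam]_z (Num.sqrt (p z) - Num.sqrt (q z)) ^+ 2 =
  \int[gam]_z p z + \int[gam]_z q z - 2 * \int[gam]_z (Num.sqrt (p z) * Num.sqrt (q z)).
  rewrite -RintegralD//; [|exact: (ib bp)|exact: (ib bq)].
  rewrite -RintegralZl//; last exact: (ib bpq).
  rewrite -RintegralB//; [|exact: (ib bs)|exact: (ib b2pq)].
  apply: eq_Rintegral => z _; rewrite sqrrB !sqr_sqrtr//; ring.
rewrite sqrrB !sqr_sqrtr//.
suff : \int[gam]_z (Num.sqrt (p z) * Num.sqrt (q z)) <=
    Num.sqrt (\int[gam]_z p z) * Num.sqrt (\int[gam]_z q z) by lra.
set I := \int[gam]_z (Num.sqrt (p z) * Num.sqrt (q z)).
have I0 : 0 <= I by apply: Rintegral_ge0 => z _; exact: mulr_ge0.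
rewrite -sqrtrM// -[leLHS]ger0_norm// -sqrtr_sqr ler_wsqrtr//.
have -> : (\int[gam]_z p z) * (\int[gam]_z q z) =
  4 * ((\int[gam]_z p z) / 2 * ((\int[gam]_z q z) / 2)) by field.
apply: sqr_le_of_amgm => //; [by rewrite divr_ge0|by rewrite divr_ge0|move=> t t0].
have b1 : bm (fun z => t / 2 * p z) by exact (bounded_measurableM (bc (t / 2)) bp).
have b2 : bm (fun z => (2 * t)^-1 * q z).
  exact (bounded_measurableM (bc (2 * t)^-1) bq).
apply: (@le_trans _ _ (\int[gam]_z (t / 2 * p z + (2 * t)^-1 * q z))).
  apply: le_Rintegral => //; [exact: (ib bpq)|exact: (ib (bounded_measurableD b1 b2))|].
  move=> z _; have := sqr_sqrtr (p0 z); have := sqr_sqrtr (q0 z).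
  move: (Num.sqrt (p z)) (Num.sqrt (q z)) => x y <- <-.
  rewrite -subr_ge0.
  have -> : t / 2 * x ^+ 2 + (2 * t)^-1 * y ^+ 2 - x * y =
    (t * x - y) ^+ 2 / (2 * t) by field; rewrite gt_eqF.
  apply: divr_ge0; first exact: sqr_ge0.
  by rewrite mulr_ge0// ltW.
rewrite RintegralD//; [|exact: (ib b1)|exact: (ib b2)].
rewrite RintegralZl//; last exact: (ib bp).
rewrite RintegralZl//; last exact: (ib bq).
by rewrite le_eqVlt; apply/orP; left; apply/eqP; field; rewrite gt_eqF.
Qed.

(** Joint convexity of the squared Hellinger distance: both families are mixed by the same law. *)
Lemma hell_mixture_le (G H : R -> F -> R) (C : R) :
  (forall f, measurable_fun [set: R] (G ^~ f)) ->
  (forall f, measurable_fun [set: R] (H ^~ f)) ->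
  (forall z f, 0 <= G z f) -> (forall z f, 0 <= H z f) ->
  (forall z, \sum_f G z f = 1) -> (forall z, \sum_f H z f = 1) ->
  (forall z, hell (G z) (H z) <= C) ->
  hell (mixture gam G) (mixture gam H) <= C.
Proof.
move=> mG mH G0 H0 G1 H1 GHC.
have bG := bounded_measurable_pmf mG G0 G1.
have bH := bounded_measurable_pmf mH H0 H1.
have bd f : bm (fun z => (Num.sqrt (G z f) - Num.sqrt (H z f)) ^+ 2).
  have bGs := bsqrt (bG f) (G0 ^~ f); have bHs := bsqrt (bH f) (H0 ^~ f).
  have b := bounded_measurableD bGs (bounded_measurableN bHs).
  exact (bounded_measurableM b b).
apply: (@le_trans _ _ (\sum_f \int[gam]_z (Num.sqrt (G z f) - Num.sqrt (H z f)) ^+ 2)).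
  by apply: ler_sum => f _; exact: sqr_sqrt_mixture.
rewrite -Rintegral_sum; last by move=> f; exact: (ib (bd f)).
rewrite -[leRHS](Rintegral_probability_cst gam C); apply: le_Rintegral => //.
- rewrite (_ : _ \o _ =
    fun z => \sum_f ((Num.sqrt (G z f) - Num.sqrt (H z f)) ^+ 2)%:E)%E; last first.
    by apply/funext => y /=; rewrite sumEFin.
  by apply: integrable_sum => // f _; exact: (ib (bd f)).
- exact: (ib (bc C)).
- by move=> z _; exact: GHC.
Qed.

Lemma mixture_dominated (G H : R -> F -> R) (c : R) :
  (forall f, bm (G ^~ f)) -> (forall f, bm (H ^~ f)) -> 0 <= c ->
  (forall z f, H z f <= c * G z f) ->
  forall f, mixture gam H f <= c * mixture gam G f.
Proof.
move=> bG bH c0 HG f; rewrite /mixture -RintegralZl//; last exact: (ib (bG f)).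
apply: le_Rintegral => //; first exact: (ib (bH f)).
have b : bm (fun z => c * G z f) by exact (bounded_measurableM (bc c) (bG f)).
exact: (ib b).
Qed.

End mixtures.

(** Families of [2 ^ j] elements of [F], nested as pairs so that the two halves of a time interval
    are the two projections and [prodlaw] applies at every level. *)
Fixpoint tree (F : finType) (j : nat) : finType :=
  if j is j'.+1 then (tree F j' * tree F j')%type : finType else F.

Section bridge_law.
Variables (R : realType) (F : finType) (b : nat -> R -> F -> R) (sd : nat -> R).

(* Counts over [2 ^ j] consecutive time cells, given the values [x] and [y] of
   the path at the two ends: [b i x] is the law over the [i]-th cell of a path
   equal to [x], and [sd j] is the standard deviation of the midpoint of an
   interval of [2 ^ j.+1] cells given its ends. *)
Fixpoint bridge_law (j i : nat) (x y : R) {struct j} : tree F j -> R :=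
  match j return tree F j -> R with
  | 0%N => b i x
  | j'.+1 => mixture (normal_prob 0 (sd j')) (fun z => prodlaw
      (@bridge_law j' i.*2 x ((x + y) / 2 + z))
      (@bridge_law j' i.*2.+1 ((x + y) / 2 + z) y))
  end.

End bridge_law.

Arguments bridge_law {R F} b sd j i x y _.

Section bridge.
Context (R : realType) (F : finType).
Variables (b : nat -> R -> F -> R) (c : R).
Hypothesis c0 : 0 <= c.
Hypothesis b0 : forall i x f, 0 <= b i x f.
Hypothesis b1 : forall i x, \sum_f b i x f = 1.
Hypothesis bdom : forall i x x' f, x <= x' ->
  b i x' f <= expR (c * (x' - x)) * b i x f.
Local Notation bm := (@bounded_measurable _ (measurableTypeR R) R).

Section one_law.
Variable sd : nat -> R.
Local Notation L := (bridge_law b sd).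

Definition split_law j i x y (z : R) : tree F j.+1 -> R := prodlaw
  (L j i.*2 x ((x + y) / 2 + z)) (L j i.*2.+1 ((x + y) / 2 + z) y).

Lemma bridge_lawS j i x y :
  L j.+1 i x y = mixture (normal_prob 0 (sd j)) (split_law i x y).
Proof. by []. Qed.

Let law_ok j := [/\ forall i x y f, 0 <= L j i x y f,
  forall i x y, \sum_f L j i x y f = 1 &
  forall i x y x' y' f, x <= x' -> y <= y' ->
    L j i x' y' f <= expR (2 ^+ j * c * ((x' - x) + (y' - y))) * L j i x y f].

(** The condition bears on the two midpoints and not on [z] and [z']. The lemma thus serves both to
    move the ends with [z] fixed, where the midpoint moves by half the sum and the exponent of
    [law_ok] reproduces itself, and to move [z] with the ends fixed. *)
Let split_ok j : law_ok j -> [/\ forall i x y z f, 0 <= @split_law j i x y z f,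
  forall i x y z, \sum_f @split_law j i x y z f = 1 &
  forall i x y x' y' z z' f, x <= x' -> y <= y' -> (x + y) / 2 + z <= (x' + y') / 2 + z' ->
    @split_law j i x' y' z' f <= expR (2 ^+ j.+1 * c *
      ((x' - x) / 2 + (y' - y) / 2 + ((x' + y') / 2 + z' - ((x + y) / 2 + z)))) *
      @split_law j i x y z f].
Proof.
move=> [L0 L1 Ld]; split => [i x y z f|i x y z|i x y x' y' z z' f xx yy zz].
- exact: mulr_ge0.
- by rewrite sum_prodlaw !L1 mulr1.
- rewrite /split_law /prodlaw.
  apply: le_trans (ler_pM (L0 _ _ _ _) (L0 _ _ _ _) (Ld _ _ _ _ _ f.1 xx zz)
    (Ld _ _ _ _ _ f.2 zz yy)) _.
  rewrite mulrACA -expRD le_eqVlt; apply/orP; left; apply/eqP; congr (expR _ * _).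
  by rewrite exprS; field.
Qed.

Let split_bm j : law_ok j -> forall i x y f, bm ((@split_law j i x y)^~ f).
Proof.
move=> Lok i x y; have [s0 s1 sdom] := split_ok Lok.
apply: bounded_measurable_pmf => //.
apply: (dominated_measurable (c := 2 ^+ j.+1 * c)) => z z' f zz.
have := sdom i x y x y z z' f (lexx _) (lexx _); rewrite lerD2l => /(_ zz).
by rewrite !subrr !mul0r !add0r opprD addrACA subrr add0r.
Qed.

Lemma bridge_lawP j : law_ok j.
Proof.
elim: j => [|j IH].
  split=> [i x y f|i x y|i x y x' y' f xx yy]; [exact: b0|exact: b1|].
  rewrite /= expr0 mul1r.
  apply: le_trans (bdom i f xx) _; rewrite ler_wpM2r// ler_expR ler_wpM2l//.
  by rewrite lerDl subr_ge0.
have [s0 s1 sdom] := split_ok IH.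
split=> [i x y f|i x y|i x y x' y' f xx yy]; rewrite ?bridge_lawS.
- exact: mixture_ge0.
- rewrite -[RHS](Rintegral_probability_cst (normal_prob 0 (sd j)) 1).
  rewrite -Rintegral_sum => [|f].
    by apply: eq_Rintegral => z _; rewrite s1.
  by apply: bounded_measurable_integrable; exact: split_bm.
- apply: mixture_dominated => [f'|f'| |z f'].
  + exact: split_bm.
  + exact: split_bm.
  + exact: expR_ge0.
  + have zz : (x + y) / 2 + z <= (x' + y') / 2 + z.
      by rewrite lerD2r ler_wpM2r// lerD.
    apply: le_trans (sdom i x y x' y' z z f' xx yy zz) _.
    rewrite le_eqVlt; apply/orP; left; apply/eqP; congr (expR (_ * _) * _).
    by field.
Qed.

Lemma bridge_law_ge0 j i x y f : 0 <= L j i x y f.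
Proof. by have [+ _ _] := bridge_lawP j; apply. Qed.

Lemma sum_bridge_law j i x y : \sum_f L j i x y f = 1.
Proof. by have [_ + _] := bridge_lawP j; apply. Qed.

Lemma bridge_law_dominated j i x y x' y' f : x <= x' -> y <= y' ->
  L j i x' y' f <= expR (2 ^+ j * c * ((x' - x) + (y' - y))) * L j i x y f.
Proof. by have [_ _ +] := bridge_lawP j; apply. Qed.

Lemma split_law_ge0 j i x y z f : 0 <= @split_law j i x y z f.
Proof. by have [+ _ _] := split_ok (bridge_lawP j); apply. Qed.

Lemma sum_split_law j i x y z : \sum_f @split_law j i x y z f = 1.
Proof. by have [_ + _] := split_ok (bridge_lawP j); apply. Qed.

Lemma split_law_dominated j i x y z z' f : z <= z' ->
  @split_law j i x y z' f <= expR (2 ^+ j.+1 * c * (z' - z)) * @split_law j i x y z f.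
Proof.
move=> zz; have [_ _ sdom] := split_ok (bridge_lawP j).
have := sdom i x y x y z z' f (lexx _) (lexx _); rewrite lerD2l => /(_ zz).
by rewrite !subrr !mul0r !add0r opprD addrACA subrr add0r.
Qed.

Lemma split_law_measurable j i x y f :
  measurable_fun [set: R] ((@split_law j i x y)^~ f).
Proof. by case: (split_bm (bridge_lawP j) i x y f). Qed.

End one_law.

Section two_laws.
Variables (sd0 sd1 : nat -> R) (eta : R) (al : R) (w : nat -> R).
Hypotheses (eta0 : 0 <= eta) (sd00 : forall j, 0 < sd0 j) (sd10 : forall j, 0 < sd1 j).
Hypothesis sd01 : forall j, sd1 j ^+ 2 = (1 + eta) * sd0 j ^+ 2.
Hypotheses (al1 : 1 < al) (al4 : al ^+ 4 = 2).
Hypotheses (w0 : forall j, 0 < w j) (wS : forall j, w j.+1 = al * w j).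
Hypothesis w6 : forall j, 2 ^+ j.+1 * c * sd1 j <= w j.+1 ^+ 6.

(** Chosen so that the gain of [x ^+ 3 / (1 + x)] over [x ^+ 3 / (al + x)], multiplied by this
    constant, pays for the cost [32 * Num.min 1 (x ^+ 3)] of one level. The factor [al - 1] of that
    gain explains the denominator. *)
Definition hell_const : R := 64 * (al + 1) / (al - 1).

Lemma hell_const_ge0 : 0 <= hell_const.
Proof. by rewrite divr_ge0// ?mulr_ge0//; move: al1; lra. Qed.

Let hc0 := hell_const_ge0.

(* Halving the interval length divides [2 ^+ j * c * sd1 j] by [al ^+ 6], and
   one level contributes [eta * Num.min 1 (w j ^+ 3)] up to a constant, while
   independence of the two halves multiplies the accumulated distance by
   [al ^+ 2]: [w ^+ 3 / (1 + w)] interpolates between the two regimes. *)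
Let B j := hell_const * eta * (w j ^+ 3 / (1 + w j)).

Let B0 j : 0 <= B j.
Proof.
apply: mulr_ge0; first exact: mulr_ge0.
by apply: divr_ge0; [exact: exprn_ge0 (ltW _)|rewrite addr_ge0// ltW].
Qed.

Let BS j a : 0 <= a -> a <= 1 -> a <= w j.+1 ^+ 3 ->
  32 * eta * a + al ^+ 2 * B j <= B j.+1.
Proof.
move=> a0 a1 aw; rewrite /B wS.
have := w0 j; move: aw; rewrite wS.
have al0 : 0 < al by move: al1; lra.
set x := al * w j => ax wj.
have -> : w j = x / al by rewrite /x; field; rewrite gt_eqF.
have x0 : 0 < x by exact: mulr_gt0.
have h1 : 0 < 1 + x by rewrite addr_gt0.
have h2 : 0 < al + x by rewrite addr_gt0.
have -> : al ^+ 2 * (hell_const * eta * ((x / al) ^+ 3 / (1 + x / al))) =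
  hell_const * eta * (x ^+ 3 / (al + x)).
  by field; rewrite !gt_eqF//= mulr_gt0.
suff : 32 * a <= hell_const * (x ^+ 3 * (al - 1) / ((1 + x) * (al + x))).
  move=> /(ler_wpM2l eta0) h.
  have -> : 32 * eta * a = eta * (32 * a) by ring.
  rewrite -lerBrDr (le_trans h)// le_eqVlt; apply/orP; left; apply/eqP.
  by field; rewrite !gt_eqF.
have -> : hell_const * (x ^+ 3 * (al - 1) / ((1 + x) * (al + x))) =
    32 * (2 * (al + 1) * x ^+ 3 / ((1 + x) * (al + x))).
  by rewrite /hell_const; field; rewrite !gt_eqF//= subr_gt0.
rewrite ler_wpM2l// ler_pdivlMr; last exact: mulr_gt0.
have x3 : 0 < x ^+ 3 by exact: exprn_gt0.
(* The product [(1 + x) * (al + x)] is at most [2 * (al + 1)] when [x <= 1] and at most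
   [2 * (al + 1) * x ^+ 2] otherwise. The bound [x ^+ 3] on [a] is used in the first case, the bound
   1 in the second. *)
case: (leP x 1) => x1.
  apply: (@le_trans _ _ (x ^+ 3 * ((1 + x) * (al + x)))).
    by rewrite ler_wpM2r// mulr_ge0// ltW.
  rewrite mulrC ler_wpM2r//; first exact: ltW.
  rewrite ler_pM//; [exact: ltW|exact: ltW|lra|lra].
apply: (@le_trans _ _ ((1 + x) * (al + x))).
  by rewrite ler_piMl// mulr_ge0// ltW.
apply: (@le_trans _ _ ((2 * x) * ((al + 1) * x))).
  rewrite ler_pM//; [exact: ltW|exact: ltW|lra|].
  by rewrite mulrDl mul1r lerD2r ler_peMr// ltW.
have -> : (2 * x) * ((al + 1) * x) = 2 * (al + 1) * x ^+ 2 by ring.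
rewrite ler_wpM2l//; first by rewrite mulr_ge0// addr_ge0// ltW.
by rewrite exprS ler_peMl// ?sqr_ge0// ltW.
Qed.

Let al2 : al ^+ 2 * al ^+ 2 = 2.
Proof. by rewrite -exprD. Qed.

Let sqr_min_sqrt (x : R) : 0 <= x ->
  1024 * Num.min 1 x * eta ^+ 2 = (32 * eta * Num.sqrt (Num.min 1 x)) ^+ 2.
Proof.
move=> x0; have m0 : 0 <= Num.min 1 x by rewrite le_min ler01.
by rewrite exprMn sqr_sqrtr//; ring.
Qed.

(** The intermediate law has [sd1] at the top midpoint and [sd0] below. The first leg mixes two
    independent halves by a common law, so the induction hypothesis is doubled, and
    [al ^+ 2 * al ^+ 2 = 2]. In the second leg only the midpoint variance changes. At a single cell
    [sd] plays no part, and the distance is zero. *)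
Lemma hell_bridge_law_le j i x y :
  hell (bridge_law b sd1 j i x y) (bridge_law b sd0 j i x y) <= B j ^+ 2.
Proof.
elim: j i x y => [|j IH] i x y; first by rewrite hell_refl sqr_ge0.
set th := 2 ^+ j.+1 * c.
have th0 : 0 <= th by rewrite mulr_ge0// exprn_ge0.
have ths0 : 0 <= th * sd1 j by rewrite mulr_ge0// ltW.
set a := Num.sqrt (Num.min 1 (th * sd1 j)).
have a0 : 0 <= a by exact: sqrtr_ge0.
have m0 : 0 <= Num.min 1 (th * sd1 j) by rewrite le_min ler01.
have a1 : a <= 1.
  by rewrite -(@sqrtr1 R) ler_wsqrtr// ge_min lexx.
have aw : a <= w j.+1 ^+ 3.
  have w3 : 0 <= w j.+1 ^+ 3 by apply: exprn_ge0; exact: ltW.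
  rewrite -[leRHS]ger0_norm// -sqrtr_sqr ler_wsqrtr// ge_min; apply/orP; right.
  by rewrite -exprM; exact: w6.
apply: (@le_trans _ _ ((al ^+ 2 * B j + 32 * eta * a) ^+ 2)); last first.
  have h : 0 <= al ^+ 2 * B j + 32 * eta * a.
    apply: addr_ge0; first by rewrite mulr_ge0// sqr_ge0.
    by rewrite mulr_ge0// mulr_ge0.
  by rewrite lerXn2r ?nnegrE// addrC BS.
apply: (@hell_triangle _ _ _ (mixture (normal_prob 0 (sd1 j)) (split_law sd0 i x y))).
- by rewrite mulr_ge0// sqr_ge0.
- by rewrite mulr_ge0// mulr_ge0.
- rewrite bridge_lawS; apply: hell_mixture_le.
  + exact: split_law_measurable.
  + exact: split_law_measurable.
  + by move=> z f; exact: split_law_ge0.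
  + by move=> z f; exact: split_law_ge0.
  + by move=> z; exact: sum_split_law.
  + by move=> z; exact: sum_split_law.
  + move=> z; apply: le_trans (hell_prod _ _ _ _ _ _ _ _) _;
      try (by move=> f; exact: bridge_law_ge0); try exact: sum_bridge_law.
    rewrite exprMn expr2 al2 mulr_natl mulr2n; exact: lerD.
- rewrite bridge_lawS -sqr_min_sqrt//; apply: hell_normal_mixture => //.
  + by move=> z f; exact: split_law_ge0.
  + by move=> z; exact: sum_split_law.
  + by move=> z z' f zz; exact: split_law_dominated.
Qed.

(** Adds the law of the right end of the path. Changing its variance costs at most [32 * eta], by
    bounding the minimum by 1, and [w ^+ 3 / (1 + w) <= w ^+ 2]. *)
Lemma hell_path_law_le j s0 s1 : 0 < s0 -> 0 < s1 ->
  s1 ^+ 2 = (1 + eta) * s0 ^+ 2 ->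
  hell (mixture (normal_prob 0 s1) (bridge_law b sd1 j 0 0))
       (mixture (normal_prob 0 s0) (bridge_law b sd0 j 0 0)) <=
  (eta * (hell_const * w j ^+ 2 + 32)) ^+ 2.
Proof.
move=> s00 s10 s01.
have th0 : 0 <= 2 ^+ j * c by rewrite mulr_ge0// exprn_ge0.
have ldom sd z z' f : z <= z' ->
    bridge_law b sd j 0 0 z' f <= expR (2 ^+ j * c * (z' - z)) * bridge_law b sd j 0 0 z f.
  move=> zz; have := bridge_law_dominated sd 0 f (lexx 0) zz.
  by rewrite subrr add0r.
apply: (@le_trans _ _ ((B j + 32 * eta) ^+ 2)); last first.
  rewrite lerXn2r ?nnegrE//.
  - by rewrite addr_ge0// mulr_ge0.
  - rewrite mulr_ge0// addr_ge0// mulr_ge0// sqr_ge0//.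
  - rewrite /B mulrDr (mulrC 32) lerD2r (mulrC hell_const) -mulrA ler_wpM2l//.
    rewrite ler_wpM2l// ler_pdivrMr; last by rewrite addr_gt0.
    by rewrite mulrDr mulr1 -exprSr lerDr sqr_ge0.
apply: (@hell_triangle _ _ _ (mixture (normal_prob 0 s1) (bridge_law b sd0 j 0 0))) => //.
- by rewrite mulr_ge0.
- apply: hell_mixture_le.
  + exact: dominated_measurable (ldom sd1).
  + exact: dominated_measurable (ldom sd0).
  + by move=> z f; exact: bridge_law_ge0.
  + by move=> z f; exact: bridge_law_ge0.
  + by move=> z; exact: sum_bridge_law.
  + by move=> z; exact: sum_bridge_law.
  + by move=> z; exact: hell_bridge_law_le.
- apply: le_trans (hell_normal_mixture th0 s00 s10 eta0 s01 _ _ (ldom sd0)) _.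
  + by move=> z f; exact: bridge_law_ge0.
  + by move=> z; exact: sum_bridge_law.
  rewrite exprMn ler_wpM2r ?sqr_ge0//.
  rewrite (_ : 32 ^+ 2 = 1024 * 1); last by ring.
  by apply: ler_wpM2l; [exact: ler0n|rewrite ge_min lexx].
Qed.

End two_laws.
End bridge.

(** * Capped Poisson counts *)

Section poisson.
Context (R : realType).

Lemma poisson_mass_ge0 (a : R) (k : nat) : 0 <= a -> 0 <= poisson_mass a k.
Proof.
by move=> a0; rewrite /poisson_mass mulr_ge0 ?expR_ge0// divr_ge0// exprn_ge0.
Qed.

Lemma poisson_mass_dominated (a a' : R) (k : nat) : 0 <= a' <= a ->
  poisson_mass a' k <= expR (a - a') * poisson_mass a k.
Proof.
move=> /andP[a'0 a'a]; rewrite /poisson_mass [leRHS]mulrCA -expRD.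
rewrite addrAC subrr add0r ler_wpM2r ?expR_ge0// ler_wpM2r// ?invr_ge0//.
by rewrite lerXn2r ?nnegrE// (le_trans a'0).
Qed.

Lemma expR_tail_ge0 (a : R) (B : nat) : 0 <= a ->
  series (exp_coeff a) B <= expR a.
Proof.
move=> a0; apply: nondecreasing_cvgn_le; last exact: is_cvg_series_exp_coeff.
apply/nondecreasing_seqP => n; rewrite /series /= big_nat_recr//= lerDl.
by rewrite divr_ge0// exprn_ge0.
Qed.

(** The tails of the exponential series are monotone because every term is. This is what extends the
    domination to the capped value, which carries a whole tail. *)
Lemma expR_tail_le (a a' : R) (B : nat) : 0 <= a' <= a ->
  expR a' - series (exp_coeff a') B <= expR a - series (exp_coeff a) B.
Proof.
move=> /andP[a'0 a'a].
pose u n := series (exp_coeff a) n - series (exp_coeff a') n.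
have cu : u @ \oo --> expR a - expR a'.
  by apply: cvgB; exact: is_cvg_series_exp_coeff.
have ndu : nondecreasing_seq u.
  apply/nondecreasing_seqP => n; rewrite /u /series /= !big_nat_recr//=.
  rewrite opprD addrACA lerDl subr_ge0 ler_wpM2r ?invr_ge0//.
  by rewrite lerXn2r ?nnegrE// (le_trans a'0).
have := nondecreasing_cvgn_le ndu (cvgP _ cu) B.
by rewrite (cvg_lim _ cu)// /u; lra.
Qed.

(* Counts are recorded up to [B] only: [B] stands for "at least [B]". *)
Definition capped_poisson (B : nat) (a : R) (k : 'I_B.+1) : R :=
  if (k < B)%N then poisson_mass a k
  else 1 - \sum_(j < B) poisson_mass a j.

Lemma capped_poisson_tail (B : nat) (a : R) :
  1 - \sum_(j < B) poisson_mass a j =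
  expR (- a) * (expR a - series (exp_coeff a) B).
Proof.
rewrite mulrBr -expRD addNr expR0 /series /= big_mkord mulr_sumr.
by congr (_ - _); apply: eq_bigr => j _; rewrite mulrC.
Qed.

Lemma capped_poisson_ge0 (B : nat) (a : R) (k : 'I_B.+1) : 0 <= a ->
  0 <= capped_poisson a k.
Proof.
move=> a0; rewrite /capped_poisson; case: ifP => _; first exact: poisson_mass_ge0.
by rewrite capped_poisson_tail mulr_ge0 ?expR_ge0// subr_ge0 expR_tail_ge0.
Qed.

Lemma sum_capped_poisson (B : nat) (a : R) :
  \sum_(k < B.+1) capped_poisson a k = 1.
Proof.
rewrite big_ord_recr/= /capped_poisson ltnn.
rewrite (eq_bigr (fun k : 'I_B => poisson_mass a k)) => [|k _]; last first.
  by rewrite /= ltn_ord.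
by rewrite addrC subrK.
Qed.

Lemma capped_poisson_dominated (B : nat) (a a' : R) (k : 'I_B.+1) :
  0 <= a' <= a -> capped_poisson a' k <= expR (a - a') * capped_poisson a k.
Proof.
move=> aa; rewrite /capped_poisson; case: ifP => _.
  exact: poisson_mass_dominated.
rewrite !capped_poisson_tail mulrA -expRD.
have -> : a - a' - a = - a' by ring.
by rewrite ler_wpM2l ?expR_ge0// expR_tail_le.
Qed.

Variable I : finType.

Definition capped_poisson_law (B : nat) (a : I -> R) (f : {ffun I -> 'I_B.+1}) : R :=
  \prod_i capped_poisson (a i) (f i).

Lemma capped_poisson_law_ge0 (B : nat) (a : I -> R) (f : {ffun I -> 'I_B.+1}) :
  (forall i, 0 <= a i) -> 0 <= capped_poisson_law a f.
Proof. by move=> a0; apply: prodr_ge0 => i _; exact: capped_poisson_ge0. Qed.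

Lemma sum_capped_poisson_law (B : nat) (a : I -> R) :
  \sum_f @capped_poisson_law B a f = 1.
Proof.
rewrite /capped_poisson_law -(bigA_distr_bigA (fun i k => @capped_poisson B (a i) k)).
by rewrite big1// => i _; exact: sum_capped_poisson.
Qed.

Lemma capped_poisson_law_dominated (B : nat) (a a' : I -> R)
    (f : {ffun I -> 'I_B.+1}) : (forall i, 0 <= a' i <= a i) ->
  capped_poisson_law a' f <= expR (\sum_i (a i - a' i)) * capped_poisson_law a f.
Proof.
move=> aa; rewrite expR_sum -big_split/=.
apply: ler_prod => i _; have /andP[a'0 aa'] := aa i.
by rewrite capped_poisson_ge0//= capped_poisson_dominated ?aa.
Qed.

End poisson.

(** * Product laws on the leaves of a tree *)

Fixpoint leaf (F : finType) (j : nat) : tree F j -> nat -> F :=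
  match j return tree F j -> nat -> F with
  | 0%N => fun f _ => f
  | j'.+1 => fun f k => if (k < 2 ^ j')%N then leaf f.1 k else leaf f.2 (k - 2 ^ j')
  end.

Section tree_law.
Context (R : realType) (F : finType).

Definition tree_law (g : nat -> F -> R) (j i : nat) (f : tree F j) : R :=
  \prod_(k < 2 ^ j) g (i * 2 ^ j + k)%N (leaf f k).

Lemma tree_law0 (g : nat -> F -> R) (i : nat) (f : tree F 0) :
  tree_law g i f = g i f.
Proof. by rewrite /tree_law big_ord1/= muln1 addn0. Qed.

Lemma tree_lawS (g : nat -> F -> R) (j i : nat) (f : tree F j.+1) :
  tree_law g i f = tree_law g i.*2 f.1 * tree_law g i.*2.+1 f.2.
Proof.
rewrite /tree_law expnS mul2n -addnn big_split_ord/=; congr (_ * _).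
  apply: eq_bigr => k _; rewrite ltn_ord; congr (g _ _).
  by rewrite -mul2n mulnDr mulnC; lia.
apply: eq_bigr => k _; rewrite ltnNge leq_addr/= addKn; congr (g _ _).
by rewrite -mul2n; lia.
Qed.

Lemma tree_law_ge0 (g : nat -> F -> R) (j i : nat) (f : tree F j) :
  (forall k f, 0 <= g k f) -> 0 <= tree_law g i f.
Proof. by move=> g0; apply: prodr_ge0. Qed.

Lemma sum_tree_law (g : nat -> F -> R) (j i : nat) :
  (forall k, \sum_f g k f = 1) -> \sum_(f : tree F j) tree_law g i f = 1.
Proof.
move=> g1; elim: j i => [|j IH] i.
  by rewrite (eq_bigr (g i)) => [|f _]; [exact: g1|exact: tree_law0].
rewrite (eq_bigr (prodlaw (tree_law g i.*2) (tree_law g i.*2.+1))).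
  by rewrite sum_prodlaw !IH mulr1.
by move=> f _; exact: tree_lawS.
Qed.

Lemma tree_law_dominated (g g' : nat -> F -> R) (D : nat -> R) (j : nat)
    (f : tree F j) : (forall k f, 0 <= g' k f) ->
  (forall k f, g' k f <= expR (D k) * g k f) ->
  tree_law g' 0 f <= expR (\sum_(k < 2 ^ j) D k) * tree_law g 0 f.
Proof.
move=> g'0 gg; rewrite expR_sum -big_split/=; apply: ler_prod => k _.
by rewrite g'0 gg.
Qed.

End tree_law.

Section tree_poisson.
Context (R : realType) (I : finType) (B : nat).

Definition tree_poisson (a : nat -> I -> R) (j : nat) :
    tree {ffun I -> 'I_B.+1} j -> R :=
  tree_law (fun k => capped_poisson_law (a k)) 0.

(** Domination needs ordered rates, so the two laws are compared through the pointwise minimum of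
    their rates; the two excesses over the minimum add up to [|a - a'|]. *)
Lemma tree_poisson_tv (a a' : nat -> I -> R) (j : nat) :
  (forall k i, 0 <= a k i) -> (forall k i, 0 <= a' k i) ->
  \sum_f `|@tree_poisson a j f - tree_poisson a' f| <=
  2 * \sum_(k < 2 ^ j) \sum_i `|a k i - a' k i|.
Proof.
move=> a0 a'0; pose m k i := Num.min (a k i) (a' k i).
have m0 k i : 0 <= m k i by rewrite le_min a0 a'0.
have tv (b : nat -> I -> R) : (forall k i, 0 <= b k i) -> (forall k i, m k i <= b k i) ->
    \sum_f `|@tree_poisson b j f - tree_poisson m f| <=
    2 * \sum_(k < 2 ^ j) \sum_i (b k i - m k i).
  move=> b0 mb.
  have D0 : 0 <= \sum_(k < 2 ^ j) \sum_i (b k i - m k i).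
    by apply: sumr_ge0 => k _; apply: sumr_ge0 => i _; rewrite subr_ge0.
  apply: le_trans (total_variation_le D0 _ _ _ _) _.
  - by move=> f; apply: tree_law_ge0 => k g; exact: capped_poisson_law_ge0.
  - by apply: sum_tree_law => k; exact: sum_capped_poisson_law.
  - by apply: sum_tree_law => k; exact: sum_capped_poisson_law.
  - move=> f; apply: (tree_law_dominated (D := fun k => \sum_i (b k i - m k i))).
      by move=> k g; exact: capped_poisson_law_ge0.
    by move=> k g; apply: capped_poisson_law_dominated => i; rewrite m0 mb.
  - by rewrite ler_wpM2l// ge_min lexx orbT.
have ma k i : m k i <= a k i by rewrite ge_min lexx.
have ma' k i : m k i <= a' k i by rewrite ge_min lexx orbT.
have ha := tv a a0 ma; have ha' := tv a' a'0 ma'.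
apply: (@le_trans _ _ (\sum_f (`|@tree_poisson a j f - tree_poisson m f| +
    `|@tree_poisson a' j f - tree_poisson m f|))).
  apply: ler_sum => f _.
  by rewrite (distrC (tree_poisson a' f)) ler_distD.
rewrite big_split/=; apply: le_trans (lerD ha ha') _.
rewrite -mulrDr -big_split/= ler_wpM2l// ler_sum// => k _.
rewrite -big_split/= ler_sum// => i _.
rewrite /m; case: (leP (a k i) (a' k i)) => h.
  by rewrite subrr add0r distrC ler_norm.
by rewrite subrr addr0 ler_norm.
Qed.

End tree_poisson.

(** * Gaussian bridges and the Brownian chain *)

Section normal_kernel.
Context (R : realType).
Local Notation mu := (@lebesgue_measure R).
Local Notation mR := (measurableTypeR R).

Lemma normal_pdf_center (m s x : R) : s != 0 ->
  normal_pdf m s x = normal_pdf 0 s (x - m).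
Proof.
by move=> s0; rewrite !normal_pdfE// /normal_fun subr0.
Qed.

Lemma measurable_normal_pdf2 d (T : measurableType d) (s : R) (f g : T -> R) :
  s != 0 -> measurable_fun [set: T] f -> measurable_fun [set: T] g ->
  measurable_fun [set: T] (fun t => normal_pdf (f t) s (g t)).
Proof.
move=> s0 mf mg; rewrite (_ : (fun t => _) = normal_pdf 0 s \o (fun t => g t - f t)).
  by apply: measurableT_comp; [exact: measurable_normal_pdf|exact: measurable_funB].
by apply/funext => t /=; rewrite normal_pdf_center.
Qed.

(* The last factor is the law of the midpoint given the two ends. *)
Lemma normal_pdf_midpoint (s x y z : R) : 0 < s ->
  normal_pdf x s z * normal_pdf z s y =
  normal_pdf x (Num.sqrt 2 * s) y * normal_pdf ((x + y) / 2) (s / Num.sqrt 2) z.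
Proof.
move=> s0; have r0 : 0 < Num.sqrt (2 : R) by rewrite sqrtr_gt0.
have h := sqrt2pi_gt0 R.
have r2 : Num.sqrt (2 : R) ^+ 2 = 2 by rewrite sqr_sqrtr.
rewrite !normal_pdf0E//; [|exact: divr_gt0|exact: mulr_gt0].
rewrite mulrACA -expRD [RHS]mulrACA -expRD; congr (_ * expR _).
  by field; rewrite !gt_eqF.
by rewrite expr_div_n exprMn r2; field; rewrite gt_eqF.
Qed.

Lemma ge0_integral_normal_prob_shift (m s : R) (f : R -> \bar R) : s != 0 ->
  measurable_fun [set: R] f -> (forall x, 0 <= f x)%E ->
  (\int[normal_prob 0 s]_z f (m + z)%R =
   \int[mu]_y (f y * (normal_pdf m s y)%:E))%E.
Proof.
move=> s0 mf f0.
have mfm : measurable_fun [set: R] (fun z => f (m + z)).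
  by apply: measurableT_comp mf _; exact: measurable_funD.
rewrite (ge0_integral_normal_prob 0 s mfm (fun z => f0 (m + z))).
have mfp : measurable_fun [set: R] (fun y => f y * (normal_pdf m s y)%:E)%E.
  by apply: emeasurable_funM => //; apply/measurable_EFinP; exact: measurable_normal_pdf.
have fp0 y : (0 <= f y * (normal_pdf m s y)%:E)%E.
  by rewrite mule_ge0// lee_fin normal_pdf_ge0.
rewrite -(ge0_integral_shift m mfp fp0); apply: eq_integral => y _.
by rewrite (normal_pdf_center m (y + m) s0) addrK (addrC m).
Qed.

End normal_kernel.

Section transfer.
Context (R : realType) (F : finType).
Variables (b : nat -> R -> F -> R) (c : R).
Hypothesis c0 : 0 <= c.
Hypothesis b0 : forall i x f, 0 <= b i x f.
Hypothesis b1 : forall i x, \sum_f b i x f = 1.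
Hypothesis bdom : forall i x x' f, x <= x' ->
  b i x' f <= expR (c * (x' - x)) * b i x f.
Variable s : nat -> R.
Hypotheses (s0 : forall j, 0 < s j) (sS : forall j, s j.+1 = Num.sqrt 2 * s j).
Local Notation mu := (@lebesgue_measure R).
Local Notation mR := (measurableTypeR R).
Local Notation sd := (fun j => s j / Num.sqrt 2).
Local Notation L := (bridge_law b sd).

Lemma measurable_leaf_law i f : measurable_fun [set: R] (b i ^~ f).
Proof. exact: dominated_measurable (@bdom i) f. Qed.

Lemma measurable_bridge_law d (T : measurableType d) j i f (u v : T -> R) :
  measurable_fun [set: T] u -> measurable_fun [set: T] v ->
  measurable_fun [set: T] (fun t => L j i (u t) (v t) f).
Proof.
elim: j d T i f u v => [|j IH] d T i f u v mu mv.
  exact: (measurableT_comp (measurable_leaf_law i f) mu).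
rewrite /= /mixture /Rintegral; apply: measurableT_comp; first exact: fine_measurable.
pose g (p : T * mR) := (prodlaw
  (L j i.*2 (u p.1) ((u p.1 + v p.1) / 2 + p.2))
  (L j i.*2.+1 ((u p.1 + v p.1) / 2 + p.2) (v p.1)) f)%:E.
apply: (@measurable_fun_fubini_tonelli_F _ _ _ _ _ (normal_prob 0 (s j / Num.sqrt 2)) g).
  apply/measurable_EFinP.
  have m1 : measurable_fun [set: T * mR] (u \o fst) by exact: measurableT_comp.
  have m2 : measurable_fun [set: T * mR] (v \o fst) by exact: measurableT_comp.
  have m3 : measurable_fun [set: T * mR]
      (fun p : T * mR => (u p.1 + v p.1) / 2 + p.2 : R).
    apply: measurable_funD; last exact: measurable_snd.
    by apply: measurable_funM => //; exact: measurable_funD.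
  by apply: measurable_funM; apply: IH.
by move=> p; rewrite lee_fin; apply: mulr_ge0; exact: (bridge_law_ge0 c0 b0 b1 bdom).
Qed.

(** Expectation, for the Gaussian walk with step [s 0] started from [x] at the first cell of block
    [i], of the product of the leaf weights and of [h] at the end of the block. Nonnegative extended
    values let Tonelli apply with no integrability to check. *)
Fixpoint transfer (j i : nat) (f : tree F j) (h : R -> \bar R) {struct j} :
    R -> \bar R :=
  match j return tree F j -> R -> \bar R with
  | 0%N => fun f x =>
      ((b i x f)%:E * \int[mu]_y (h y * (normal_pdf x (s 0) y)%:E))%E
  | j'.+1 => fun f => @transfer j' i.*2 f.1 (@transfer j' i.*2.+1 f.2 h)
  end f.

(** Identifies walk and bridge. Composing two blocks integrates over the middle point, and
    [normal_pdf_midpoint] rewrites the two transition densities as the law of the far end times the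
    law of the midpoint given both ends, which is the recursion of [bridge_law]. *)
Lemma transferE j i f h x : measurable_fun [set: R] h -> (forall y, 0 <= h y)%E ->
  transfer i f h x =
  (\int[mu]_y (h y * (normal_pdf x (s j) y * L j i x y f)%:E))%E.
Proof.
elim: j i f h x => [|j IH] i f h x mh h0.
  rewrite /= -ge0_integralZl//.
  - by apply: eq_integral => y _; rewrite muleCA -EFinM mulrC.
  - apply: emeasurable_funM => //; apply/measurable_EFinP; exact: measurable_normal_pdf.
  - by move=> y _; rewrite mule_ge0// lee_fin normal_pdf_ge0.
  - by rewrite lee_fin; exact: b0.
have r0 : 0 < Num.sqrt (2 : R) by rewrite sqrtr_gt0.
have sn0 k : s k != 0 by rewrite gt_eqF.
have L0 k l u v g : 0 <= L k l u v g by exact: (bridge_law_ge0 c0 b0 b1 bdom).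
pose g (p : mR * mR) := (h p.2 * ((normal_pdf x (s j) p.1 * normal_pdf p.1 (s j) p.2) *
  (L j i.*2 x p.1 f.1 * L j i.*2.+1 p.1 p.2 f.2))%:E)%E.
have g0 p : (0 <= g p)%E.
  by rewrite mule_ge0// lee_fin !mulr_ge0// normal_pdf_ge0.
have mg : measurable_fun [set: mR * mR] g.
  apply: emeasurable_funM.
    by apply: measurableT_comp mh _; exact: measurable_snd.
  apply/measurable_EFinP; apply: measurable_funM; apply: measurable_funM.
  - apply: measurable_normal_pdf2 => //.
  - apply: measurable_normal_pdf2 => //.
  - apply: measurable_bridge_law => //.
  - apply: measurable_bridge_law => //.
have e1 z : transfer i.*2.+1 f.2 h z =
    (\int[mu]_y (h y * (normal_pdf z (s j) y * L j i.*2.+1 z y f.2)%:E))%E.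
  exact: IH.
have mL2 z : measurable_fun [set: mR] (fun y => h y * (normal_pdf z (s j) y *
    L j i.*2.+1 z y f.2)%:E)%E.
  apply: emeasurable_funM => //; apply/measurable_EFinP/measurable_funM.
    exact: measurable_normal_pdf.
  exact: measurable_bridge_law.
have mT : measurable_fun [set: R] (transfer i.*2.+1 f.2 h).
  rewrite (_ : transfer _ _ _ = fubini_F mu (fun p : mR * mR =>
    h p.2 * (normal_pdf p.1 (s j) p.2 * L j i.*2.+1 p.1 p.2 f.2)%:E)%E); last first.
    by apply/funext => z; rewrite e1.
  apply: measurable_fun_fubini_tonelli_F.
    apply: emeasurable_funM.
      by apply: measurableT_comp mh _; exact: measurable_snd.
    apply/measurable_EFinP; apply: measurable_funM.
      exact: measurable_normal_pdf2.
    exact: measurable_bridge_law.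
  by move=> p; rewrite mule_ge0// lee_fin mulr_ge0// normal_pdf_ge0.
have T0 z : (0 <= transfer i.*2.+1 f.2 h z)%E.
  rewrite e1; apply: integral_ge0 => y _.
  by rewrite mule_ge0// lee_fin mulr_ge0// normal_pdf_ge0.
rewrite /= IH//.
transitivity (\int[mu]_z \int[mu]_y g (z, y))%E.
  apply: eq_integral => z _; rewrite e1 -ge0_integralZr//.
  - apply: eq_integral => y _; rewrite /g/= -muleA -EFinM; congr (_ * _%:E)%E; ring.
  - by move=> y _; rewrite mule_ge0// lee_fin mulr_ge0// normal_pdf_ge0.
  - by rewrite lee_fin mulr_ge0// normal_pdf_ge0.
(* From here the end [y] is fixed and the inner integral runs over the midpoint [z]. *)
rewrite fubini_tonelli//; apply: eq_integral => y _.
pose k (z : R) := L j i.*2 x z f.1 * L j i.*2.+1 z y f.2.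
have mk : measurable_fun [set: R] k.
  by apply: measurable_funM; exact: measurable_bridge_law.
have k0 z : 0 <= k z by exact: mulr_ge0.
transitivity (\int[mu]_z ((h y * (normal_pdf x (s j.+1) y)%:E) *
   ((k z)%:E * (normal_pdf ((x + y) / 2) (s j / Num.sqrt 2) z)%:E)))%E.
  apply: eq_integral => z _; rewrite /g/= normal_pdf_midpoint// -sS.
  by rewrite -muleA -!EFinM; congr (_ * _%:E)%E; rewrite /k; ring.
rewrite ge0_integralZl//; last first.
- by rewrite mule_ge0// lee_fin normal_pdf_ge0.
- by move=> z _; apply: mule_ge0; rewrite lee_fin; [exact: k0|exact: normal_pdf_ge0].
- apply: emeasurable_funM; first exact/measurable_EFinP.
  by apply/measurable_EFinP; exact: measurable_normal_pdf.
have sd0 : s j / Num.sqrt 2 != 0 by rewrite gt_eqF// divr_gt0.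
rewrite -(@ge0_integral_normal_prob_shift _ _ _ (EFin \o k))//; last first.
  exact/measurable_EFinP.
rewrite -muleA EFinM; congr (_ * (_ * _))%E.
rewrite /mixture /Rintegral fineK//.
apply: integrable_fin_num => //.
have := split_law_measurable c0 b0 b1 bdom sd i x y f => ms.
apply: (@probability_integrable _ _ _ (normal_prob 0 (s j / Num.sqrt 2)) _ 1) => // z.
have s_ge0 := split_law_ge0 c0 b0 b1 bdom sd i x y z.
rewrite ger0_norm; last exact: s_ge0.
exact: (pmf_le1 f (s_ge0 j) (sum_split_law c0 b0 b1 bdom sd j i x y z)).
Qed.

Let integrand_ge0 j i f (h : R -> \bar R) x y : (forall y, 0 <= h y)%E ->
  (0 <= h y * (normal_pdf x (s j) y * L j i x y f)%:E)%E.
Proof.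
move=> h0; rewrite mule_ge0// lee_fin mulr_ge0 ?normal_pdf_ge0//.
exact: (bridge_law_ge0 c0 b0 b1 bdom).
Qed.

Lemma transfer_ge0 j i f h x : measurable_fun [set: R] h ->
  (forall y, 0 <= h y)%E -> (0 <= transfer (j := j) i f h x)%E.
Proof.
move=> mh h0; rewrite transferE//; apply: integral_ge0 => y _.
exact: integrand_ge0.
Qed.

Lemma measurable_transfer j i f h : measurable_fun [set: R] h ->
  (forall y, 0 <= h y)%E -> measurable_fun [set: R] (transfer (j := j) i f h).
Proof.
move=> mh h0; pose g (p : mR * mR) :=
  (h p.2 * (normal_pdf p.1 (s j) p.2 * L j i p.1 p.2 f)%:E)%E.
rewrite (_ : transfer i f h = fubini_F mu g); last first.
  by apply/funext => z; rewrite transferE.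
apply: measurable_fun_fubini_tonelli_F => [|p]; last exact: integrand_ge0.
apply: emeasurable_funM.
  by apply: measurableT_comp mh _; exact: measurable_snd.
apply/measurable_EFinP; apply: measurable_funM.
  by apply: measurable_normal_pdf2; rewrite ?gt_eqF.
exact: measurable_bridge_law.
Qed.

End transfer.

(** * Image of a weighted probability *)

Section weighted_law.
Context d (T : measurableType d) d2 (T2 : measurableType d2) (R : realType).
Variables (P : probability T R) (phi : T -> R) (X : T -> T2).
Hypotheses (mphi : measurable_fun [set: T] phi)
  (phi01 : forall w, 0 <= phi w <= 1) (mX : measurable_fun [set: T] X).

(* The proofs are arguments so that the measure structure can be inferred. *)
Definition weighted_law of measurable_fun [set: T] phi &
    (forall w, 0 <= phi w <= 1) & measurable_fun [set: T] X :=
  fun A : set T2 => (\int[P]_(w in X @^-1` A) (phi w)%:E)%E.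

Local Notation nu := (weighted_law mphi phi01 mX).

Let phi0 w : (0 <= (phi w)%:E)%E.
Proof. by rewrite lee_fin; case/andP: (phi01 w). Qed.

Let mE A : measurable A -> measurable (X @^-1` A).
Proof. by move=> mA; rewrite -[X in measurable X]setTI; exact: mX. Qed.

Let nu0 : nu set0 = 0%E.
Proof. by rewrite /weighted_law preimage_set0 integral_set0. Qed.

Let nu_ge0 A : (0 <= nu A)%E.
Proof. by apply: integral_ge0 => w _; exact: phi0. Qed.

Let nu_sigma_additive : semi_sigma_additive nu.
Proof.
move=> A mA tA mUA; rewrite /weighted_law preimage_bigcup ge0_integral_bigcup//.
- by apply: is_cvg_ereal_nneg_natsum => n _; exact: nu_ge0.
- by move=> n; exact: mE.
- by apply: measurable_funTS; exact/measurable_EFinP.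
- apply/trivIsetP => i j _ _ ij; rewrite -preimage_setI.
  by move/trivIsetP : tA => /(_ _ _ _ _ ij) ->//; rewrite preimage_set0.
Qed.

HB.instance Definition _ := isMeasure.Build _ _ _ nu nu0 nu_ge0 nu_sigma_additive.

Let nu_setT : (nu [set: T2] <= 1)%E.
Proof.
rewrite /weighted_law preimage_setT.
have PT : P [set: T] = 1%E by exact: probability_setT.
apply: (@le_trans _ _ (\int[P]_w (cst 1%E) w)%E).
  apply: ge0_le_integral => //.
  - exact/measurable_EFinP.
  - by move=> w _; rewrite lee_fin; case/andP: (phi01 w).
by rewrite integral_cst// mul1e le_eqVlt; apply/orP; left; apply/eqP.
Qed.

HB.instance Definition _ := Measure_isSubProbability.Build _ _ _ nu nu_setT.

End weighted_law.

Lemma integral_weighted_law d (T : measurableType d) d2 (T2 : measurableType d2)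
    (R : realType) (P : probability T R) (phi : T -> R) (X : T -> T2)
    (mphi : measurable_fun [set: T] phi) (phi01 : forall w, 0 <= phi w <= 1)
    (mX : measurable_fun [set: T] X) (f : T2 -> \bar R) :
  measurable_fun [set: T2] f -> (forall x, 0 <= f x)%E ->
  (\int[weighted_law P mphi phi01 mX]_x f x = \int[P]_w (f (X w) * (phi w)%:E))%E.
Proof.
move=> mf f0.
pose nu := weighted_law P mphi phi01 (@measurable_id _ T setT).
have nuE A : measurable A -> nu A = (\int[P]_(x in A) (phi x)%:E)%E by [].
have phi0 w : 0 <= phi w by case/andP: (phi01 w).
transitivity (\int[pushforward nu X]_x f x)%E.
  by apply: eq_measure_integral => A mA _.
rewrite ge0_integral_pushforward//= preimage_setT.
have mfX : measurable_fun [set: T] (f \o X) by exact: measurableT_comp mf mX.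
by rewrite (ge0_integral_density mphi phi0 nuE mfX (fun w => f0 (X w))).
Qed.

Section normal_scale.
Context (R : realType).
Local Notation mu := (@lebesgue_measure R).

Lemma ge0_integral_scale (k : R) (f : R -> \bar R) : 0 < k ->
  measurable_fun [set: R] f -> (forall x, 0 <= f x)%E ->
  (k%:E * \int[mu]_x f (k * x)%R = \int[mu]_x f x)%E.
Proof.
move=> k0 mf f0; pose phi (x : measurableTypeR R) : measurableTypeR R := k * x.
have mphi : measurable_fun [set: measurableTypeR R] phi by exact: measurable_funM.
pose nk : {nonneg R} := NngNum (ltW k0).
transitivity (\int[pushforward (mscale nk mu) phi]_x f x)%E.
  rewrite ge0_integral_pushforward//= preimage_setT ge0_integral_mscale//.
  exact: measurableT_comp mf mphi.
apply: eq_measure_integral => A mA _; apply/esym.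
apply: lebesgue_measure_unique => //=.
move=> _ [[a b]] _ <-.
rewrite /pushforward /mscale /=.
rewrite (_ : phi @^-1` _ = [set` `]k^-1 * a, k^-1 * b]]); last first.
  have e1 x : (a < k * x) = (k^-1 * a < x) by rewrite (mulrC _ a) ltr_pdivrMr// mulrC.
  have e2 x : (k * x <= b) = (x <= k^-1 * b) by rewrite (mulrC _ b) ler_pdivlMr// mulrC.
  by apply/seteqP; split => x /=; rewrite !in_itv/= /phi e1 e2.
rewrite !lebesgue_measure_itv/= !lte_fin ltr_pM2l ?invr_gt0//.
case: ifP => _; last by rewrite mule0.
by rewrite -!EFinD -EFinM -mulrBr mulVKf// gt_eqF.
Qed.

Lemma normal_prob_scale (k s : R) (B : set R) : 0 < k -> 0 < s -> measurable B ->
  normal_prob 0 s ((fun x => k * x) @^-1` B) = normal_prob 0 (k * s) B.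
Proof.
move=> k0 s0 mB; rewrite /normal_prob integral_mkcond [RHS]integral_mkcond.
have mR : measurable_fun [set: R] ((fun x => (normal_pdf 0 (k * s) x)%:E) \_ B).
  apply/(measurable_restrictT _ mB); apply: measurable_funTS.
  by apply/measurable_EFinP; exact: measurable_normal_pdf.
rewrite -(ge0_integral_scale k0 mR); last first.
  by move=> x; apply: erestrict_ge0 => y _; rewrite lee_fin normal_pdf_ge0.
rewrite -ge0_integralZl//.
- apply: eq_integral => x _; rewrite !patchE.
  have -> : (x \in (fun y => k * y) @^-1` B) = (k * x \in B).
    by apply/idP/idP; rewrite !inE.
  case: ifP => _; last by rewrite mule0.
  rewrite -EFinM !normal_pdf0E//; last exact: mulr_gt0.
  have h := sqrt2pi_gt0 R.
  congr (_%:E); rewrite mulrA; congr (_ * expR _); first by field; rewrite !gt_eqF.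
  by rewrite !subr0; field; rewrite !gt_eqF.
- apply: (measurableT_comp mR); exact: measurable_funM.
- by move=> x _; apply: erestrict_ge0 => y _; rewrite lee_fin normal_pdf_ge0.
- by rewrite lee_fin ltW.
Qed.

End normal_scale.

(** * Markov property of the path sampled on a grid *)

Section brownian_chain.
Context (R : realType) d (Om : measurableType d) (P : probability Om R).
Variable W : R -> Om -> R.
Hypothesis bmW : brownian_motion P W.
Variables (K : nat) (sig : R).
Hypotheses (K0 : (0 < K)%N) (sig0 : 0 < sig).
Local Notation mR := (measurableTypeR R).
Local Notation mu := (@lebesgue_measure R).

Definition grid (k : nat) : R := k%:R / K%:R.
Definition chain (k : nat) (w : Om) : R := sig * W (grid k) w.
Definition chain_step (k : nat) (w : Om) : R := chain k.+1 w - chain k w.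
Definition step_sd : R := sig * Num.sqrt (K%:R^-1).
Local Notation X := chain.
Local Notation Y := chain_step.
Local Notation gam := (normal_prob 0 step_sd : probability mR R).

Let K0R : 0 < K%:R :> R. Proof. by rewrite ltr0n. Qed.

Lemma step_sd_gt0 : 0 < step_sd.
Proof. by rewrite mulr_gt0// sqrtr_gt0 invr_gt0. Qed.

Lemma grid_ge0 k : 0 <= grid k.
Proof. by rewrite divr_ge0. Qed.

Lemma grid_le1 k : (k <= K)%N -> grid k <= 1.
Proof. by move=> kK; rewrite ler_pdivrMr// mul1r ler_nat. Qed.

Lemma ltr_grid k : grid k < grid k.+1.
Proof. by rewrite ltr_pM2r ?invr_gt0// ltr_nat. Qed.

Lemma measurable_chain k : (k <= K)%N -> measurable_fun [set: Om] (X k).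
Proof.
move=> kK; apply: measurable_funM => //; apply: (bm_measurable bmW).
by rewrite grid_ge0 grid_le1.
Qed.

Lemma measurable_chain_step k : (k < K)%N -> measurable_fun [set: Om] (Y k).
Proof.
by move=> kK; apply: measurable_funB; apply: measurable_chain => //; exact: ltnW.
Qed.

Let YE k w : Y k w = sig * (W (grid k.+1) w - W (grid k) w).
Proof. by rewrite mulrBr. Qed.

Let mscale_pre (B : set R) : measurable B -> measurable [set x : R | B (sig * x)].
Proof.
move=> mB; rewrite (_ : [set x | _] = (fun x => sig * x) @^-1` B)//.
rewrite -[X in measurable X]setTI.
have msig : measurable_fun [set: mR] (fun x : mR => sig * x : mR).
  exact: measurable_funM.
exact: msig.
Qed.

Lemma chain_step_law k (B : set R) : (k < K)%N -> measurable B ->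
  P [set w | B (Y k w)] = gam B.
Proof.
move=> kK mB; have mB' := mscale_pre mB.
rewrite (_ : [set w | _] =
  [set w | [set x | B (sig * x)] (W (grid k.+1) w - W (grid k) w)]); last first.
  by apply/seteqP; split => w /=; rewrite YE.
rewrite (bm_gaussian bmW (grid_ge0 k) (ltr_grid k) (grid_le1 kK) mB').
have -> : grid k.+1 - grid k = K%:R^-1.
  by rewrite /grid -mulrBl -natrB// subSnn mul1r.
by rewrite /= -normal_prob_scale// sqrtr_gt0 invr_gt0.
Qed.

Definition future (m : nat) (B : nat -> set R) : set Om :=
  [set w | forall k, (m <= k < K)%N -> B k (Y k w)].

Lemma future_prob m (B : nat -> set R) : (forall k, measurable (B k)) ->
  P (future m B) = (\prod_(k < K) if (m <= k)%N then gam (B k) else 1)%E.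
Proof.
(* [bm_independent] speaks of all increments from the first on; the full set fills in those before
   [m], and each of them contributes a factor 1. *)
move=> mB; pose B' k : set R := if (m <= k)%N then [set x | B k (sig * x)] else setT.
have mB' k : measurable (B' k).
  by rewrite /B'; case: ifP => // _; exact: mscale_pre.
have -> : future m B = [set w | forall k, (k < K)%N ->
    B' k (W (grid k.+1) w - W (grid k) w)].
  apply/seteqP; split => w /= H k.
    move=> kK; rewrite /B'; case: ifPn => // mk.
    by have /= := H k; rewrite mk kK YE; apply.
  by move=> /andP[mk kK]; have := H k kK; rewrite /B' mk YE.
rewrite (bm_independent bmW (t := grid) (grid_ge0 0) (grid_le1 (leqnn K))
  (fun k _ => ltr_grid k) (fun k _ => mB' k)).
apply: eq_bigr => k _; rewrite /B'; case: ifPn => mk.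
  rewrite -(chain_step_law (ltn_ord k) (mB k)); congr (P _).
  by apply/seteqP; split => w /=; rewrite YE.
by rewrite (_ : [set w | _] = setT); [exact: probability_setT|apply/seteqP; split].
Qed.

Lemma futureS_prob m (B : nat -> set R) : (m < K)%N -> (forall k, measurable (B k)) ->
  P (future m B) = (gam (B m) * P (future m.+1 B))%E.
Proof.
move=> mK mB; rewrite !future_prob// (bigD1 (Ordinal mK))//= leqnn; congr (_ * _)%E.
rewrite [RHS](bigD1 (Ordinal mK))//= ltnn mul1e; apply: eq_bigr => k km.
rewrite ltn_neqAle; have -> : (m != k) = true.
  by rewrite eq_sym; apply: contraNN km => /eqP e; apply/eqP/val_inj.
by [].
Qed.

Lemma measurable_future m (B : nat -> set R) : (forall k, measurable (B k)) ->
  measurable (future m B).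
Proof.
move=> mB; rewrite (_ : future m B = \bigcap_k
  (if (m <= k < K)%N then Y k @^-1` B k else setT)); last first.
  apply/seteqP; split => w /= H k.
    by move=> _; case: ifPn => // mk; exact: H.
  by move=> mk; have := H k I; rewrite mk.
apply: bigcap_measurableType => k _; case: ifPn => // /andP[_ kK].
by rewrite -[X in measurable X]setTI; exact: measurable_chain_step.
Qed.

Let measurable_setT_future m : future m (fun=> setT) = setT.
Proof. by apply/seteqP; split. Qed.

(** Markov property without a filtration: weighted by [phi], the position [X m] is independent of
    the increments from [m] on. It is tested on rectangles only, the form in which [bm_independent]
    supplies it, and [pastS] propagates it along the chain. *)
Definition past (m : nat) (phi : Om -> R) : Prop :=
  [/\ measurable_fun [set: Om] phi, forall w, 0 <= phi w <= 1 &
  forall (A : set R) (B : nat -> set R), measurable A ->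
    (forall k, measurable (B k)) ->
    (\int[P]_(w in future m B) (phi w * \1_A (X m w))%:E =
     P (future m B) * \int[P]_w (phi w * \1_A (X m w))%:E)%E].

(** The chain starts at 0 almost surely, so the indicator of [A] is almost surely constant and comes
    out of both integrals. *)
Lemma past0 : past 0 (fun=> 1).
Proof.
split => //; first by move=> w; rewrite ler01 lexx.
move=> A B mA mB.
have mX0 : measurable_fun [set: Om] (X 0) by exact: measurable_chain.
have mX0A : measurable (X 0 @^-1` A).
  by rewrite -[X in measurable X]setTI; exact: mX0.
have i0 (G : set Om) : measurable G ->
    (\int[P]_(w in G) (1 * \1_A (X 0 w))%:E = P G * (\1_A (0 : R))%:E)%E.
  move=> mG; rewrite -[RHS]muleC -integral_cst//; apply: ae_eq_integral => //.
  - apply: measurable_funTS; apply/measurable_EFinP; apply: measurable_funM => //.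
    exact: (measurableT_comp (measurable_indic mA)).
  - have := bm_start bmW; apply: filterS => w W0 _ /=.
    by rewrite /chain /grid mul0r W0 mulr0 mul1r.
rewrite (i0 _ (measurable_future 0 mB)) (i0 _ measurableT).
have -> : P setT = 1%E by exact: probability_setT.
by rewrite mul1e.
Qed.

Section step.
Variables (m : nat) (phi : Om -> R) (B : nat -> set R) (f : R * R -> \bar R).
Hypotheses (mK : (m < K)%N) (pphi : past m phi) (mB : forall k, measurable (B k)).
Hypotheses (mf : measurable_fun [set: mR * mR] (f : mR * mR -> \bar R))
  (f0 : forall p, (0 <= f p)%E).

Let mphi : measurable_fun [set: Om] phi. Proof. by case: pphi. Qed.
Let phi01 w : 0 <= phi w <= 1. Proof. by case: pphi. Qed.
Let mX : measurable_fun [set: Om] (X m : Om -> mR).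
Proof. by apply: measurable_chain; exact: ltnW. Qed.
Let mY : measurable_fun [set: Om] (Y m : Om -> mR).
Proof. exact: measurable_chain_step. Qed.
Let mXY : measurable_fun [set: Om] (fun w => (X m w, Y m w) : mR * mR).
Proof. exact: measurable_fun_pair. Qed.

Let G := future m.+1 B.
Let mG : measurable G. Proof. exact: measurable_future. Qed.
Let kap : R := fine (P G).
Let kapE : (kap%:E = P G)%E. Proof. by rewrite fineK// fin_num_measure. Qed.
Let kap01 : 0 <= kap <= 1.
Proof. by rewrite -!lee_fin kapE measure_ge0 probability_le1. Qed.

Let phiG w := phi w * \1_G w.
Let mphiG : measurable_fun [set: Om] phiG.
Proof. by apply: measurable_funM => //; exact: measurable_indic. Qed.
Let phiG01 w : 0 <= phiG w <= 1.
Proof.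
have /andP[p0 p1] := phi01 w; rewrite /phiG indicE.
by case: (_ \in _); rewrite ?mulr1 ?p0 ?p1// mulr0 lexx ler01.
Qed.

Let phik w := phi w * kap.
Let mphik : measurable_fun [set: Om] phik.
Proof. exact: measurable_funM. Qed.
Let phik01 w : 0 <= phik w <= 1.
Proof.
have /andP[p0 p1] := phi01 w; have /andP[k0 k1] := kap01.
by rewrite mulr_ge0//= -[leRHS]mulr1 ler_pM.
Qed.

(** Under the weight [phi] on the event [G], position and next increment have a product law. Both
    sides are finite measures in [C], so rectangles suffice, and on them the identity is the one
    granted by [past m phi]. *)
Let law_product C : measurable C ->
  ((weighted_law P mphik phik01 mX) \x gam)%E C = weighted_law P mphiG phiG01 mXY C.
Proof.
apply: product_measure_unique => A A' mA mA'.
(* Inserting [A'] as the condition on increment [m] turns the rectangle into an event of [future m],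
   to which the hypothesis on [phi] applies. *)
pose B' k := if k == m then A' else B k.
have mB' k : measurable (B' k) by rewrite /B'; case: ifP => _; [exact: mA'|exact: mB].
have [_ _ pE] := pphi.
have h := pE A B' mA mB'.
have fB' : future m B' = (Y m @^-1` A') `&` G.
  apply/seteqP; split => w /=.
    move=> H; split; first by have := H m; rewrite leqnn mK /B' eqxx; apply.
    move=> k /andP[mk kK]; have := H k; rewrite (ltnW mk) kK /B'.
    by rewrite gtn_eqF//; apply.
  move=> [H1 H2] k /andP[mk kK]; rewrite /B'; case: eqP => [->//|/eqP km].
  by apply: H2; rewrite kK andbT ltn_neqAle eq_sym km mk.
have PfB' : P (future m B') = (gam A' * kap%:E)%E.
  rewrite futureS_prob//; congr (_ * _)%E; first by rewrite /B' eqxx.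
  rewrite kapE; congr (P _); apply/seteqP; split => w /= H k mk.
    by have := H k mk; rewrite /B' gtn_eqF//; case/andP: mk.
  by rewrite /B' gtn_eqF; [exact: H|case/andP: mk].
have mG' : measurable (future m B') by exact: measurable_future.
have mA1 : measurable (X m @^-1` A).
  by rewrite -[X in measurable X]setTI; exact: mX.
have phi1 w : 0 <= phi w by case/andP: (phi01 w).
have mphiA : measurable_fun [set: Om] (fun w => (phi w * \1_A (X m w))%:E).
  apply/measurable_EFinP; apply: measurable_funM => //.
  exact: (measurableT_comp (measurable_indic mA) mX).
transitivity (P (future m B') * \int[P]_w (phi w * \1_A (X m w))%:E)%E.
  rewrite -h; change (\int[P]_(w in (fun w => (X m w, Y m w)) @^-1` (A `*` A'))
    (phiG w)%:E = \int[P]_(w in future m B') (phi w * \1_A (X m w))%:E)%E.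
  rewrite integral_mkcond [RHS]integral_mkcond; apply: eq_integral => w _.
  rewrite !patchE /phiG !indicE fB'.
  have -> : (w \in (fun w => (X m w, Y m w)) @^-1` (A `*` A')) =
      (X m w \in A) && (Y m w \in A').
    by apply/idP/andP; rewrite !inE.
  have -> : (w \in Y m @^-1` A' `&` G) = (Y m w \in A') && (w \in G).
    by apply/idP/andP; rewrite !inE.
  case: (X m w \in A); case: (Y m w \in A'); case: (w \in G);
    by rewrite /= ?mulr1 ?mulr0.
rewrite PfB' -muleA [RHS]muleC; congr (_ * _)%E.
change (kap%:E * \int[P]_w (phi w * \1_A (X m w))%:E =
  \int[P]_(w in X m @^-1` A) (phik w)%:E)%E.
rewrite [RHS]integral_mkcond.
rewrite -ge0_integralZl//.
- apply: eq_integral => w _; rewrite patchE indicE.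
  have -> : (w \in X m @^-1` A) = (X m w \in A) by apply/idP/idP; rewrite !inE.
  by case: (X m w \in A); rewrite ?mulr1 ?mulr0 ?mule0// /phik -EFinM mulrC.
- by move=> w _; rewrite lee_fin mulr_ge0.
- by rewrite lee_fin; case/andP: kap01.
Qed.

Lemma past_step :
  (\int[P]_(w in G) ((phi w)%:E * f (X m w, Y m w)) =
   P G * \int[P]_w ((phi w)%:E * \int[gam]_y f (X m w, y)))%E.
Proof.
have phi0 w : 0 <= phi w by case/andP: (phi01 w).
have mfXY : measurable_fun [set: Om] (fun w => f (X m w, Y m w)).
  exact: measurableT_comp mf mXY.
have mF : measurable_fun [set: mR] (fun x : mR => \int[gam]_y f (x, y))%E.
  exact: (@measurable_fun_fubini_tonelli_F _ _ mR mR R (normal_prob 0 step_sd) f mf f0).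
have F0 x : (0 <= \int[gam]_y f (x, y))%E by apply: integral_ge0.
transitivity (\int[weighted_law P mphiG phiG01 mXY]_p f p)%E.
  rewrite (integral_weighted_law P mphiG phiG01 mXY mf f0) integral_mkcond.
  apply: eq_integral => w _; rewrite patchE /phiG indicE.
  by case: (w \in G); rewrite ?mulr1 ?mulr0 ?mule0// muleC.
transitivity (\int[(weighted_law P mphik phik01 mX) \x gam]_p f p)%E.
  by apply: eq_measure_integral => C mC _; apply/esym; exact: law_product.
rewrite (fubini_tonelli1 _ mf f0) /fubini_F.
rewrite (integral_weighted_law P mphik phik01 mX mF F0) -kapE -ge0_integralZl//.
- by apply: eq_integral => w _; rewrite /phik EFinM muleA (muleC _ (kap%:E)) (muleC (phi w)%:E).
- apply: emeasurable_funM; first exact/measurable_EFinP.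
  exact: measurableT_comp mF mX.
- by move=> w _; rewrite mule_ge0// lee_fin.
- by rewrite lee_fin; case/andP: kap01.
Qed.

End step.

Lemma chainS m w : X m.+1 w = X m w + Y m w.
Proof. by rewrite addrC subrK. Qed.

Let transition_fun (be : R -> R) (h : R -> \bar R) (p : R * R) : \bar R :=
  ((be p.1)%:E * h (p.1 + p.2)%R)%E.

Let measurable_transition (be : R -> R) (h : R -> \bar R) :
  measurable_fun [set: R] be -> measurable_fun [set: R] h ->
  measurable_fun [set: mR * mR] (transition_fun be h : mR * mR -> \bar R).
Proof.
move=> mbe mh; apply: emeasurable_funM.
  by apply/measurable_EFinP; apply: (measurableT_comp mbe); exact: measurable_fst.
apply: (measurableT_comp mh); apply: measurable_funD.
  exact: measurable_fst.
exact: measurable_snd.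
Qed.

Let measurable_shift (h : R -> \bar R) x :
  measurable_fun [set: R] h -> measurable_fun [set: R] (fun y => h (x + y)).
Proof. by move=> mh; apply: (measurableT_comp mh); exact: measurable_funD. Qed.

Lemma past_transition m phi (be : R -> R) (h : R -> \bar R) : (m < K)%N ->
  past m phi -> measurable_fun [set: R] be -> (forall x, 0 <= be x) ->
  measurable_fun [set: R] h -> (forall x, 0 <= h x)%E ->
  (\int[P]_w ((phi w * be (X m w))%:E * h (X m.+1 w)) =
   \int[P]_w ((phi w)%:E *
     ((be (X m w))%:E * \int[mu]_y (h y * (normal_pdf (X m w) step_sd y)%:E))))%E.
Proof.
move=> mK pphi mbe be0 mh h0.
have f0 p : (0 <= transition_fun be h p)%E by rewrite mule_ge0// lee_fin.
have := past_step mK pphi (B := fun=> setT) (fun=> measurableT)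
  (measurable_transition mbe mh) f0.
rewrite measurable_setT_future.
have -> : P setT = 1%E by exact: probability_setT.
rewrite mul1e => e; transitivity (\int[P]_w ((phi w)%:E * transition_fun be h (X m w, Y m w)))%E.
  by apply: eq_integral => w _; rewrite EFinM -muleA /transition_fun/= -chainS.
rewrite e; apply: eq_integral => w _; congr (_ * _)%E.
rewrite /transition_fun/= ge0_integralZl//; last 2 first.
- exact: measurable_shift.
- by rewrite lee_fin.
congr (_ * _)%E; rewrite ge0_integral_normal_prob_shift// gt_eqF//.
exact: step_sd_gt0.
Qed.

Lemma pastS m phi (be : R -> R) : (m < K)%N -> past m phi ->
  measurable_fun [set: R] be -> (forall x, 0 <= be x <= 1) ->
  past m.+1 (fun w => phi w * be (X m w)).
Proof.
move=> mK pphi mbe be01; have [mphi phi01 _] := pphi.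
have mX : measurable_fun [set: Om] (X m) by apply: measurable_chain; exact: ltnW.
split.
- by apply: measurable_funM => //; exact: (measurableT_comp mbe mX).
- move=> w; have /andP[p0 p1] := phi01 w; have /andP[b0 b1] := be01 (X m w).
  by rewrite mulr_ge0//= -[leRHS]mulr1 ler_pM.
- move=> A B mA mB.
  pose h x : \bar R := (\1_A x)%:E.
  have mh : measurable_fun [set: R] h.
    by apply/measurable_EFinP; exact: measurable_indic.
  have f0 p : (0 <= transition_fun be h p)%E.
    by rewrite mule_ge0// lee_fin//; case/andP: (be01 p.1).
  have stepE w : (phi w * be (X m w) * \1_A (X m.+1 w))%:E =
      ((phi w)%:E * transition_fun be h (X m w, Y m w))%E.
    by rewrite /transition_fun/= -chainS !EFinM muleA.
  (* Once with the event and once with the full set: both right sides contain the same integral over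
     the next increment, so the probability of the event factors out. *)
  have e := past_step mK pphi mB (measurable_transition mbe mh) f0.
  have := past_step mK pphi (B := fun=> setT) (fun=> measurableT)
    (measurable_transition mbe mh) f0.
  rewrite measurable_setT_future.
  have -> : P setT = 1%E by exact: probability_setT.
  rewrite mul1e => e1.
  under eq_integral do rewrite stepE.
  rewrite e -e1; congr (_ * _)%E.
  by apply: eq_integral => w _; rewrite stepE.
Qed.

End brownian_chain.

Section tree_chain.
Context (R : realType) d (Om : measurableType d) (P : probability Om R).
Variable W : R -> Om -> R.
Hypothesis bmW : brownian_motion P W.
Variables (K : nat) (sig : R).
Hypotheses (K0 : (0 < K)%N) (sig0 : 0 < sig).
Variables (F : finType) (b : nat -> R -> F -> R) (c : R).
Hypothesis c0 : 0 <= c.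
Hypothesis b0 : forall i x f, 0 <= b i x f.
Hypothesis b1 : forall i x, \sum_f b i x f = 1.
Hypothesis bdom : forall i x x' f, x <= x' ->
  b i x' f <= expR (c * (x' - x)) * b i x f.
Variable s : nat -> R.
Hypotheses (s0 : forall j, 0 < s j) (sS : forall j, s j.+1 = Num.sqrt 2 * s j).
Hypothesis s0E : s 0 = step_sd K sig.
Local Notation mu := (@lebesgue_measure R).
Local Notation mR := (measurableTypeR R).
Local Notation X := (chain W K sig).
Local Notation past := (past P W K sig).

Let psi j i (f : tree F j) (w : Om) : R :=
  tree_law (fun k g => b k (X k w) g) i f.

(** The two claims are proved together: the weight accumulated over the first half must satisfy
    [past] before the second half can be processed, and the first half is run with the transfer of
    the second as its function [h]. *)
Lemma tree_chain j i (f : tree F j) (h : R -> \bar R) (phi : Om -> R) :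
  (i.+1 * 2 ^ j <= K)%N -> past (i * 2 ^ j) phi ->
  measurable_fun [set: R] h -> (forall x, 0 <= h x)%E ->
  past (i.+1 * 2 ^ j) (fun w => phi w * psi i f w) /\
  (\int[P]_w ((phi w)%:E * transfer b s i f h (X (i * 2 ^ j) w)) =
   \int[P]_w ((phi w * psi i f w)%:E * h (X (i.+1 * 2 ^ j) w)))%E.
Proof.
elim: j i f h phi => [|j IH] i f h phi iK pphi mh h0.
  rewrite !muln1 in iK pphi *.
  have psiE w : psi i f w = b i (X i w) f by rewrite /psi tree_law0.
  have be01 x : 0 <= b i x f <= 1.
    by rewrite b0 (pmf_le1 _ _ (b1 i x)).
  have mb : measurable_fun [set: R] (b i ^~ f) by exact: measurable_leaf_law bdom i f.
  have -> : (fun w => phi w * psi i f w) = (fun w => phi w * b i (X i w) f).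
    by apply/funext => w; rewrite psiE.
  split; first exact: (pastS bmW K0 sig0 iK pphi mb be01).
  under [in RHS]eq_integral do rewrite psiE.
  rewrite (past_transition bmW K0 sig0 iK pphi mb (fun x => b0 i x f) mh h0).
  by apply: eq_integral => w _; rewrite /= s0E.
have e1 : (i * 2 ^ j.+1 = i.*2 * 2 ^ j)%N by rewrite expnS mulnA muln2.
have e2 : (i.+1 * 2 ^ j.+1 = i.*2.+1.+1 * 2 ^ j)%N by rewrite expnS mulnA muln2.
have psiE w : psi i f w = psi i.*2 f.1 w * psi i.*2.+1 f.2 w.
  by rewrite /psi tree_lawS.
rewrite e1 e2 in iK pphi *.
have iK1 : (i.*2.+1 * 2 ^ j <= K)%N by rewrite (leq_trans _ iK)// leq_mul.
have mT := measurable_transfer c0 b0 b1 bdom s0 sS i.*2.+1 f.2 mh h0.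
have T0 x := transfer_ge0 c0 b0 b1 bdom s0 sS i.*2.+1 f.2 x mh h0.
have [p1 E1] := IH i.*2 f.1 _ phi iK1 pphi mT T0.
have [p2 E2] := IH i.*2.+1 f.2 h _ iK p1 mh h0.
have -> : (fun w => phi w * psi i f w) =
    (fun w => phi w * psi i.*2 f.1 w * psi i.*2.+1 f.2 w).
  by apply/funext => w; rewrite psiE mulrA.
split => //; rewrite [LHS]E1 E2.
by apply: eq_integral => w _; rewrite psiE mulrA.
Qed.

(** Case [h = 1] over the whole time interval. The start is almost surely 0, and integrating over
    the free end gives the outer Gaussian mixture. *)
Lemma tree_law_expectation j (f : tree F j) : K = (2 ^ j)%N ->
  (\int[P]_w (tree_law (fun k g => b k (X k w) g) 0 f)%:E =
   (mixture (normal_prob 0 (s j)) (bridge_law b (fun k => (s k / Num.sqrt 2)%R) j 0 0) f)%:E)%E.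
Proof.
move=> KE; have jK : (1 * 2 ^ j <= K)%N by rewrite mul1n KE.
have m1 : measurable_fun [set: R] (cst 1%E : R -> \bar R) by exact: measurable_cst.
have p0 : past (0 * 2 ^ j) (fun=> 1) by rewrite mul0n; exact: past0.
have [_] := tree_chain f jK p0 m1 (fun=> lee01).
under eq_integral do rewrite mul1e mul0n.
under [X in _ = X]eq_integral do rewrite mul1r mule1.
move=> <-.
have mT := measurable_transfer c0 b0 b1 bdom s0 sS 0 f m1 (fun=> lee01).
have mX0 : measurable_fun [set: Om] (X 0) by exact: (measurable_chain bmW sig K0).
transitivity (\int[P]_w (cst (transfer b s 0 f (cst 1%E) 0)) w)%E.
  apply: ae_eq_integral => //.
  - exact: measurableT_comp mT mX0.
  - have := bm_start bmW; apply: filterS => w W0 _ /=.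
    by rewrite /chain /grid mul0r W0 mulr0.
transitivity (transfer b s 0 f (cst 1%E) 0 * 1)%E.
  by rewrite integral_cst//; congr (_ * _)%E; exact: probability_setT.
rewrite mule1 (transferE c0 b0 b1 bdom s0 sS)//.
set L := bridge_law _ _.
have ldom z z' : z <= z' -> forall g, L j 0 0 z' g <=
    expR (2 ^+ j * c * (z' - z)) * L j 0 0 z g.
  move=> zz g; have := bridge_law_dominated c0 b0 b1 bdom
    (fun k => s k / Num.sqrt 2) 0 g (lexx 0) zz.
  by rewrite subrr add0r.
have mL : measurable_fun [set: R] (fun y => L j 0 0 y f).
  exact: (dominated_measurable (fun z z' g zz => ldom z z' zz g) f).
have L0 y : 0 <= L j 0 0 y f by exact: (bridge_law_ge0 c0 b0 b1 bdom).
rewrite /mixture /Rintegral fineK.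
  rewrite ge0_integral_normal_prob; [|exact/measurable_EFinP|by move=> y; rewrite lee_fin].
  by apply: eq_integral => y _; rewrite mul1e -EFinM mulrC.
apply: integrable_fin_num => //.
apply: (@probability_integrable _ _ _ (normal_prob 0 (s j)) _ 1) => //.
move=> y; rewrite ger0_norm//.
apply: (pmf_le1 f _ (sum_bridge_law c0 b0 b1 bdom _ j 0 0 y)) => g.
exact: (bridge_law_ge0 c0 b0 b1 bdom).
Qed.

End tree_chain.

(** * Intensities of time slabs *)

Section intensity_cells.
Context (R : realType).
Local Notation mu := (@lebesgue_measure R).
Local Notation lam := (lebesgue_measure \x lebesgue_measure)%E.

Definition above (X : R -> R) : set (R * R) :=
  strip `&` [set z | X z.1 <= z.2].

Lemma measurable_strip : measurable (@strip R).
Proof. by apply: measurableX. Qed.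

Lemma measurable_above (X : R -> R) :
  {within `[0, 1], continuous X} -> measurable (above X).
Proof.
move=> cX; pose Y := X \_ `[0, 1].
have mY : measurable_fun [set: R] Y.
  apply/(measurable_restrictT _ (measurable_itv _)).
  by apply: subspace_continuous_measurable_fun => //; exact: measurable_itv.
rewrite (_ : above X = strip `&` [set z | Y z.1 <= z.2]).
  apply: measurableI; first exact: measurable_strip.
  have mb : measurable_fun [set: R * R] (fun z : R * R => Y z.1 <= z.2).
    apply: measurable_fun_ler; last exact: measurable_snd.
    exact: (measurableT_comp mY measurable_fst).
  by have := mb measurableT [set true] I; rewrite setTI.
apply/seteqP; split => -[t y] [[t01 _] /= H]; split => //=.
  by rewrite /Y patchE mem_set.
by move: H; rewrite /Y patchE mem_set.
Qed.

Lemma measurable_above_cst (x : R) : measurable (above (fun=> x)).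
Proof. by apply: measurable_above; exact: cst_continuous. Qed.

Lemma intensityE (n : nat) (X : R -> R) (A : set (R * R)) : measurable A ->
  measurable (above X) -> intensity n X A = (n%:R%:E * lam (A `&` above X))%E.
Proof.
move=> mA mX; rewrite /intensity.
have mAS : measurable (A `&` strip) by apply: measurableI => //; exact: measurable_strip.
transitivity (\int[lam]_(z in A `&` strip) (n%:R%:E * (\1_(above X) z)%:E))%E.
  apply: eq_integral => z; rewrite inE => -[Az Sz]; rewrite -EFinM; congr (_ * _)%:E.
  rewrite indicE; congr (_%:R); congr nat_of_bool.
  by apply/idP/idP => [Xz|]; [rewrite inE; split|rewrite inE => -[]].
have m1 : measurable_fun (A `&` strip) (fun z => (\1_(above X) z)%:E : \bar R).
  apply: measurable_funTS; apply/measurable_EFinP; exact: measurable_indic.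
rewrite (ge0_integralZl lam mAS m1)//.
congr (_ * _)%E; rewrite integral_indic//; congr (lam _).
by rewrite setIC -setIA; congr (_ `&` _); rewrite /above setIA setIid.
Qed.

Lemma bounded_set_lam (A : set (R * R)) : measurable A -> bounded_set A ->
  (lam A < +oo)%E.
Proof.
move=> mA [M [_ AM]]; pose r : R := `|M| + 1.
have Ar z : A z -> `|z.1| <= r /\ `|z.2| <= r.
  move=> Az; have Mr : M < r by rewrite /r; have := ler_norm M; lra.
  have /= := AM _ Mr _ Az; rewrite prod_normE ge_max => /andP[].
  by split.
have mI : measurable (`[- r, r]%classic : set R) by exact: measurable_itv.
apply: (@le_lt_trans _ _ (lam (`[- r, r] `*` `[- r, r]))).
  apply: le_measure; rewrite ?inE//; first exact: measurableX.
  by move=> z /Ar[z1 z2]; split; rewrite /= in_itv/= -ler_norml.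
have I_fin : (mu (`[(- r)%R, r]%classic : set R) < +oo)%E.
  by rewrite lebesgue_measure_itv/=; case: ifP => _; rewrite ?ltry// -EFinD ltry.
rewrite product_measure1E//; apply: lte_mul_pinfty => //.
by rewrite ge0_fin_numE.
Qed.

Lemma intensity_ge0 (n : nat) (X : R -> R) (A : set (R * R)) :
  (0 <= intensity n X A)%E.
Proof. by apply: integral_ge0 => z _; rewrite lee_fin mulr_ge0. Qed.

(** Within a cell the regions above the two paths differ only inside [D]; the errors
    [n * lam (C i & D)] add up to at most [n * lam D] because the cells are disjoint. *)
Lemma intensity_diff_le (n : nat) (I : finType) (C : I -> set (R * R))
    (X X' : R -> R) (D : set (R * R)) (c : R) :
  (forall i, measurable (C i)) -> trivIset setT C ->
  (forall i, (lam (C i) < +oo)%E) ->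
  measurable (above X) -> measurable (above X') ->
  measurable D -> (lam D <= c%:E)%E ->
  (forall i z, C i z -> strip z -> (X z.1 <= z.2) != (X' z.1 <= z.2) -> D z) ->
  \sum_i `|fine (intensity n X (C i)) - fine (intensity n X' (C i))| <= n%:R * c.
Proof.
move=> mC tC fC mX mX' mD Dc CD.
have mCD i : measurable (C i `&` D) by exact: measurableI.
have fin i (B : set (R * R)) : measurable B -> lam (C i `&` B) \is a fin_num.
  move=> mB; rewrite ge0_fin_numE//; apply: le_lt_trans (fC i).
  have mCB := measurableI _ _ (mC i) mB.
  by apply: le_measure; rewrite ?inE; [exact: mCB|exact: mC|exact: subIsetl].
have [g gE] : exists g : I -> set (R * R) -> R, forall i B, g i B = fine (lam (C i `&` B)).
  by exists (fun i B => fine (lam (C i `&` B))).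
have one (Y Y' : R -> R) i : measurable (above Y) -> measurable (above Y') ->
    (forall z, C i z -> strip z -> (Y z.1 <= z.2) != (Y' z.1 <= z.2) -> D z) ->
    g i (above Y) <= g i (above Y') + g i D.
  move=> mY mY' YD; rewrite !gE.
  have le : (lam (C i `&` above Y) <= lam (C i `&` above Y') + lam (C i `&` D))%E.
    apply: (@le_trans _ _ (lam ((C i `&` above Y') `|` (C i `&` D)))).
      apply: le_measure; rewrite ?inE.
      - exact: (measurableI _ _ (mC i) mY).
      - exact: (measurableU _ _ (measurableI _ _ (mC i) mY') (mCD i)).
      - move=> z [Cz [Sz Yz]]; case: (boolP (Y' z.1 <= z.2)) => Y'z; first by left.
        by right; split => //; apply: YD => //; rewrite (negbTE Y'z); move: Yz => /= ->.
    have m1 := measurableI _ _ (mC i) mY'; have m2 := mCD i.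
    by apply: measureU2; [exact: m1|exact: m2].
  move: (fin i _ mY) (fin i _ mY') (fin i _ mD) le.
  move: (lam (C i `&` above Y)) (lam (C i `&` above Y')) (lam (C i `&` D)).
  by move=> p q r fp fq fr; rewrite -lee_fin EFinD !fineK.
have each i : `|fine (intensity n X (C i)) - fine (intensity n X' (C i))| <=
    n%:R * g i D.
  rewrite (intensityE _ (mC i) mX) (intensityE _ (mC i) mX').
  rewrite !fineM ?fin//= -!gE -mulrBr normrM ger0_norm// ler_wpM2l//.
  have h1 := one X X' i mX mX' (CD i).
  have h2 : g i (above X') <= g i (above X) + g i D.
    by apply: (one _ _ i mX' mX) => z Cz Sz; rewrite eq_sym; exact: CD Cz Sz.
  by rewrite ler_norml; lra.
apply: le_trans (ler_sum _ (fun i _ => each i)) _.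
rewrite -mulr_sumr ler_wpM2l// -lee_fin -sumEFin.
under eq_bigr do rewrite gE fineK ?fin//.
apply: le_trans Dc; rewrite fsbig_seq ?index_enum_uniq// -measure_fin_bigcup//.
- apply: le_measure; rewrite ?inE.
  + apply: fin_bigcup_measurable; first exact: finite_seq.
    by move=> i _; exact: mCD.
  + exact: mD.
  + by move=> z [i _ []].
- apply/trivIsetP => i j _ _ ij; rewrite setIACA.
  by move/trivIsetP: tC => /(_ i j Logic.I Logic.I ij) ->; rewrite set0I.
- by move=> i _; exact: mCD.
Qed.

End intensity_cells.

(** * Time slabs and freezing of the path *)

Section slabs.
Context (R : realType).
Variable K : nat.
Hypothesis K0 : (0 < K)%N.
Local Notation lam := (lebesgue_measure \x lebesgue_measure)%E.

(** The cap at [K.-1] puts [t = 1] into the last slab and gives every real an index, so that the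
    slabs partition the whole plane. *)
Definition time_index (t : R) : nat := minn (Num.truncn (K%:R * t)) K.-1.

Definition slab (k : nat) : set (R * R) := [set z | time_index z.1 = k].

Let K0R : 0 < K%:R :> R. Proof. by rewrite ltr0n. Qed.

Lemma time_index_lt t : (time_index t < K)%N.
Proof. by rewrite /time_index -[X in (_ < X)%N](prednK K0) ltnS geq_minr. Qed.

Lemma time_index_grid t k : 0 <= t <= 1 -> time_index t = k ->
  grid R K k <= t <= grid R K k.+1.
Proof.
move=> /andP[t0 t1] tk.
have Kt0 : 0 <= K%:R * t by rewrite mulr_ge0.
have Kt1 : K%:R * t <= K%:R by rewrite ler_piMr.
have /andP[h1 h2] := truncn_itv Kt0.
rewrite /grid ler_pdivrMr// ler_pdivlMr// (mulrC t).
move: tk; rewrite /time_index /minn; case: ltnP => h tk.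
  by rewrite -tk h1 ltW.
rewrite -tk prednK// Kt1 andbT (le_trans _ h1)// ler_nat.
exact: h.
Qed.

Lemma measurable_slab k : measurable (slab k).
Proof.
have m : measurable_fun [set: R] (fun t => (time_index t)%:R : R).
  apply: nondecreasing_measurable => // x y xy; rewrite ler_nat leq_min geq_minr andbT.
  by rewrite (leq_trans (geq_minl _ _))// le_truncn// ler_wpM2l.
have m2 := measurableT_comp m (measurable_fst (T1 := measurableTypeR R) (T2 := measurableTypeR R)).
have -> : slab k = ((fun t => (time_index t)%:R : R) \o fst) @^-1` [set k%:R].
  apply/seteqP; split => z /=; rewrite /slab/=; first by move=> ->.
  by move=> /eqP; rewrite eqr_nat => /eqP.
rewrite -[X in measurable X]setTI.
by apply: m2 => //; exact: measurable_set1.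
Qed.

Lemma lam_rectangle (u v p q : R) : u <= v -> p <= q ->
  lam (`[u, v] `*` `[p, q]) = ((v - u) * (q - p))%:E.
Proof.
move=> uv pq; rewrite product_measure1E//; try exact: measurable_itv.
have e (a b : R) : a <= b -> lebesgue_measure (`[a, b]%classic : set R) = (b - a)%:E.
  move=> ab; rewrite lebesgue_measure_itv/= lte_fin; case: ltP => // ba.
  have -> : a = b by apply/eqP; rewrite eq_le ab ba.
  by rewrite subrr.
by rewrite EFinM; congr (_ * _)%E; exact: e.
Qed.

Section cells.
Variables (I : finType) (C : I -> set (R * R)) (n : nat).
Hypotheses (mC : forall i, measurable (C i)) (tC : trivIset setT C)
  (fC : forall i, (lam (C i) < +oo)%E).

Definition cell (k : nat) (i : I) : set (R * R) := C i `&` slab k.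

Lemma measurable_cell k i : measurable (cell k i).
Proof. by apply: measurableI => //; exact: measurable_slab. Qed.

Lemma trivIset_cell k : trivIset setT (cell k).
Proof.
apply/trivIsetP => i j _ _ ij; rewrite /cell setIACA.
by move/trivIsetP: tC => /(_ i j Logic.I Logic.I ij) ->; rewrite set0I.
Qed.

Lemma lam_cell k i : (lam (cell k i) < +oo)%E.
Proof.
apply: le_lt_trans (fC i); apply: le_measure; rewrite ?inE.
- exact: measurable_cell.
- exact: mC.
- exact: subIsetl.
Qed.

Definition rate (X : R -> R) (k : nat) (i : I) : R :=
  fine (intensity n X (cell k i)).

Lemma rate_ge0 X k i : 0 <= rate X k i.
Proof. by apply: fine_ge0; exact: intensity_ge0. Qed.

Let gridD k : grid R K k.+1 - grid R K k = K%:R^-1.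
Proof. by rewrite /grid -mulrBl -natrB// subSnn mul1r. Qed.

Let grid_le k : grid R K k <= grid R K k.+1.
Proof. by rewrite -subr_ge0 gridD invr_ge0. Qed.

Lemma rate_diff_le (X X' : R -> R) k (p q : R) : p <= q ->
  measurable (above X) -> measurable (above X') ->
  (forall t y, 0 <= t <= 1 -> time_index t = k -> (X t <= y) != (X' t <= y) ->
    p <= y <= q) ->
  \sum_i `|rate X k i - rate X' k i| <= n%:R * ((q - p) / K%:R).
Proof.
move=> pq mX mX' XX'.
have mD : measurable (`[grid R K k, grid R K k.+1] `*` `[p, q] : set (R * R)).
  by apply: measurableX; exact: measurable_itv.
have H := (@intensity_diff_le R n I (cell k) X X' _ ((q - p) / K%:R) (measurable_cell k) (@trivIset_cell k)
  (lam_cell k) mX mX' mD).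
apply: H.
  by rewrite lam_rectangle// gridD mulrC.
move=> i [t y] [_ tk] [t01 _] /= neq; split => /=; rewrite in_itv/=.
  by move: t01; rewrite /= in_itv/= => t01; exact: time_index_grid.
by apply: (XX' t) => //; move: t01; rewrite /= in_itv.
Qed.

Lemma rate_cst_le k i (x x' : R) : x <= x' ->
  rate (fun=> x') k i <= rate (fun=> x) k i.
Proof.
move=> xx; rewrite /rate.
have mc := measurable_cell k i.
have mx := measurable_above_cst x; have mx' := measurable_above_cst x'.
rewrite (intensityE _ mc mx) (intensityE _ mc mx').
have fin y : measurable (above (fun=> y)) -> lam (cell k i `&` above (fun=> y)) \is a fin_num.
  move=> my; rewrite ge0_fin_numE//; apply: le_lt_trans (lam_cell k i).
  have m := measurableI _ _ mc my.
  by apply: le_measure; rewrite ?inE; [exact: m|exact: mc|exact: subIsetl].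
rewrite !fineM ?fin//; apply: ler_wpM2l => //.
apply: fine_le; [exact: fin|exact: fin|].
have m1 := measurableI _ _ mc mx'; have m2 := measurableI _ _ mc mx.
apply: le_measure; rewrite ?inE; [exact: m1|exact: m2|].
by move=> z [Cz [Sz /= H]]; split => //; split => //=; exact: le_trans H.
Qed.

Variable B : nat.

Definition leaf_law (k : nat) (x : R) (f : {ffun I -> 'I_B.+1}) : R :=
  capped_poisson_law (rate (fun=> x) k) f.

Lemma leaf_law_ge0 k x f : 0 <= leaf_law k x f.
Proof. by apply: capped_poisson_law_ge0 => i; exact: rate_ge0. Qed.

Lemma sum_leaf_law k x : \sum_f leaf_law k x f = 1.
Proof. exact: sum_capped_poisson_law. Qed.

(** Between the levels [x] and [x'] the slab contains a rectangle of width [1 / K] and height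
    [x' - x]; [n] times its area bounds the total loss of intensity over the cells. *)
Lemma leaf_law_dominated k x x' f : x <= x' ->
  leaf_law k x' f <= expR (n%:R / K%:R * (x' - x)) * leaf_law k x f.
Proof.
move=> xx.
have h : leaf_law k x' f <= expR (\sum_i (rate (fun=> x) k i - rate (fun=> x') k i)) *
    leaf_law k x f.
  apply: capped_poisson_law_dominated => i.
  by apply/andP; split; [exact: rate_ge0|exact: rate_cst_le].
apply: le_trans h _; apply: (ler_wpM2r (leaf_law_ge0 k x f)).
rewrite ler_expR.
apply: (@le_trans _ _ (\sum_i `|rate (fun=> x) k i - rate (fun=> x') k i|)).
  by apply: ler_sum => i _; exact: ler_norm.
have -> : n%:R / K%:R * (x' - x) = n%:R * ((x' - x) / K%:R) by ring.
apply: rate_diff_le => //; [exact: measurable_above_cst|exact: measurable_above_cst|].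
move=> t y _ _; case: (leP x y) => xy; case: (leP x' y) => xy' //= _.
  by rewrite ltW.
by have := le_lt_trans xy' (lt_le_trans xy xx); rewrite ltxx.
Qed.

(** In each slab, path and frozen path differ in a rectangle of area [2 * om / K]. The [K] slabs
    compensate the [1 / K], so the bound depends on the oscillation alone. *)
Lemma path_rate_diff (X : R -> R) (om : R) : 0 <= om ->
  {within `[0, 1], continuous X} ->
  (forall t, 0 <= t <= 1 -> `|X t - X (grid R K (time_index t))| <= om) ->
  \sum_(k < K) \sum_i `|rate X k i - rate (fun=> X (grid R K k)) k i| <=
  2 * n%:R * om.
Proof.
move=> om0 cX Xom.
apply: (@le_trans _ _ (\sum_(k < K) (n%:R * (2 * om / K%:R)))).
  apply: ler_sum => k _; set x := X (grid R K k).
  have -> : 2 * om = (x + om) - (x - om) by ring.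
  apply: rate_diff_le; [lra|exact: measurable_above|exact: measurable_above_cst|].
  move=> t y t01 tk; have := Xom t t01; rewrite tk -/x ler_norml => /andP[h1 h2].
  by case: (leP (X t) y) => h; case: (leP x y) => h' //= _; apply/andP; split; lra.
rewrite sumr_const card_ord -mulr_natl le_eqVlt; apply/orP; left; apply/eqP.
by field; rewrite gt_eqF.
Qed.

End cells.
End slabs.

(** * Events determined by finitely many counts *)

(** Heine-Cantor by compactness: halving both the radius and the precision lets one neighbourhood
    serve all pairs of points close to its centre. *)
Lemma dyadic_uniform_continuity (R : realType) (X : R -> R) (e : R) : 0 < e ->
  {within `[0, 1], continuous X} ->
  \forall L \near \oo, forall x y, 0 <= x <= 1 -> 0 <= y <= 1 ->
    `|x - y| <= (2 ^+ L)^-1 -> `|X x - X y| <= e.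
Proof.
move=> e0 cX.
have /compact_near_coveringP cov := @segment_compact R 0 1.
pose Pr (L : nat) (x : R) := 0 <= x <= 1 -> forall y, 0 <= y <= 1 ->
  `|x - y| <= (2 ^+ L)^-1 -> `|X x - X y| <= e.
have : \forall L \near \oo, `[0, 1]%classic `<=` Pr L.
  apply: (cov nat \oo Pr) => x x01.
  have cx : X x' @[x' --> within `[0, 1] (nbhs x)] --> X x.
    by move/subspace_continuousP : cX; apply.
  have e2 : 0 < e / 2 by rewrite divr_gt0.
  have /cvgrPdist_le /(_ _ e2) := cx; rewrite near_withinE => /nbhs_ballP[r /= r0 rP].
  have r2 : 0 < r / 2 by rewrite divr_gt0.
  exists (ball x (r / 2), [set L | (2 ^+ L)^-1 < r / 2]) => /=.
    split; first exact: nbhsx_ballx.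
    have := near_infty_natSinv_lt (PosNum r2); apply: filterS => L /=; apply: le_lt_trans.
    by rewrite lef_pV2 ?posrE ?exprn_gt0// -natrX ler_nat ltn_expl.
  move=> [x' L] /= [xx' Lr] x'01 y y01 x'y.
  have xr : ball x r x' by apply: le_ball xx'; rewrite ler_pdivrMr//; lra.
  have yr : ball x r y.
    by rewrite (splitr r); apply: ball_triangle xx' _; exact: le_lt_trans x'y Lr.
  have inI (z : R) : 0 <= z <= 1 -> z \in `[0, 1]%R by move=> z01; rewrite in_itv.
  have h1 := rP _ xr (inI x' x'01); have h2 := rP _ yr (inI y y01).
  rewrite /= in h1 h2; rewrite (splitr e); apply: le_trans (lerD h1 h2).
  by rewrite (distrC (X x)) ler_distD.
apply: filterS => L H x y x01; apply: H => //.
Qed.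

Section leaf_ext.
Variable F : finType.
Lemma leaf_inj j (f g : tree F j) :
  (forall k, (k < 2 ^ j)%N -> leaf f k = leaf g k) -> f = g.
Proof.
elim: j f g => [|j IH] f g fg; first exact: (fg 0%N).
case: f fg => f1 f2; case: g => g1 g2 /= fg; congr pair; apply: IH => k kj.
  by have := fg k; rewrite kj expnS mul2n -addnn ltn_addr//; apply.
have := fg (2 ^ j + k)%N; rewrite expnS mul2n -addnn ltn_add2l kj => /(_ isT).
by rewrite ltnNge leq_addr/= addKn.
Qed.
End leaf_ext.

Section poisson_fin.
Context (R : realType).

Lemma poisson_process_law_fin (L : set (R * R) -> \bar R)
    (Q : set (observation R) -> \bar R) (J : finType) (A : J -> set (R * R))
    (m : J -> nat) :
  poisson_process_law L Q -> (forall j, measurable (A j)) ->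
  (forall j, bounded_set (A j)) -> trivIset setT A ->
  Q [set N | forall j, (N : configuration R) (A j) = (m j)%:R%:E] =
  (\prod_j poisson_mass (fine (L (A j))) (m j))%:E.
Proof.
move=> LQ mA bA tA.
pose A' (i : nat) := if insub i is Some o then A (enum_val (o : 'I_#|J|)) else set0.
pose m' (i : nat) := if insub i is Some o then m (enum_val (o : 'I_#|J|)) else 0%N.
have A'E (o : 'I_#|J|) : A' o = A (enum_val o) by rewrite /A' valK.
have m'E (o : 'I_#|J|) : m' o = m (enum_val o) by rewrite /m' valK.
have mA' i : (i < #|J|)%N -> measurable (A' i).
  by move=> iJ; have := A'E (Ordinal iJ) => /= ->; exact: mA.
have bA' i : (i < #|J|)%N -> bounded_set (A' i).
  by move=> iJ; have := A'E (Ordinal iJ) => /= ->; exact: bA.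
have tA' : trivIset `I_#|J| A'.
  apply/trivIsetP => i j /= iJ jJ ij.
  have := A'E (Ordinal iJ) => /= ->; have := A'E (Ordinal jJ) => /= ->.
  move/trivIsetP: tA; apply => //; apply: contraNN ij => /eqP/enum_val_inj/(congr1 val)/=.
  by move=> ->.
have := LQ #|J| A' m' mA' bA' tA'.
rewrite (_ : [set N | forall j, (N : configuration R) (A j) = (m j)%:R%:E] =
  [set N | forall i, (i < #|J|)%N -> (N : configuration R) (A' i) = (m' i)%:R%:E]).
  move=> ->; congr (_%:E).
  rewrite [RHS](reindex (@enum_val J predT))/=; last by apply: onW_bij; exact: enum_val_bij.
  by apply: eq_bigr => o _; rewrite A'E m'E.
apply/seteqP; split => N /= H.
  by move=> i iJ; have := A'E (Ordinal iJ); have := m'E (Ordinal iJ) => /= -> ->.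
move=> j; have := H (enum_rank j) (ltn_ord _).
by rewrite A'E m'E enum_rankK.
Qed.

End poisson_fin.

(** * Approximation of events in both laws at once *)

Section approximation.
Context (R : realType).
Local Notation conf := (configuration R).
Local Notation obs := (observation R).

(** The sets are bounded because [poisson_process_law] prescribes the counts of bounded sets
    only. *)
Definition finitely_determined (E : set obs) : Prop :=
  exists (I : finType) (A : I -> set (R * R)),
  [/\ forall i, measurable (A i), forall i, bounded_set (A i) &
  forall N N' : conf, (forall i, N (A i) = N' (A i)) -> E N -> E N'].

Lemma finitely_determinedC E : finitely_determined E -> finitely_determined (~` E).
Proof.
move=> [I [A [mA bA AE]]]; exists I, A; split => // N N' NN EN EN'.
by apply: EN; apply: AE EN' => i; rewrite NN.
Qed.

Lemma finitely_determinedU E E' : finitely_determined E ->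
  finitely_determined E' -> finitely_determined (E `|` E').
Proof.
move=> [I [A [mA bA AE]]] [I' [A' [mA' bA' AE']]].
exists (I + I')%type, (fun s => match s with inl i => A i | inr i => A' i end).
split => [[i|i]//|[i|i]//|N N' NN [EN|EN]].
  by left; apply: AE EN => i; exact: (NN (inl i)).
by right; apply: AE' EN => i; exact: (NN (inr i)).
Qed.

Lemma finitely_determined0 : finitely_determined set0.
Proof. by exists void, (fun=> set0); split. Qed.

Lemma measurable_count (A : set (R * R)) (Y : set (\bar R)) : measurable A ->
  measurable Y -> measurable ([set N | Y ((N : conf) A)] : set obs).
Proof. by move=> mA mY; apply: sub_sigma_algebra; exists A, Y. Qed.

Variables Q0 Q1 : probability obs R.

Definition symdiff (E E' : set obs) : set obs := (E `\` E') `|` (E' `\` E).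

(** One and the same [E'] must serve [Q0] and [Q1], since the sum of the two errors of a single test
    is to be bounded. *)
Definition approximable (E : set obs) : Prop := measurable E /\
  forall e : R, 0 < e -> exists E', [/\ measurable E', finitely_determined E',
    (Q0 (symdiff E E') <= e%:E)%E & (Q1 (symdiff E E') <= e%:E)%E].

Let msd E E' : measurable E -> measurable E' -> measurable (symdiff E E').
Proof. by move=> mE mE'; apply: measurableU; exact: measurableD. Qed.

Lemma finitely_determined_approximable E : measurable E ->
  finitely_determined E -> approximable E.
Proof.
move=> mE dE; split => // e e0; exists E; split => //.
  by rewrite /symdiff !setDv setU0 measure0 lee_fin ltW.
by rewrite /symdiff !setDv setU0 measure0 lee_fin ltW.
Qed.

Lemma approximable0 : approximable set0.
Proof.
apply: finitely_determined_approximable => //; exact: finitely_determined0.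
Qed.

Lemma approximableC E : approximable E -> approximable (~` E).
Proof.
move=> [mE aE]; split; first exact: measurableC.
move=> e e0; have [E' [mE' dE' h0 h1]] := aE e e0.
have sdC : symdiff (~` E) (~` E') = symdiff E E'.
  by rewrite /symdiff !setDE !setCK setUC [E' `&` _]setIC [E `&` _]setIC.
exists (~` E'); rewrite sdC; split => //; first exact: measurableC.
exact: finitely_determinedC.
Qed.

Let le_sub (Q : probability obs R) (A B C : set obs) (a b : R) :
  measurable A -> measurable B -> measurable C -> A `<=` B `|` C ->
  (Q B <= a%:E)%E -> (Q C <= b%:E)%E -> (Q A <= (a + b)%:E)%E.
Proof.
move=> mA mB mC ABC Ba Cb; apply: (@le_trans _ _ (Q (B `|` C))).
  by apply: le_measure; rewrite ?inE//; exact: measurableU.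
apply: le_trans (measureU2 _ mB mC) _; rewrite EFinD; exact: leeD.
Qed.

Lemma approximableU E F : approximable E -> approximable F -> approximable (E `|` F).
Proof.
move=> [mE aE] [mF aF]; split; first exact: measurableU.
move=> e e0; have e2 : 0 < e / 2 by rewrite divr_gt0.
have [E' [mE' dE' hE0 hE1]] := aE _ e2; have [F' [mF' dF' hF0 hF1]] := aF _ e2.
have sub : symdiff (E `|` F) (E' `|` F') `<=` symdiff E E' `|` symdiff F F'.
  move=> N [[[EN|FN] nN]|[[EN|FN] nN]].
  - by left; left; split => // E'N; apply: nN; left.
  - by right; left; split => // E'N; apply: nN; right.
  - by left; right; split => // E'N; apply: nN; left.
  - by right; right; split => // E'N; apply: nN; right.
have m1 := msd (measurableU _ _ mE mF) (measurableU _ _ mE' mF').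
have m2 := msd mE mE'; have m3 := msd mF mF'.
exists (E' `|` F'); split.
- exact: measurableU.
- exact: finitely_determinedU.
- by rewrite (splitr e); exact: (le_sub m1 m2 m3 sub).
- by rewrite (splitr e); exact: (le_sub m1 m2 m3 sub).
Qed.

Let cvg_residual (Q : probability obs R) (E : nat -> set obs) (e : R) : 0 < e ->
  (forall n, measurable (E n)) ->
  \forall n \near \oo, (Q ((\bigcup_k E k) `\` (\bigcup_(k in `I_n) E k)) <= e%:E)%E.
Proof.
move=> e0 mE; pose U := \bigcup_k E k.
pose D n := U `\` \bigcup_(k in `I_n) E k.
have mU : measurable U by exact: bigcup_measurable.
have mD n : measurable (D n).
  by apply: measurableD => //; apply: bigcup_measurable.
have D0 : \bigcap_n D n = set0.
  apply/seteqP; split => // N H; have [[k _ EkN] _] := H 0%N I.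
  by have [_ nE] := H k.+1 I; apply: nE; exists k => //=.
have cD : Q (D n) @[n --> \oo] --> (0 : \bar R)%E.
  rewrite -(measure0 Q) -D0; apply: nonincreasing_cvg_mu => //.
  - by rewrite (le_lt_trans (probability_le1 _ (mD 0%N)))// ltry.
  - by rewrite D0.
  - move=> m n mn; apply/subsetPset => N [UN nN]; split => // -[k /= km EkN].
    by apply: nN; exists k => //=; exact: leq_trans mn.
have : \forall n \near \oo, (Q (D n) < e%:E)%E.
  by apply: (cD [set y | (y < e%:E)%E]); apply: open_ereal_lt'; rewrite lte_fin.
by apply: filterS => n /ltW.
Qed.

(** Half of [e] pays for truncating the union, by continuity from above, and half for approximating
    the finite union that remains. *)
Lemma approximable_bigcup (E : nat -> set obs) : (forall n, approximable (E n)) ->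
  approximable (\bigcup_n E n).
Proof.
move=> aE; have mE n : measurable (E n) by case: (aE n).
pose F n := \bigcup_(k in `I_n) E k.
have aF n : approximable (F n).
  elim: n => [|n IH]; first by rewrite /F II0 bigcup_set0; exact: approximable0.
  rewrite /F IIS bigcup_setU bigcup_set1; exact: approximableU.
have mU : measurable (\bigcup_n E n) by exact: bigcup_measurable.
split => // e e0; have e2 : 0 < e / 2 by rewrite divr_gt0.
have [n _ nP] : \forall n \near \oo, (Q0 ((\bigcup_k E k) `\` F n) <= (e / 2)%:E)%E /\
    (Q1 ((\bigcup_k E k) `\` F n) <= (e / 2)%:E)%E.
  near=> n; split; near: n; exact: cvg_residual.
have [h0 h1] := nP n (leqnn n).
have [mF aFn] := aF n; have [E' [mE' dE' k0 k1]] := aFn _ e2.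
have m1 := msd mU mE'; have m2 := measurableD mU mF; have m3 := msd mF mE'.
have sub : symdiff (\bigcup_n E n) E' `<=`
    ((\bigcup_k E k) `\` F n) `|` symdiff (F n) E'.
  move=> N [[UN nN]|[EN nN]].
    have [FN|FN] := pselect (F n N); last by left.
    by right; left.
  by right; right; split => // -[k _ EkN]; apply: nN; exists k.
exists E'; split => //; rewrite (splitr e).
- exact: (le_sub m1 m2 m3 sub).
- exact: (le_sub m1 m2 m3 sub).
Unshelve. all: by end_near.
Qed.

Lemma sigma_algebra_approximable : sigma_algebra setT approximable.
Proof.
split; [exact: approximable0| |exact: approximable_bigcup].
by move=> E aE; rewrite setTD; exact: approximableC.
Qed.

End approximation.

Section generation.
Context (R : realType).
Local Notation conf := (configuration R).
Local Notation obs := (observation R).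
Variables Q0 Q1 : probability obs R.
Local Notation approximable := (approximable Q0 Q1).

Let box (r : nat) : set (R * R) := `[- r%:R, r%:R] `*` `[- r%:R, r%:R].

Let measurable_box r : measurable (box r).
Proof. by apply: measurableX; exact: measurable_itv. Qed.

Let bounded_box (A : set (R * R)) r : bounded_set (A `&` box r).
Proof.
exists r%:R; split => [|x rx z [_ [/= z1 z2]]]; first exact: num_real.
rewrite prod_normE ge_max; move: z1 z2; rewrite !in_itv/= -!ler_norml => z1 z2.
by rewrite !(le_trans _ (ltW rx)).
Qed.

Let subset_box m n : (m <= n)%N -> box m `<=` box n.
Proof.
move=> mn z [/=]; rewrite !in_itv/= -!ler_norml => z1 z2.
have mn' : (m%:R <= n%:R :> R) by rewrite ler_nat.
by split; rewrite /= in_itv/= -ler_norml (le_trans _ mn').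
Qed.

Let bigcup_box : \bigcup_r box r = setT.
Proof.
apply/seteqP; split => // z _; exists (Num.truncn (`|z.1| + `|z.2|)).+1 => //.
have h := truncnS_gt (`|z.1| + `|z.2|).
have z1 := normr_ge0 z.1; have z2 := normr_ge0 z.2.
by split; rewrite /= in_itv/= -ler_norml (le_trans _ (ltW h))// ?lerDl ?lerDr.
Qed.

Variable A : set (R * R).
Hypothesis mA : measurable A.

Let Ar r := A `&` box r.
Let mAr r : measurable (Ar r). Proof. exact: measurableI. Qed.

Let cvg_count (N : conf) : N (Ar r) @[r --> \oo] --> N A.
Proof.
have AE : A = \bigcup_r Ar r by rewrite -setI_bigcupr bigcup_box setIT.
rewrite [X in _ --> N X]AE; apply: nondecreasing_cvg_mu => //.
  by rewrite -AE.
by move=> m n mn; apply/subsetPset => z [Az Bz]; split => //; exact: subset_box Bz.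
Qed.

Let G (k : nat) : set obs := [set N | (k%:R%:E <= (N : conf) A)%E].

Let count_le (N : conf) k : (forall r, (N (Ar r) < k.+1%:R%:E)%E) ->
  (N A <= k%:R%:E)%E.
Proof.
move=> H; apply: (cvge_to_le (cvg_count (N := N))); apply: nearW => r.
have [m mE] := count_nat N (mAr r) (@bounded_box A r).
by have := H r; rewrite mE lte_fin lee_fin ltr_nat ler_nat ltnS.
Qed.

(** Counts of bounded sets are integers: if none of them reaches [k + 1] they are all at most [k],
    and so is their limit. A threshold reached on [A] is thus already reached on a bounded piece. *)
Let GE k : G k = \bigcup_r [set N : obs | (k%:R%:E <= (N : conf) (Ar r))%E].
Proof.
apply/seteqP; split => N; last first.
  move=> [r _ /= H]; apply: le_trans H _; apply: le_measure; rewrite ?inE//.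
  exact: subIsetl.
case: k => [_|k /= H]; first by exists 0%N => //=; rewrite measure_ge0.
apply: contrapT => H'; have : (N A <= k%:R%:E)%E.
  apply: (@count_le N) => r; rewrite ltNge; apply/negP => H2.
  by apply: H'; exists r.
by move=> /(le_trans H); rewrite lee_fin ler_nat ltnn.
Qed.

Let approximable_G k : approximable (G k).
Proof.
rewrite GE; apply: approximable_bigcup => r; apply: finitely_determined_approximable.
  apply: (measurable_count (Y := [set y | (k%:R%:E <= y)%E])) => //.
  rewrite (_ : [set y | _] = `[k%:R%:E, +oo[%classic); first exact: emeasurable_itv.
  by apply/seteqP; split => y /=; rewrite in_itv/= andbT.
exists unit, (fun=> Ar r); split => [_|_|N N' NN /=].
- exact: mAr.
- exact: bounded_box.
- by rewrite (NN tt).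
Qed.

Let approximableI E F : approximable E -> approximable F -> approximable (E `&` F).
Proof.
move=> aE aF; rewrite -[E `&` F]setCK setCI; apply: approximableC.
by apply: approximableU; exact: approximableC.
Qed.

Let count_eq (N : conf) k : (k%:R%:E <= N A)%E -> ~ (k.+1%:R%:E <= N A)%E ->
  N A = k%:R%:E.
Proof.
move=> h1 h2; apply/eqP; rewrite eq_le h1 andbT; apply: count_le => r.
rewrite ltNge; apply/negP => h; apply: h2; apply: le_trans h _.
by apply: le_measure; rewrite ?inE//; exact: subIsetl.
Qed.

(** [N A] is a natural number or [+oo], so the event is a countable combination of the threshold
    events [G k]. *)
Lemma approximable_count (Y : set (\bar R)) :
  approximable [set N | Y ((N : conf) A)].
Proof.
pose U1 k : set obs := if asbool (Y k%:R%:E) then G k `&` ~` G k.+1 else set0.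
pose U2 : set obs := if asbool (Y +oo%E) then \bigcap_k G k else set0.
rewrite (_ : [set N | _] = (\bigcup_k U1 k) `|` U2).
  apply: approximableU.
    apply: approximable_bigcup => k; rewrite /U1; case: ifP => _.
      by apply: approximableI => //; exact: approximableC.
    exact: approximable0.
  rewrite /U2; case: ifP => _; last exact: approximable0.
  rewrite -[\bigcap_k _]setCK setC_bigcap; apply: approximableC.
  by apply: approximable_bigcup => k; exact: approximableC.
apply/seteqP; split => N /=; last first.
  move=> [[k _]|].
    rewrite /U1; case: ifPn => // /asboolP Yk [h1 h2].
    by rewrite (count_eq h1 h2).
  rewrite /U2; case: ifPn => // /asboolP Yoo H.
  suff -> : (N : conf) A = +oo%E by [].
  apply/eqyP => x _; have h := ltW (truncnS_gt x).
  by apply: le_trans (H (Num.truncn x).+1 Logic.I); rewrite lee_fin.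
move=> YN; have [H|/existsNP[k0 nk0]] := pselect (forall k, G k N).
  right; have NA : (N : conf) A = +oo%E.
    apply/eqyP => x _; have h := ltW (truncnS_gt x).
    by apply: le_trans (H (Num.truncn x).+1); rewrite lee_fin.
  by rewrite /U2 -NA asboolT.
left; have [k [Gk nGk]] : exists k, G k N /\ ~ G k.+1 N.
  apply: contrapT => H; apply: nk0; elim: k0 => [|k IH].
    by rewrite /G/= measure_ge0.
  by apply: contrapT => nGk; apply: H; exists k.
exists k => //; rewrite /U1 asboolT; first by split.
by rewrite -(count_eq Gk nGk).
Qed.

End generation.

Lemma approximable_measurable (R : realType) (Q0 Q1 : probability (observation R) R)
  (E : set (observation R)) : measurable E -> approximable Q0 Q1 E.
Proof.
move=> mE.
have sub : @count_events R `<=` approximable Q0 Q1.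
  by move=> F [A [Y [mA _ ->]]]; exact: approximable_count.
exact: (smallest_sub (sigma_algebra_approximable Q0 Q1) sub mE).
Qed.

(** * Finite experiments and their limit *)

Lemma bounded_setS (R : realType) (A B : set (R * R)) :
  A `<=` B -> bounded_set B -> bounded_set A.
Proof.
by move=> AB [M [Mr H]]; exists M; split => // x Mx z /AB Bz; exact: H Mx _ Bz.
Qed.

Lemma measure_disjoint_sum d (T : measurableType d) (R : realType)
    (Q : {measure set T -> \bar R}) (I : finType) (U : pred I) (E : I -> set T) :
  (forall i, measurable (E i)) -> (forall i j x, E i x -> E j x -> i = j) ->
  (\sum_(i | U i) Q (E i) = Q [set x | exists2 i, U i & E i x])%E.
Proof.
move=> mE dE; rewrite -big_enum/= fsbig_seq ?enum_uniq// -measure_fin_bigcup//.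
- congr (Q _); apply/seteqP; split => x [i].
    by rewrite /= mem_enum => Ui Ex; exists i.
  by move=> Ui Ex; exists i => //=; rewrite mem_enum.
- by move=> i j _ _ [x [Ex Ey]]; exact: dE Ex Ey.
Qed.

Section outcomes.
Context (R : realType).
Local Notation conf := (configuration R).
Local Notation obs := (observation R).
Variables (J : finType) (C : J -> set (R * R)).
Hypotheses (mC : forall j, measurable (C j)) (bC : forall j, bounded_set (C j))
  (tC : trivIset setT C).
Variables (L B : nat).
Local Notation F := {ffun J -> 'I_B.+1}.
Local Notation ccell := (cell (2 ^ L) C).

Definition outcome (f : tree F L) : set obs :=
  [set N | forall p : 'I_(2 ^ L) * J,
    (N : conf) (ccell p.1 p.2) = (leaf f p.1 p.2)%:R%:E].

(** In the capped law the value [B] means at least [B], whereas [outcome] asks for exactly [B]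
    points. The two agree only when no cell reaches the cap. *)
Definition unsaturated (f : tree F L) : bool :=
  [forall p : 'I_(2 ^ L) * J, (leaf f p.1 p.2 < B)%N].

Let bcell k j : bounded_set (ccell k j).
Proof.
have [M [Mr H]] := bC j; exists M; split => // x Mx z [Cz _]; exact: H Mx _ Cz. Qed.

Let mcell k j : measurable (ccell k j). Proof. exact: measurable_cell. Qed.

Lemma measurable_outcome f : measurable (outcome f).
Proof.
have -> : outcome f = \bigcap_(p in [set: 'I_(2 ^ L) * J])
    [set N | (N : conf) (ccell p.1 p.2) = (leaf f p.1 p.2)%:R%:E].
  by apply/seteqP; split => N H p; [move=> _; exact: H|exact: (H p Logic.I)].
apply: fin_bigcap_measurable; first exact: finite_finset.
move=> p _; apply: (measurable_count (Y := [set (leaf f p.1 p.2)%:R%:E])) => //.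
Qed.

Lemma outcome_inj f g N : outcome f N -> outcome g N -> f = g.
Proof.
move=> fN gN; apply: leaf_inj => k kL; apply/ffunP => j; apply/val_inj => /=.
have := fN (Ordinal kL, j); rewrite (gN (Ordinal kL, j)) => -[] /eqP.
by rewrite eqr_nat eq_sym => /eqP.
Qed.

Lemma sum_outcome (Q : {measure set obs -> \bar R}) (U : pred (tree F L)) :
  (\sum_(f | U f) Q (outcome f) = Q [set N | exists2 f, U f & outcome f N])%E.
Proof.
by apply: measure_disjoint_sum; [exact: measurable_outcome|exact: outcome_inj].
Qed.

Lemma measurable_outcomes (U : pred (tree F L)) :
  measurable ([set N | exists2 f, U f & outcome f N] : set obs).
Proof.
rewrite (_ : [set N | _] = \bigcup_(f in [set` U]) outcome f).
  apply: fin_bigcup_measurable; first exact: finite_finset.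
  by move=> f _; exact: measurable_outcome.
by apply/seteqP; split => N [f Uf fN]; exists f.
Qed.

(** Total mass 1 is a hypothesis here so as to cover both the law of the observations and the
    conditional laws [K w]. *)
Lemma mass1_le1 (Q : {measure set obs -> \bar R}) (E : set obs) :
  Q setT = 1%E -> measurable E -> (Q E <= 1)%E.
Proof. by move=> <- mE; apply: le_measure; rewrite ?inE. Qed.

Lemma mass1_fin_num (Q : {measure set obs -> \bar R}) (E : set obs) :
  Q setT = 1%E -> measurable E -> Q E \is a fin_num.
Proof.
by move=> Q1 mE; rewrite ge0_fin_numE// (le_lt_trans (mass1_le1 Q1 mE))// ltry.
Qed.

Lemma sum_outcome_le1 (Q : {measure set obs -> \bar R}) (U : pred (tree F L)) :
  Q setT = 1%E -> \sum_(f | U f) fine (Q (outcome f)) <= 1.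
Proof.
move=> Q1; rewrite -lee_fin -sumEFin.
under eq_bigr do rewrite (fineK (mass1_fin_num Q1 (measurable_outcome _))).
by rewrite sum_outcome; apply: mass1_le1 => //; exact: measurable_outcomes.
Qed.

Lemma poisson_outcome (n : nat) (X : R -> R) (Q : set obs -> \bar R) f :
  poisson_process_law (intensity n X) Q -> unsaturated f ->
  Q (outcome f) = (tree_poisson (rate (2 ^ L) C n X) f)%:E.
Proof.
move=> XQ /forallP uf.
rewrite (poisson_process_law_fin (A := fun p : 'I_(2 ^ L) * J => ccell p.1 p.2)
  (fun p => leaf f p.1 p.2) XQ).
- congr (_%:E); rewrite /tree_poisson /tree_law /capped_poisson_law pair_bigA/=.
  apply: eq_bigr => p _; rewrite mul0n add0n /capped_poisson.
  by rewrite (uf p).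
- by move=> p; exact: mcell.
- by move=> p; exact: bcell.
- apply/trivIsetP => -[k j] [k' j'] _ _ neq; apply/seteqP; split => // z [/= [Cz kz] [C'z k'z]].
  move: neq; rewrite xpair_eqE negb_and; case: eqVneq => /= [_|+ _].
    by move/trivIsetP : tC => /(_ j j' Logic.I Logic.I) /[apply] /seteqP[/(_ z) + _]; apply.
  by case/eqP; apply: val_inj; rewrite /= -kz.
Qed.

Lemma fine_poisson_outcome (n : nat) (X : R -> R) (Q : set obs -> \bar R) f :
  poisson_process_law (intensity n X) Q -> unsaturated f ->
  fine (Q (outcome f)) = tree_poisson (rate (2 ^ L) C n X) f.
Proof. by move=> XQ uf; rewrite (poisson_outcome XQ uf). Qed.

End outcomes.

(** Standard deviation of the increment of [sig * W] over [2 ^ k] of the [2 ^ L] cells of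
    [[0, 1]]. *)
Definition dyadic_sd (R : realType) (sig : R) (L k : nat) : R :=
  sig * Num.sqrt 2 ^+ k / Num.sqrt 2 ^+ L.

Section dyadic_sd.
Context (R : realType) (sig : R).

Lemma dyadic_sd_gt0 L k : 0 < sig -> 0 < dyadic_sd sig L k.
Proof. by move=> s0; rewrite divr_gt0// ?mulr_gt0// exprn_gt0. Qed.

Lemma dyadic_sdS L k : dyadic_sd sig L k.+1 = Num.sqrt 2 * dyadic_sd sig L k.
Proof. by rewrite /dyadic_sd exprS; ring. Qed.

Lemma dyadic_sd_top L : dyadic_sd sig L L = sig.
Proof. by rewrite /dyadic_sd mulfK// expf_neq0// gt_eqF. Qed.

Lemma dyadic_sd_step L : dyadic_sd sig L 0 = step_sd (2 ^ L) sig.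
Proof.
rewrite /dyadic_sd /step_sd expr0 mulr1; congr (_ * _).
have h : 0 < (Num.sqrt 2 : R) ^+ L by rewrite exprn_gt0.
rewrite -[LHS]ger0_norm ?invr_ge0 ?(ltW h)// -sqrtr_sqr; congr Num.sqrt.
by rewrite exprVn natrX -exprM mulnC exprM sqr_sqrtr.
Qed.

End dyadic_sd.

Section outcome_law.
Context (R : realType).
Local Notation obs := (observation R).
Variables (J : finType) (C : J -> set (R * R)).
Hypotheses (mC : forall j, measurable (C j)) (bC : forall j, bounded_set (C j))
  (tC : trivIset setT C).
Variables (n : nat) (s2 : R) (Q : probability obs R).
Hypotheses (s20 : 0 < s2).
Local Notation F B := {ffun J -> 'I_B.+1}.

(** Law of the capped counts when the path is frozen on each slab: first the right end of the path,
    then the successive midpoints. *)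
Definition path_law L B : tree (F B) L -> R :=
  mixture (normal_prob 0 (Num.sqrt s2))
    (bridge_law (leaf_law (2 ^ L) C n (B := B))
       (fun k => dyadic_sd (Num.sqrt s2) L k / Num.sqrt 2) L 0 0).

Let fC j : ((lebesgue_measure \x lebesgue_measure)%E (C j) < +oo)%E.
Proof. exact: bounded_set_lam. Qed.

Let K0 L : (0 < 2 ^ L)%N. Proof. by rewrite expn_gt0. Qed.

Let c0 L : 0 <= n%:R / (2 ^ L)%:R :> R. Proof. by rewrite divr_ge0. Qed.

Let bdom L B i x x' f := @leaf_law_dominated R (2 ^ L) (K0 L) J C n mC tC fC B i x x' f.

Section one_path.
Context d (Om : measurableType d) (P : probability Om R) (W : R -> Om -> R)
  (K : R.-pker Om ~> obs).
Hypothesis bmW : brownian_motion P W.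

Definition chain_law L B (f : tree (F B) L) (w : Om) : R :=
  tree_law (fun k g => leaf_law (2 ^ L) C n k (chain W (2 ^ L) (Num.sqrt s2) k w) g) 0 f.

Lemma chain_law_ge0 L B (f : tree (F B) L) w : 0 <= chain_law f w.
Proof. by apply: tree_law_ge0 => k g; exact: leaf_law_ge0. Qed.

Lemma sum_chain_law L B w : \sum_(f : tree (F B) L) chain_law f w = 1.
Proof. by apply: sum_tree_law => k; exact: sum_leaf_law. Qed.

Lemma bounded_measurable_chain_law L B (f : tree (F B) L) :
  bounded_measurable (chain_law f).
Proof.
split; last first.
  exists 1 => w; rewrite ger0_norm ?chain_law_ge0//.
  by apply: (pmf_le1 f (fun g => chain_law_ge0 g w)); exact: sum_chain_law.
apply: measurable_prod => k _.
have mX : measurable_fun [set: Om] (chain W (2 ^ L) (Num.sqrt s2) k).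
  by apply: (measurable_chain bmW _ (K0 L)); exact: ltnW.
have mb := @measurable_leaf_law R (F B) (leaf_law (2 ^ L) C n (B := B)) _
  (@bdom L B) k (leaf f k).
rewrite mul0n add0n; exact: (measurableT_comp mb mX).
Qed.

Lemma path_lawE L B (f : tree (F B) L) : path_law f = \int[P]_w chain_law f w.
Proof.
have sig0 : 0 < Num.sqrt s2 by rewrite sqrtr_gt0.
have := tree_law_expectation bmW (K0 L) sig0 (c0 L)
  (@leaf_law_ge0 R (2 ^ L) J C n B) (@sum_leaf_law R (2 ^ L) J C n B) (@bdom L B)
  (fun k => dyadic_sd_gt0 L k sig0) (dyadic_sdS _ L) (dyadic_sd_step _ L) f erefl.
by rewrite dyadic_sd_top /Rintegral => ->.
Qed.

Lemma bounded_measurable_outcome L B (f : tree (F B) L) :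
  bounded_measurable (fun w => fine (K w (outcome C f))).
Proof.
have mf := measurable_outcome mC f.
split; last first.
  exists 1 => w; rewrite ger0_norm ?fine_ge0//.
  by rewrite -lee_fin (fineK (mass1_fin_num (prob_kernel w) mf)) mass1_le1// prob_kernel.
by apply: measurableT_comp (measurable_kernel K _ mf).
Qed.

Definition path_error L B (w : Om) : R :=
  \sum_(f : tree (F B) L | unsaturated f)
     `|fine (K w (outcome C f)) - chain_law f w|.

Lemma path_error_ge0 L B w : 0 <= path_error L B w.
Proof. exact: sumr_ge0. Qed.

Lemma path_error_le2 L B w : path_error L B w <= 2.
Proof.
apply: (@le_trans _ _ (\sum_(f : tree (F B) L | unsaturated f)
    (fine (K w (outcome C f)) + chain_law f w))).
  apply: ler_sum => f _; apply: le_trans (ler_normB _ _) _.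
  by rewrite !ger0_norm// ?chain_law_ge0// fine_ge0.
rewrite big_split/= (_ : 2 = 1 + 1)//; apply: lerD.
  by apply: (sum_outcome_le1 mC); exact: prob_kernel.
rewrite -(sum_chain_law L B w) [leRHS](bigID (@unsaturated J L B))/= lerDl.
by apply: sumr_ge0 => f _; exact: chain_law_ge0.
Qed.

Lemma measurable_path_error L B : measurable_fun [set: Om] (path_error L B).
Proof.
rewrite /path_error; under eq_fun do rewrite big_mkcond.
apply: measurable_sum => f /=; case: (unsaturated f) => //.
have [m1 _] := bounded_measurable_outcome f.
have [m2 _] := bounded_measurable_chain_law f.
by apply: measurableT_comp => //; exact: measurable_funB.
Qed.

(** The cap may depend on [L]: the total variation bound involves only the rates. *)
Lemma path_error_cvg (B : nat -> nat) w :
  {within `[0, 1], continuous (W ^~ w)} ->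
  poisson_process_law (intensity n (fun t => Num.sqrt s2 * W t w)) (K w) ->
  path_error L (B L) w @[L --> \oo] --> (0 : R).
Proof.
move=> cW pK; pose X t := Num.sqrt s2 * W t w.
have cX : {within `[0, 1], continuous X}.
  by move=> t; apply: cvgM; [exact: cvg_cst|exact: cW].
(* The final bound is [4 * n * om]; [n.+1] keeps the quotient meaningful for [n = 0]. *)
apply/cvgrPdist_le => e e0; pose om := e / (4 * n.+1%:R).
have om0 : 0 < om by rewrite divr_gt0// mulr_gt0.
have := dyadic_uniform_continuity om0 cX; apply: filterS => L H.
rewrite sub0r normrN ger0_norm ?path_error_ge0//.
have D : forall t, 0 <= t <= 1 ->
    `|X t - X (grid R (2 ^ L) (time_index (2 ^ L) t))| <= om.
  move=> t t01; have /andP[h1 h2] := time_index_grid (K0 L) t01 erefl.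
  move: h1 h2; set g := grid _ _ _ => h1; rewrite /grid -natr1 mulrDl mul1r -/(grid _ _ _) -/g => h2.
  have /andP[t0 t1] := t01.
  have g0 : 0 <= g by rewrite divr_ge0.
  apply: H => //; first by rewrite g0 (le_trans h1).
  by rewrite ger0_norm ?subr_ge0// lerBlDl -natrX.
have := path_rate_diff (K0 L) n mC tC fC (ltW om0) cX D => R_le.
apply: (@le_trans _ _ (\sum_(f : tree (F (B L)) L)
  `|tree_poisson (rate (2 ^ L) C n X) f -
    tree_poisson (fun k => rate (2 ^ L) C n (fun=> X (grid R (2 ^ L) k)) k) f|)).
  rewrite [leRHS](bigID (@unsaturated J L (B L)))/= -[leLHS]addr0; apply: lerD.
    by apply: ler_sum => f uf; rewrite (fine_poisson_outcome mC bC tC pK uf).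
  exact: sumr_ge0.
apply: le_trans (tree_poisson_tv _ _ _ _) _; try by move=> k i; exact: rate_ge0.
apply: (@le_trans _ _ (2 * (2 * n%:R * om))); first by rewrite ler_wpM2l.
rewrite (_ : 2 * (2 * n%:R * om) = e * (n%:R / n.+1%:R)); last first.
  by rewrite /om; field; rewrite addrC natr1 pnatr_eq0.
rewrite ler_piMr//; first exact: ltW.
by rewrite ler_pdivrMr// mul1r ler_nat.
Qed.

End one_path.

(** Dominated convergence: the error given the path is at most 2 and tends to 0 almost surely. By
    [path_lawE] the mean of [chain_law] is [path_law]. *)
Lemma outcome_law_cvg (B : nat -> nat) (e : R) : observation_law n s2 Q -> 0 < e ->
  \forall L \near \oo, \sum_(f : tree (F (B L)) L | unsaturated f)
    `|fine (Q (outcome C f)) - path_law f| <= e.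
Proof.
move=> [d [Om [P [W [K [bmW pK QE]]]]]] e0.
pose g L w := path_error W K L (B L) w.
have mg L : measurable_fun [set: Om] (g L) by exact: (measurable_path_error K bmW).
have [_ _ cg] : [/\ P.-integrable setT (cst 0%E : Om -> \bar R),
    (fun L => \int[P]_w `|(g L w)%:E - 0|)%E @ \oo --> 0%E &
    (fun L => \int[P]_w (g L w)%:E)%E @ \oo --> (\int[P]_w (0 : \bar R))%E].
  apply: (@dominated_convergence _ Om R P setT measurableT (fun L => EFin \o g L)
    (cst 0%E) (cst 2%:E)) => //.
  - by move=> L; apply/measurable_EFinP; exact: mg.
  - have := bm_continuous bmW; apply: filterS2 pK => w pKw cW _.
    apply: cvg_EFin; first exact: nearW.
    exact: path_error_cvg.
  - by apply: (@probability_integrable _ _ _ P (cst 2) 2) => // x; rewrite ger0_norm.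
  - apply: aeW => w L _ /=; rewrite lee_fin ger0_norm; first exact: path_error_le2.
    exact: path_error_ge0.
have {cg} : \forall L \near \oo, (\int[P]_w (g L w)%:E < e%:E)%E.
  rewrite integral0 in cg; apply: (cg [set y | (y < e%:E)%E]).
  by apply: open_ereal_lt'; rewrite lte_fin.
apply: filterS => L /ltW gLe; pose a (f : tree (F (B L)) L) w := fine (K w (outcome C f)).
have bma f : bounded_measurable (a f) := bounded_measurable_outcome K f.
have bmc f := @bounded_measurable_chain_law _ _ P W bmW L (B L) f.
have bmac f : bounded_measurable (fun w => `|a f w - chain_law W f w|).
  apply: bounded_measurable_norm; apply: bounded_measurableD => //.
  exact: bounded_measurableN.
have QaE f : fine (Q (outcome C f)) = \int[P]_w a f w.
  rewrite QE; last exact: measurable_outcome.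
  rewrite /Rintegral; congr fine; apply: eq_integral => w _.
  by rewrite fineK// mass1_fin_num ?prob_kernel//; exact: measurable_outcome.
apply: (@le_trans _ _ (\sum_(f : tree (F (B L)) L | unsaturated f)
    \int[P]_w `|a f w - chain_law W f w|)).
  apply: ler_sum => f _; rewrite QaE (path_lawE bmW) -RintegralB//; last 2 first.
  - exact: bounded_measurable_integrable.
  - exact: bounded_measurable_integrable.
  apply: le_normr_Rintegral => //.
  apply: bounded_measurable_integrable; apply: bounded_measurableD => //.
  exact: bounded_measurableN.
rewrite -big_enum/= -Rintegral_sum; last first.
  by move=> f; exact: bounded_measurable_integrable.
rewrite -lee_fin /Rintegral fineK.
  apply: le_trans gLe; rewrite le_eqVlt; apply/orP; left; apply/eqP.
  by apply: eq_integral => w _; rewrite /g /path_error big_enum.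
have ig : P.-integrable setT (EFin \o g L).
  apply: (@probability_integrable _ _ _ P (g L) 2) => // w.
  by rewrite ger0_norm ?path_error_le2// path_error_ge0.
have := integrable_fin_num measurableT ig; apply: etrans.
by congr (_ \is a _); apply: eq_integral => w _; rewrite /g /path_error /= big_enum.
Qed.

End outcome_law.

Lemma leaf_surj (F : finType) (j : nat) (g : nat -> F) :
  exists f : tree F j, forall k, (k < 2 ^ j)%N -> leaf f k = g k.
Proof.
elim: j g => [|j IH] g; first by exists (g 0%N) => -[].
have [f1 H1] := IH g; have [f2 H2] := IH (fun k => g (2 ^ j + k)%N).
exists (f1, f2) => k; rewrite expnS mul2n -addnn => kj /=.
case: ltnP => h; first exact: H1.
by rewrite H2 ?subnKC// -(ltn_add2l (2 ^ j)) subnKC.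
Qed.

(** Inside [U] the two perturbations cost [2 * e]; outside, the overlap is at most the mass of [p0],
    which is at most [d + e]. *)
Lemma sum_min_perturbed (R : realType) (T : finType) (U : pred T)
    (p0 p1 q0 q1 : T -> R) (m e d : R) :
  (forall t, 0 <= p0 t) -> \sum_t p0 t = 1 ->
  m <= \sum_t Num.min (p0 t) (p1 t) ->
  1 - d <= \sum_(t | U t) q0 t ->
  \sum_(t | U t) `|q0 t - p0 t| <= e -> \sum_(t | U t) `|q1 t - p1 t| <= e ->
  m - d - 3 * e <= \sum_(t | U t) Num.min (q0 t) (q1 t).
Proof.
move=> p00 p01 mp dq e0 e1.
have h1 : \sum_(t | U t) Num.min (p0 t) (p1 t) <=
    \sum_(t | U t) (Num.min (q0 t) (q1 t) + (`|q0 t - p0 t| + `|q1 t - p1 t|)).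
  apply: ler_sum => t _; have := ler_norm (p0 t - q0 t); have := ler_norm (p1 t - q1 t).
  have := normr_ge0 (p0 t - q0 t); have := normr_ge0 (p1 t - q1 t).
  rewrite (distrC (q0 t)) (distrC (q1 t)).
  by case: (leP (p0 t) (p1 t)); case: (leP (q0 t) (q1 t)); lra.
have h2 : \sum_(t | ~~ U t) Num.min (p0 t) (p1 t) <= \sum_(t | ~~ U t) p0 t.
  by apply: ler_sum => t _; rewrite ge_min lexx.
have h3 : \sum_(t | U t) q0 t <= \sum_(t | U t) (p0 t + `|q0 t - p0 t|).
  by apply: ler_sum => t _; have := ler_norm (q0 t - p0 t); lra.
move: p01 mp; rewrite (bigID U)/= [in X in _ -> X -> _](bigID U)/=.
move: h1 h3; rewrite !big_split/=; lra.
Qed.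

Section atoms.
Context (R : realType).
Local Notation conf := (configuration R).
Local Notation obs := (observation R).
Variables (I : finType) (A : I -> set (R * R)).
Hypotheses (mA : forall i, measurable (A i)) (bA : forall i, bounded_set (A i)).

(* The complement of all the [A i] is excluded, so that atoms are bounded. *)
Definition atom (be : {ffun I -> bool}) : set (R * R) :=
  [set z | (exists i, A i z) /\ forall i, be i <-> A i z].

Lemma measurable_atom be : measurable (atom be).
Proof.
have -> : atom be = (\bigcup_(i in [set: I]) A i) `&`
    \bigcap_(i in [set: I]) (if be i then A i else ~` A i).
  apply/seteqP; split => z [[i]].
    move=> Az H; split; first by exists i.
    move=> k _; case: ifPn => [bk|nbk]; first exact/H.
    by move=> Ak; move/negP: nbk; apply; exact/H.
  move=> _ Az H; split; first by exists i.
  by move=> k; have := H k Logic.I; case: (be k).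
apply: measurableI.
  by apply: fin_bigcup_measurable => [|i _]; [exact: finite_finset|exact: mA].
apply: fin_bigcap_measurable => [|i _]; first exact: finite_finset.
by case: (be i) => //; exact: measurableC.
Qed.

Lemma bounded_atom be : bounded_set (atom be).
Proof.
have [[i bi]|nb] := pselect (exists i, be i).
  by apply: bounded_setS (bA i) => z [_ /(_ i)[+ _]]; apply.
exists 0; split => // x _ z [[i Az] H]; exfalso; apply: nb; exists i; exact/H.
Qed.

Lemma trivIset_atom : trivIset setT atom.
Proof.
apply/trivIsetP => be be' _ _ neq; apply/seteqP; split => // z [[_ H] [_ H']].
move/eqP: neq; apply; apply/ffunP => i; apply/idP/idP => [/H/H'|/H'/H] //.
Qed.

Lemma count_atoms (N : conf) (K : nat) i : (0 < K)%N ->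
  N (A i) = (\sum_(p : 'I_K * {ffun I -> bool} | p.2 i) N (cell K atom p.1 p.2))%E.
Proof.
move=> K0; rewrite (measure_disjoint_sum _ (fun p : 'I_K * {ffun I -> bool} => p.2 i)
  (E := fun p => cell K atom p.1 p.2)).
- congr (N _); apply/seteqP; split => z; last first.
    by move=> [[k be] /= bi [[_ H] _]]; exact/H.
  move=> Az; exists (Ordinal (time_index_lt K0 z.1), [ffun i => asbool (A i z)]).
    by rewrite /= ffunE; exact/asboolP.
  split => //=; split; first by exists i.
  by move=> k; rewrite ffunE; split => /asboolP.
- by move=> p; apply: measurable_cell => //; exact: measurable_atom.
- move=> [k be] [k' be'] z [/= [_ H] kz] [/= [_ H'] k'z]; congr pair.
    by apply: val_inj; rewrite /= -kz.
  by apply/ffunP => j; apply/idP/idP => [/H/H'|/H'/H].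
Qed.

(** The count of each [A i] is a sum of counts of cells, so all configurations of one outcome agree
    on every [A i] and hence on [E]. *)
Lemma outcome_determined (E : set obs) L B (f : tree {ffun {ffun I -> bool} -> 'I_B.+1} L) :
  (forall N N' : conf, (forall i, N (A i) = N' (A i)) -> E N -> E N') ->
  outcome atom f `<=` E \/ outcome atom f `<=` ~` E.
Proof.
move=> dE; have [[N [fN EN]]|nE] := pselect (exists N, outcome atom f N /\ E N).
  left => N' fN'; apply: dE EN => i.
  have K0 : (0 < 2 ^ L)%N by rewrite expn_gt0.
  rewrite !(count_atoms _ _ K0); apply: eq_bigr => p _.
  by rewrite (fN p) (fN' p).
by right => N fN EN; apply: nE; exists N.
Qed.

End atoms.

Section saturation.
Context (R : realType).
Local Notation conf := (configuration R).
Local Notation obs := (observation R).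
Variables (J : finType) (C : J -> set (R * R)).
Hypotheses (mC : forall j, measurable (C j)) (bC : forall j, bounded_set (C j)).

(** For fixed [L] the cells are finitely many and bounded, so every configuration is unsaturated for
    large [B], and continuity from below applies. *)
Lemma unsaturated_mass (Q : probability obs R) (L : nat) (e : R) : 0 < e ->
  exists B, 1 - e <=
    \sum_(f : tree {ffun J -> 'I_B.+1} L | unsaturated f) fine (Q (outcome C f)).
Proof.
move=> e0; pose V B := [set N : obs | exists2 f : tree {ffun J -> 'I_B.+1} L,
  unsaturated f & outcome C f N].
have mV B : measurable (V B) by exact: measurable_outcomes.
have mcell k j : measurable (cell (2 ^ L) C k j) by exact: measurable_cell.
have VI B N : (forall p : 'I_(2 ^ L) * J, exists2 k, (k < B)%N &
    (N : conf) (cell (2 ^ L) C p.1 p.2) = k%:R%:E) -> V B N.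
  move=> H.
  pose c k j : 'I_B.+1 := inord (Num.truncn (fine ((N : conf) (cell (2 ^ L) C k j)))).
  have [f fE] := @leaf_surj _ L (fun k => [ffun j => c k j]).
  have fN (p : 'I_(2 ^ L) * J) : (leaf f p.1 p.2 < B)%N /\
      (N : conf) (cell (2 ^ L) C p.1 p.2) = (leaf f p.1 p.2)%:R%:E.
    have [k kB kE] := H p; rewrite fE// ffunE /c kE /= natrK.
    by rewrite inordK// ltnS ltnW.
  exists f; first by apply/forallP => p; have [] := fN p.
  by move=> p; have [] := fN p.
have VU : \bigcup_B V B = setT.
  apply/seteqP; split => // N _.
  have /choice[k kE] : forall p : 'I_(2 ^ L) * J, exists k : nat,
      (N : conf) (cell (2 ^ L) C p.1 p.2) = k%:R%:E.
    move=> p; apply: count_nat; first exact: mcell.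
    by apply: bounded_setS (bC p.2); exact: subIsetl.
  exists (\max_p k p).+1 => //; apply: VI => p; exists (k p) => //.
  by rewrite ltnS; exact: leq_bigmax.
have ndV : nondecreasing_seq V.
  move=> m n mn; apply/subsetPset => N [f /forallP uf fN]; apply: VI => p.
  by exists (leaf f p.1 p.2); [exact: leq_trans (uf p) mn|exact: fN].
have cV : Q (V B) @[B --> \oo] --> (1 : \bar R)%E.
  rewrite -(probability_setT Q) -VU; apply: nondecreasing_cvg_mu => //.
  by rewrite VU.
have [B _ HB] : \forall B \near \oo, ((1 - e)%:E < Q (V B))%E.
  apply: (cV [set y | ((1 - e)%:E < y)%E]); apply: open_ereal_gt'.
  by rewrite lte_fin ltrBlDr ltrDl.
exists B; rewrite -lee_fin -sumEFin.
have Q1 : Q setT = 1%E by exact: probability_setT.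
under eq_bigr do rewrite (fineK (mass1_fin_num Q1 (measurable_outcome mC _))).
by rewrite (sum_outcome mC); apply/ltW/HB => /=.
Qed.

End saturation.

(** * Testing and estimation *)

Section path_law_theory.
Context (R : realType).
Variables (J : finType) (C : J -> set (R * R)).
Hypotheses (mC : forall j, measurable (C j)) (bC : forall j, bounded_set (C j))
  (tC : trivIset setT C).
Variables (n L B : nat).

Let fC j : ((lebesgue_measure \x lebesgue_measure)%E (C j) < +oo)%E.
Proof. exact: bounded_set_lam. Qed.

Let K0 : (0 < 2 ^ L)%N. Proof. by rewrite expn_gt0. Qed.

Let c0 : 0 <= n%:R / (2 ^ L)%:R :> R. Proof. by rewrite divr_ge0. Qed.

Let b0 := @leaf_law_ge0 R (2 ^ L) J C n B.
Let b1 := @sum_leaf_law R (2 ^ L) J C n B.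
Let bdom i x x' f := @leaf_law_dominated R (2 ^ L) K0 J C n mC tC fC B i x x' f.

Lemma path_law_ge0 s2 (f : tree {ffun J -> 'I_B.+1} L) : 0 <= path_law C n s2 f.
Proof. by apply: mixture_ge0 => z g; exact: (bridge_law_ge0 c0 b0 b1 bdom). Qed.

Lemma sum_path_law s2 :
  \sum_(f : tree {ffun J -> 'I_B.+1} L) path_law C n s2 f = 1.
Proof.
apply: (@sum_mixture _ _ _ _ (2 ^+ L * (n%:R / (2 ^ L)%:R))).
- by move=> z f; exact: (bridge_law_ge0 c0 b0 b1 bdom).
- by move=> z; exact: (sum_bridge_law c0 b0 b1 bdom).
- move=> z z' f zz.
  have := bridge_law_dominated c0 b0 b1 bdom
    (fun k => dyadic_sd (Num.sqrt s2) L k / Num.sqrt 2) 0 f (lexx 0) zz.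
  by rewrite subrr add0r.
Qed.

(** From one level to the next both sides of [w6] are multiplied by [al ^+ 6 = 2 * Num.sqrt 2].
    Normalising [w] to equal [v] at the top therefore reduces all these conditions to the single one
    on [v]. *)
Lemma hell_path_law_dyadic (s0 s1 eta v : R) : 0 < s0 -> 0 <= eta ->
  s1 = (1 + eta) * s0 -> 0 < v -> n%:R * Num.sqrt s1 <= v ^+ 6 ->
  hell (path_law C n s1 (L := L) (B := B)) (path_law C n s0 (L := L) (B := B)) <=
  (eta * (hell_const (Num.sqrt (Num.sqrt 2)) * v ^+ 2 + 32)) ^+ 2.
Proof.
move=> s00 eta0 s1E v0 nv.
have s10 : 0 < s1 by rewrite s1E mulr_gt0// ltr_pwDl.
have r0 : 0 < Num.sqrt 2 :> R by rewrite sqrtr_gt0.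
set r := Num.sqrt 2 in r0 *.
have r2 : r ^+ 2 = 2 by rewrite sqr_sqrtr.
set al := Num.sqrt r.
have al2 : al ^+ 2 = r by rewrite sqr_sqrtr// ltW.
have al4 : al ^+ 4 = 2 by rewrite -[4%N]/(2 * 2)%N exprM al2.
have r1 : 1 < r by rewrite -(@sqrtr1 R) ltr_sqrt// ltr1n.
have al1 : 1 < al by rewrite -(@sqrtr1 R) ltr_sqrt// ltr1n.
have al0 : 0 < al by exact: lt_trans al1.
have alL : 0 < al ^+ L by exact: exprn_gt0.
have rL : 0 < r ^+ L by exact: exprn_gt0.
pose w j := al ^+ j / al ^+ L * v.
have wL : w L = v by rewrite /w divff ?mul1r// gt_eqF.
rewrite -[X in hell_const _ * X ^+ 2]wL.
have sE s : 0 < s -> Num.sqrt s ^+ 2 = s :> R by move=> s_gt0; rewrite sqr_sqrtr// ltW.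
apply: (hell_path_law_le c0 b0 b1 bdom eta0 _ _ _ al1 al4).
- by move=> j; rewrite divr_gt0// dyadic_sd_gt0// sqrtr_gt0.
- by move=> j; rewrite divr_gt0// dyadic_sd_gt0// sqrtr_gt0.
- move=> j; rewrite /dyadic_sd !exprMn (sE _ s10) (sE _ s00) s1E; ring.
- by move=> j; rewrite mulr_gt0// divr_gt0// exprn_gt0.
- by move=> j; rewrite /w exprS; ring.
- move=> j; rewrite /dyadic_sd -/r.
  have -> : w j.+1 ^+ 6 = (r ^+ 3 / r ^+ L ^+ 3) * (r ^+ j) ^+ 3 * v ^+ 6.
    rewrite /w (exprS al j) -al2 (exprAC al 2 j) (exprAC al 2 L); field.
    by rewrite gt_eqF.
  have -> : 2 ^+ j.+1 * (n%:R / (2 ^ L)%:R) * (Num.sqrt s1 * r ^+ j / r ^+ L / r) =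
      (r ^+ 3 / r ^+ L ^+ 3) * (r ^+ j) ^+ 3 * (n%:R * Num.sqrt s1 / 2).
    rewrite natrX -r2 (exprS (r ^+ 2) j) (exprAC r 2 j) (exprAC r 2 L); field.
    by rewrite !gt_eqF.
  apply: ler_wpM2l.
    by rewrite !mulr_ge0 ?invr_ge0 ?exprn_ge0// ltW.
  have := sqrtr_ge0 s1; have := ler0n R n => n0 q0.
  have := mulr_ge0 n0 q0; move: nv; lra.
- by rewrite sqrtr_gt0.
- by rewrite sqrtr_gt0.
- by rewrite (sE _ s10) (sE _ s00).
Qed.

End path_law_theory.

Section testing.
Context (R : realType).
Local Notation obs := (observation R).
Variables (n : nat) (s0 s1 : R) (Q0 Q1 : probability obs R).
Hypotheses (s00 : 0 < s0) (s10 : 0 < s1).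
Hypotheses (law0 : observation_law n s0 Q0) (law1 : observation_law n s1 Q1).
Hypothesis close : forall (J : finType) (C : J -> set (R * R)) (L B : nat),
  (forall j, measurable (C j)) -> (forall j, bounded_set (C j)) -> trivIset setT C ->
  hell (path_law C n s1 (L := L) (B := B)) (path_law C n s0 (L := L) (B := B)) <= 1.

Let mass_ge (Q : probability obs R) (J : finType) (C : J -> set (R * R)) (L B : nat)
    (U : pred (tree {ffun J -> 'I_B.+1} L)) (E : set obs) :
  (forall j, measurable (C j)) -> measurable E ->
  (forall f, U f -> outcome C f `<=` E) ->
  \sum_(f | U f) fine (Q (outcome C f)) <= fine (Q E).
Proof.
move=> mC mE UE; have Q1' : Q setT = 1%E by exact: probability_setT.
rewrite -lee_fin -sumEFin (fineK (mass1_fin_num Q1' mE)).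
under eq_bigr do rewrite (fineK (mass1_fin_num Q1' (measurable_outcome mC _))).
rewrite (sum_outcome mC); apply: le_measure; rewrite ?inE.
- exact: measurable_outcomes.
- exact: mE.
- by move=> N [f Uf fN]; exact: UE fN.
Qed.

(** On an outcome contained in [E] the error under [Q0] pays the minimum of the two masses, on any
    other the error under [Q1] does. The overlap 1/8 loses 1/64 to saturation and 3/64 to freezing
    the path. *)
Lemma finitely_determined_error (E : set obs) : measurable E ->
  finitely_determined E -> 16^-1 <= fine (Q0 E) + fine (Q1 (~` E)).
Proof.
have num : 16^-1 <= 8^-1 - 64^-1 - 3 * 64^-1 :> R by lra.
move=> mE [I [A [mA bA dE]]].
have mC := measurable_atom mA; have bC := bounded_atom bA; have tC := @trivIset_atom R I A.
pose e : R := 64^-1; have e0 : 0 < e by rewrite invr_gt0.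
(* The cap is fixed for every [L] beforehand, and [L] is then chosen along this sequence of caps. *)
have [B HB] := choice (fun L => unsaturated_mass mC bC Q0 L e0).
have c0 := outcome_law_cvg mC bC tC s00 B law0 e0.
have c1 := outcome_law_cvg mC bC tC s10 B law1 e0.
have [L [h0 h1]] := filter_ex (filterI c0 c1).
have ov : 8^-1 <= \sum_(f : tree {ffun {ffun I -> bool} -> 'I_(B L).+1} L)
    Num.min (path_law (atom A) n s0 f) (path_law (atom A) n s1 f).
  under eq_bigr do rewrite minC.
  exact: (overlap_ge (path_law_ge0 mC bC tC n s1) (path_law_ge0 mC bC tC n s0)
    (sum_path_law mC bC tC n L (B L) s1) (sum_path_law mC bC tC n L (B L) s0)
    (close L (B L) mC bC tC)).
have H := sum_min_perturbed (path_law_ge0 mC bC tC n s0)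
  (sum_path_law mC bC tC n L (B L) s0) ov (HB L) h0 h1.
pose inE (f : tree {ffun {ffun I -> bool} -> 'I_(B L).+1} L) : bool :=
  asbool (outcome (atom A) f `<=` E).
have k0 : \sum_(f | unsaturated f && inE f) fine (Q0 (outcome (atom A) f)) <=
    fine (Q0 E).
  by apply: mass_ge => // f /andP[_ /asboolP].
have k1 : \sum_(f | unsaturated f && ~~ inE f) fine (Q1 (outcome (atom A) f)) <=
    fine (Q1 (~` E)).
  apply: mass_ge => //; first exact: measurableC.
  by move=> f /andP[_ /asboolP nE]; case: (outcome_determined mA f dE).
apply: le_trans (lerD k0 k1); apply: (@le_trans _ _ (8^-1 - e - 3 * e)).
  exact: num.
apply: le_trans H _; rewrite (bigID inE)/=; apply: lerD.
  by apply: ler_sum => f _; rewrite ge_min lexx.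
by apply: ler_sum => f _; rewrite ge_min lexx orbT.
Qed.

Lemma testing_error (E : set obs) : measurable E ->
  32^-1 <= fine (Q0 E) + fine (Q1 (~` E)).
Proof.
have arith (a b a' b' : R) : 16^-1 <= a' + b' -> a' <= a + 64^-1 ->
  b' <= b + 64^-1 -> 32^-1 <= a + b by lra.
move=> mE; have [_ /(_ 64^-1)] := approximable_measurable Q0 Q1 mE.
rewrite invr_gt0 => /(_ (ltr0n _ _)) [E' [mE' dE' d0 d1]].
have err := finitely_determined_error mE' dE'.
have Q01 : Q0 setT = 1%E by exact: probability_setT.
have Q11 : Q1 setT = 1%E by exact: probability_setT.
have msd : measurable (symdiff E E') by apply: measurableU; exact: measurableD.
have step (Q : probability obs R) (F F' : set obs) : Q setT = 1%E ->
    measurable F -> measurable F' -> F' `<=` F `|` symdiff E E' ->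
    (Q (symdiff E E') <= 64^-1%:E)%E -> fine (Q F') <= fine (Q F) + 64^-1.
  move=> QT mF mF' sub dQ; rewrite -lee_fin EFinD !fineK; try exact: mass1_fin_num.
  apply: (@le_trans _ _ (Q (F `|` symdiff E E'))).
    by apply: le_measure; rewrite ?inE//; exact: measurableU.
  by apply: le_trans (measureU2 _ mF msd) _; exact: leeD.
have h0 : fine (Q0 E') <= fine (Q0 E) + 64^-1.
  apply: step => // N E'N; have [EN|nEN] := pselect (E N); first by left.
  by right; right.
have h1 : fine (Q1 (~` E')) <= fine (Q1 (~` E)) + 64^-1.
  apply: step => //; try exact: measurableC.
  move=> N E'N; have [EN|nEN] := pselect (E N); last by left.
  by right; left.
exact: arith err h0 h1.
Qed.

End testing.

(** Two-point reduction: an estimate within [r] of [s0] is at distance at least [r] from [s1], and a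
    maximum is at least half of the sum. *)
Lemma estimation_error (R : realType) (Q0 Q1 : probability (observation R) R)
    (s0 s1 r c : R) (est : observation R -> R) :
  measurable_fun [set: observation R] est -> s0 + 2 * r <= s1 ->
  (forall E, measurable E -> 2 * c <= fine (Q0 E) + fine (Q1 (~` E))) ->
  (c%:E <= maxe (Q0 [set N | (r <= `|est N - s0|)%R])
                (Q1 [set N | (r <= `|est N - s1|)%R]))%E.
Proof.
move=> mest rs H; pose A s := [set N | r <= `|est N - s|].
have mA s : measurable (A s).
  have mn : measurable_fun [set: observation R] (fun N => `|est N - s|).
    by apply: measurableT_comp => //; exact: measurable_funB.
  have mb := measurable_fun_ler (measurable_cst r) mn.
  by have := mb measurableT [set true] Logic.I; rewrite setTI.
have sub : ~` A s0 `<=` A s1.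
  move=> N /negP; rewrite -ltNge /A /= ltr_norml => /andP[h1 h2].
  by rewrite ler_normr; apply/orP; right; move: rs h1 h2; lra.
have le1 : (Q1 (~` A s0) <= Q1 (A s1))%E.
  apply: le_measure; rewrite ?inE; [exact: measurableC|exact: mA|exact: sub].
have Q01 : Q0 setT = 1%E by exact: probability_setT.
have Q11 : Q1 setT = 1%E by exact: probability_setT.
have f0 := mass1_fin_num Q01 (mA s0); have f1 := mass1_fin_num Q11 (mA s1).
have f2 := mass1_fin_num Q11 (measurableC (mA s0)).
have := H _ (mA s0); rewrite le_max -(fineK f0) -(fineK f1) !lee_fin.
have : fine (Q1 (~` A s0)) <= fine (Q1 (A s1)) by exact: fine_le.
move: (fine (Q0 (A s0))) (fine (Q1 (A s1))) (fine _) => x y z.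
by case: (leP c x) => //= xc yz; lra.
Qed.

Theorem theorem4p1 (R : realType)
    (PP : nat -> R -> probability (observation R) R)
    (hPP : forall (n : nat) (s2 : R), (0 < n)%N -> 0 < s2 ->
       observation_law n s2 (PP n s2))
    (s02 : R) (hs02 : 0 < s02) :
  exists delta : R, 0 < delta /\
    (0 < limn_einf (fun n : nat =>
      let rate : R := (n%:R `^ (- 3^-1))%R in
      let err (est : observation R -> R) (s2 : R) : \bar R :=
        PP n s2 [set N | (delta / 2 * rate <= `|est N - s2|)%R] in
      ereal_inf [set maxe (err est s02) (err est (s02 + delta * rate)%R)
                | est in [set est : observation R -> R |
                           measurable_fun [set: observation R] est]]))%E.
Proof.
(* [delta] will satisfy [s1 <= 2 * s02 <= q], and [q >= 1] then gives [Num.sqrt s1 <= q ^+ 3] for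
   all [n] at once. *)
pose q := 1 + 2 * s02; pose al : R := Num.sqrt (Num.sqrt 2).
have q1 : 1 <= q by rewrite lerDl mulr_ge0// ltW.
have r1 : 1 < Num.sqrt 2 :> R by rewrite -[ltLHS]sqrtr1 ltr_sqrt// ltr1n.
have al1 : 1 < al by rewrite -(@sqrtr1 R) ltr_sqrt// (lt_trans _ r1)//.
have H0 := hell_const_ge0 al1.
have D32 : 32 <= hell_const al * q + 32.
  by rewrite lerDr mulr_ge0// (le_trans _ q1).
have D0 : 0 < hell_const al * q + 32 by apply: lt_le_trans D32.
(* With [h] the cube root of [n], [eta] is the inverse of [h * (hell_const al * q + 32)]. As
   [v ^+ 2 = h * q], this brings the Hellinger bound below 1. *)
pose delta := s02 / (hell_const al * q + 32).
have delta0 : 0 < delta by exact: divr_gt0.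
exists delta; split => //.
apply: (@lt_le_trans _ _ 64^-1%:E); first by rewrite lte_fin invr_gt0.
rewrite limn_einf_lim; apply: lime_ge; first exact: is_cvg_einfs.
(* The bound holds for every [n >= 1], the range in which [hPP] provides the laws. *)
exists 1%N => // m /= m0; apply: le_ereal_inf_tmp => _ [n /= mn <-].
have {m m0 mn} n0 : (0 < n)%N by exact: leq_trans mn.
apply: le_ereal_inf_tmp => _ [est /= mest <-].
set rate := n%:R `^ _; pose h : R := n%:R `^ 3^-1.
have nR1 : 1 <= n%:R :> R by rewrite ler1n.
have h3 : h ^+ 3 = n%:R.
  by rewrite -powR_mulrn ?powR_ge0// /h -powRrM mulVf ?powRr1.
have h1 : 1 <= h.
  by rewrite leNgt; apply/negP => hl; have : h ^+ 3 < 1;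
    [rewrite exprn_ilt1// powR_ge0|rewrite h3 ltNge nR1].
have h0 : 0 < h by exact: lt_le_trans h1.
have rateE : rate = h^-1 by rewrite /rate powRN.
have rate0 : 0 < rate by rewrite rateE invr_gt0.
set s1 := s02 + delta * rate.
have s10 : 0 < s1 by rewrite addr_gt0// mulr_gt0.
pose eta := delta * rate / s02.
have eta0 : 0 <= eta by rewrite divr_ge0 ?(ltW hs02)// mulr_ge0// ltW.
have s1E : s1 = (1 + eta) * s02 by rewrite /s1 /eta; field; rewrite gt_eqF.
have dr : delta * rate <= s02.
  rewrite rateE ler_pdivrMr// (@le_trans _ _ s02)//; last by rewrite ler_peMr// ltW.
  rewrite ler_pdivrMr// ler_peMr//; first exact: ltW.
  by apply: le_trans D32; rewrite ler1n.
have sq : Num.sqrt s1 <= q ^+ 3.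
  apply: (@le_trans _ _ q); last first.
    by rewrite exprS ler_peMr ?(le_trans _ q1)// exprn_ege1.
  have q0 : 0 <= q by exact: le_trans q1.
  rewrite -(ger0_norm q0) -sqrtr_sqr ler_wsqrtr// (@le_trans _ _ q)//.
    by rewrite /s1 /q; lra.
  by rewrite expr2 ler_peMr.
(* Then [v ^+ 6 = n * q ^+ 3] dominates [n * Num.sqrt s1], while [v ^+ 2] is only of the order of
   the cube root of [n]: this is where the rate comes from. *)
pose v := Num.sqrt (h * q).
have hq0 : 0 < h * q by rewrite mulr_gt0// (lt_le_trans _ q1).
have v0 : 0 < v by rewrite sqrtr_gt0.
have v2 : v ^+ 2 = h * q by rewrite sqr_sqrtr// ltW.
have nv : n%:R * Num.sqrt s1 <= v ^+ 6.
  by rewrite -[6%N]/(2 * 3)%N exprM v2 exprMn h3 ler_wpM2l.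
have small : (eta * (hell_const al * v ^+ 2 + 32)) ^+ 2 <= 1.
  rewrite exprn_ile1//.
    by rewrite mulr_ge0// addr_ge0// mulr_ge0// sqr_ge0.
  rewrite v2 /eta rateE /delta (_ : _ * _ =
    (hell_const al * q + 32 / h) / (hell_const al * q + 32)); last first.
    by field; rewrite !gt_eqF.
  rewrite ler_pdivrMr// mul1r lerD2l ler_pdivrMr// ler_peMr//.
apply: estimation_error => //.
  by rewrite /s1; lra.
rewrite (_ : 2 * 64^-1 = 32^-1); last by lra.
move=> E mE; apply: (testing_error hs02 s10 (hPP _ _ n0 hs02) (hPP _ _ n0 s10)) => //.
move=> J C L B mC bC tC; apply: le_trans small.
exact: (hell_path_law_dyadic mC bC tC L B hs02 eta0 s1E v0 nv).
Qed.
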